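(* Let $d\ge 1$ and let $X=(X^1,\dots,X^d)$ be an $\mathbb R^d$-valued random field on $T$ over $(\Omega_X,\mathcal F_X,P_X)$ such that, for each $l=1,\dots,d$, the component $X^l$ is a homogeneous random field with $E_X[|X^l(0)|^2]<\infty$ and $\mathrm{Var}_X[X^l(0)\mid \mathcal I^l_X]>0$ with $P_X$-probability 1. For each $l$ let $\{T_n^l\}_{n\ge1}$ be a pointwise averaging sequence of sets in $T$, let $k_n\in\mathbb N$, $k_n\uparrow\infty$, and let $\tau^l_{n,i}$ ($1\le i\le k_n$, $1\le l\le d$) be the randomizing points, uniformly distributed on $T_n^l$, described in the context. Put $\mu^l=E_X[X^l(0)]$ and assume that for each $l=1,\dots,d$ $$k_n^{1/2}(M_n^l-\mu^l)\Longrightarrow0\quad\text{in distribution with respect to } P_X .$$ Let $Z=(Z^1,\dots,Z^d)$ be a vector of independent standard normal random variables. Then, as $n\to\infty$, $$\left(\frac{\sum_{i=1}^{k_n}(X^1(\tau^1_{n,i})-\mu^1)}{k_n^{1/2}(V^1_n)^{1/2}},\dots,\frac{\sum_{i=1}^{k_n}(X^d(\tau^d_{n,i})-\mu^d)}{k_n^{1/2}(V^d_n)^{1/2}}\right)\Longrightarrow Z$$ in distribution with respect to $P_{X,\tau}$. If all $X^l$ are ergodic, then $$\left(\frac{\sum_{i=1}^{k_n}(X^1(\tau^1_{n,i})-\mu^1)}{k_n^{1/2}\sigma^1},\dots,\frac{\sum_{i=1}^{k_n}(X^d(\tau^d_{n,i})-\mu^d)}{k_n^{1/2}\sigma^d}\right)\Longrightarrow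 Z$$ in distribution with respect to $P_{X,\tau}$, where $\sigma^l=(\mathrm{Var}_X[X^l(0)])^{1/2}$.
   Context: $T=\mathbb R^m$ or $T=\mathbb Z^m$, $m\ge1$; $\mathcal B$ is the Borel $\sigma$-field of $T$ (all subsets if $T=\mathbb Z^m$); $\lambda$ is Lebesgue measure on $\mathbb R^m$, resp. counting measure on $\mathbb Z^m$. A random field is a family $X(t)$, $t\in T$, of random vectors on a probability space $(\Omega_X,\mathcal F_X,P_X)$ (expectation $E_X$); when $T=\mathbb R^m$ the map $(t,\omega)\mapsto X(t,\omega)$ is assumed $\mathcal B\otimes\mathcal F_X$-measurable. A field is homogeneous if all its finite-dimensional distributions are invariant under shifts of $T$. For a homogeneous field $Y$, $\mathcal I_Y$ denotes the $\sigma$-field of events $\{Y\in A\}$, $A$ in the product $\sigma$-field of the space of functions on $T$, with $P_X(\{Y\in A\}\triangle\{Y(\cdot+t)\in A\})=0$ for all $t\in T$; $Y$ is ergodic if every event of $\mathcal I_Y$ has probability $0$ or $1$. $\mathcal I^l_X:=\mathcal I_{X^l}$. $\mathrm{Var}_X[\cdot\mid\mathcal I]$ is the conditional variance. Pointwise averaging: a sequence $\{T_n\}$ of bounded Borel subsets of $T$ with $\lambda(T_n)>0$, $\lambda(T_n)\to\infty$, is pointwise averaging if for every scalar homogeneous random field $Y$ on $T$ (over any probability space) and every measurable $f:\mathbb R\to\mathbb R$ with $E[|f(Y(0))|]<\infty$, with probability 1, $\lim_{n}\frac1{\lambda(T_n)}\int_{T_n}f(Y(t))\lambda(dt)=E[f(Y(0))\mid\mathcal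 I_Y]$. Randomizing points: on a probability space $(\Omega_\tau,\mathcal F_\tau,P_\tau)$, for each $n$ there are $d$ mutually independent vectors $\tau_n^l=(\tau^l_{n,1},\dots,\tau^l_{n,k_n})$, $l=1,\dots,d$, where $\tau^l_{n,1},\dots,\tau^l_{n,k_n}$ are i.i.d. $T$-valued, uniformly distributed on $T_n^l$ (with respect to $\lambda$). The $\tau$'s are independent of $X$: everything is considered on the product space $(\Omega_X\times\Omega_\tau,\mathcal F_X\otimes\mathcal F_\tau,P_{X,\tau})$, $P_{X,\tau}:=P_X\times P_\tau$. $M_n^l:=\frac1{\lambda(T_n^l)}\int_{T_n^l}X^l(t)\lambda(dt)$, $V_n^l:=\frac1{\lambda(T_n^l)}\int_{T_n^l}(X^l(t)-M_n^l)^2\lambda(dt)$ (functions of $\omega\in\Omega_X$). A quotient with zero denominator is set to $0$. *)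

(* Defs.v *)
From HB Require Import structures.
From mathcomp Require Import all_boot all_order all_algebra.
From mathcomp Require Import all_classical all_reals all_analysis.
From mathcomp Require Import measurable_realfun.
Set Implicit Arguments.
Unset Strict Implicit.
Unset Printing Implicit Defensive.
Import Order.TTheory GRing.Theory Num.Theory.
Import numFieldNormedType.Exports.
Local Open Scope classical_set_scope.
Local Open Scope ring_scope.

Section borel_rV.
Variables (R : realType) (n : nat).

HB.instance Definition _ := @isMeasurable.Build default_measure_display
  'rV[R]_n <<s open >> (@sigma_algebra0 _ setT open) (@sigma_algebraC _ open)
  (@sigma_algebra_bigcup _ setT open).

Lemma measurable_coord (i : 'I_n) :
  measurable_fun setT (fun v : 'rV[R]_n => v ord0 i).
Proof.
apply: (measurability _ (RGenOpens.measurableE R)).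
move=> _ [_ [a [b ->] <-]]; rewrite setTI; apply: sub_sigma_algebra.
have /continuousP := @coord_continuous R 1 n ord0 i; apply.
exact: interval_open.
Qed.

Lemma measurable_fun_rV d (T : measurableType d) (f : T -> 'rV[R]_n) :
  (forall i, measurable_fun setT (fun x => f x ord0 i)) -> measurable_fun setT f.
Proof.
move=> mf; have mE : @measurable _ 'rV[R]_n = <<s open >> by [].
apply: (measurability _ mE) => _ [U oU <-]; rewrite setTI.
pose box (p : 'rV[rat]_n * nat) := [set v : 'rV[R]_n |
  forall i, `|v ord0 i - ratr (p.1 ord0 i)| < p.2.+1%:R^-1].
have -> : U = \bigcup_p (if `[< box p `<=` U >] then box p else set0).
  apply/seteqP; split => [v Uv|v [p _]]; last first.
    by case: asboolP => // + ?; exact.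
  have /nbhs_ballP[e /= e0 eU] : nbhs v U by exact: open_nbhs_nbhs.
  have [k ke] : exists k, k.+1%:R^-1 < e / 2.
    exists (Num.truncn (e / 2)^-1); rewrite -[ltRHS]invrK ltf_pV2 ?posrE//.
      by rewrite truncnS_gt.
    by rewrite invr_gt0 divr_gt0.
  have /choice[q qv] : forall i : 'I_n, exists q : rat,
      `|v ord0 i - ratr q| < k.+1%:R^-1.
    move=> i; have [|q] := @rat_in_itvoo R (v ord0 i - k.+1%:R^-1) (v ord0 i + k.+1%:R^-1).
      by rewrite ltrD2l gtrN// invr_gt0.
    by rewrite in_itv/= => /andP[h1 h2]; exists q; rewrite distrC ltr_distl h1 h2.
  exists (\row_i q i, k) => //; case: asboolP => [_ i|nU]; first by rewrite mxE.
  exfalso; apply: nU => w wq; apply: eU; split => // j i.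
  rewrite (ord1 j) -ball_normE/= (splitr e).
  rewrite -(subrKA (ratr (q i))) (le_lt_trans (ler_normD _ _))// ltrD//.
    exact: lt_trans (qv i) ke.
  rewrite distrC; have := wq i; rewrite mxE => /= /lt_trans; exact.
rewrite preimage_bigcup; apply: countable_bigcupT_measurable.
  exact: countableP.
move=> p; case: asboolP => _; last by rewrite preimage_set0.
rewrite [X in measurable X](_ : _ = \bigcap_(i in [set: 'I_n])
   ((fun x => f x ord0 i) @^-1` ball (ratr (p.1 ord0 i) : R) p.2.+1%:R^-1)).
  apply: fin_bigcap_measurable => // i _; rewrite -[X in measurable X]setTI.
  by apply: mf => //; exact: measurable_ball.
apply/seteqP; split => x /=.
  by move=> h i _; rewrite /= -ball_normE /= distrC; exact: h.
by move=> h i; have := h i I; rewrite /= -ball_normE /= distrC.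
Qed.

End borel_rV.

Section lebesgue_rV.
Variable R : realType.

(* Lebesgue measure on R^m is built coordinate by coordinate, R^(m+1) being the
   product of R and R^m along row_cons; lebesgue_rV_box states the
   characteristic property. *)
Definition row_cons m (p : R * 'rV[R]_m) : 'rV[R]_m.+1 :=
  \row_i (if unlift ord0 i is Some j then p.2 ord0 j else p.1).

Lemma measurable_row_cons m : measurable_fun setT (@row_cons m).
Proof.
apply: measurable_fun_rV => i; under eq_fun do rewrite mxE.
case: unliftP => [j _|_]; last exact: measurable_fst.
by apply: (measurableT_comp (measurable_coord j)); exact: measurable_snd.
Qed.

Definition lebesgue_cons m (mu : {sigma_finite_measure set 'rV[R]_m -> \bar R}) :
  set 'rV[R]_m.+1 -> \bar R :=
  pushforward (@lebesgue_measure R \x mu)%E (@row_cons m).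

Section lebesgue_cons.
Variables (m : nat) (mu : {sigma_finite_measure set 'rV[R]_m -> \bar R}).

Let mrow_cons A : measurable A -> measurable (@row_cons m @^-1` A).
Proof.
by move=> mA; rewrite -[X in measurable X]setTI; exact: measurable_row_cons.
Qed.

Let lebesgue_cons0 : lebesgue_cons mu set0 = 0%E.
Proof. by rewrite /lebesgue_cons /pushforward preimage_set0 measure0. Qed.

Let lebesgue_cons_ge0 A : (0 <= lebesgue_cons mu A)%E.
Proof. exact: (measure_ge0 (lebesgue_measure \x mu)%E). Qed.

Let lebesgue_cons_sigma_additive : semi_sigma_additive (lebesgue_cons mu).
Proof.
move=> F mF tF mUF; rewrite /lebesgue_cons /pushforward preimage_bigcup.
apply: (@measure_semi_sigma_additive _ _ _ (lebesgue_measure \x mu)%E).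
- by move=> k; exact: mrow_cons.
- apply/trivIsetP => /= i j _ _ ij; rewrite -preimage_setI.
  by move/trivIsetP : tF => /(_ _ _ _ _ ij) ->//; rewrite preimage_set0.
- by rewrite -preimage_bigcup; exact: mrow_cons.
Qed.

HB.instance Definition _ := isMeasure.Build _ _ _ (lebesgue_cons mu)
  lebesgue_cons0 lebesgue_cons_ge0 lebesgue_cons_sigma_additive.

Lemma lebesgue_cons_box (A : set R) (B : set 'rV[R]_m) :
  measurable A -> measurable B ->
  lebesgue_cons mu [set v | A (v ord0 ord0) /\ B (\row_j v ord0 (lift ord0 j))] =
  (lebesgue_measure A * mu B)%E.
Proof.
move=> mA mB; rewrite /lebesgue_cons /pushforward -product_measure1E//.
congr (_ _); apply/seteqP; split => -[x v] /=; rewrite /row_cons mxE unlift_none.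
all: rewrite (_ : \row_j _ = v)//; apply/rowP => j; by rewrite !mxE liftK.
Qed.

Let lebesgue_cons_sigma_finite : sigma_finite setT (lebesgue_cons mu).
Proof.
have /sigma_finiteP[F [FT ndF mF]] := sigma_finiteT (@lebesgue_measure R).
have /sigma_finiteP[G [GT ndG mG]] := sigma_finiteT mu.
exists (fun k => [set v : 'rV[R]_m.+1 |
    F k (v ord0 ord0) /\ G k (\row_j v ord0 (lift ord0 j))]).
  apply/esym; rewrite -subTset => v _.
  have [k _ Fk] : (\bigcup_k F k) (v ord0 ord0) by rewrite -FT.
  have [l _ Gl] : (\bigcup_k G k) (\row_j v ord0 (lift ord0 j)) by rewrite -GT.
  exists (maxn k l) => //; split.
    by move: Fk; exact/subsetPset/ndF/leq_maxl.
  by move: Gl; exact/subsetPset/ndG/leq_maxr.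
move=> k; have [mFk Fk] := mF k; have [mGk Gk] := mG k; split.
  apply: measurableI; rewrite -[X in measurable X]setTI.
    exact: (@measurable_coord R m.+1 ord0).
  apply: (_ : measurable_fun setT (fun v : 'rV[R]_m.+1 => \row_j v ord0 (lift ord0 j))) => //.
  apply: measurable_fun_rV => i; under eq_fun do rewrite mxE.
  exact: measurable_coord.
by rewrite lebesgue_cons_box// lte_mul_pinfty// ge0_fin_numE.
Qed.

HB.instance Definition _ := Measure_isSigmaFinite.Build _ _ _ (lebesgue_cons mu)
  lebesgue_cons_sigma_finite.

End lebesgue_cons.

Fixpoint lebesgue_rV m : {sigma_finite_measure set 'rV[R]_m -> \bar R} :=
  if m is k.+1 then lebesgue_cons (lebesgue_rV k) else dirac (0 : 'rV[R]_0).

Lemma lebesgue_rV_box m (A : 'I_m -> set R) : (forall i, measurable (A i)) ->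
  lebesgue_rV m [set v | forall i, A i (v ord0 i)] =
  (\prod_(i < m) lebesgue_measure (A i))%E.
Proof.
elim: m A => [|m IH] A mA /=.
  by rewrite big_ord0 diracE mem_set//= => -[].
have mB : measurable [set v : 'rV[R]_m | forall j, A (lift ord0 j) (v ord0 j)].
  rewrite [X in measurable X](_ : _ = \bigcap_(j in [set: 'I_m])
     ((fun v : 'rV[R]_m => v ord0 j) @^-1` A (lift ord0 j))).
    apply: fin_bigcap_measurable => // i _; rewrite -[X in measurable X]setTI.
    exact: measurable_coord.
  by apply/seteqP; split => v /= h j; [move=> _; exact: h|exact: (h j I)].
rewrite big_ord_recl -IH// -lebesgue_cons_box//; congr (_ _).
apply/seteqP; split => v /= h.
  by split => // j; rewrite mxE.
move=> i; case: (unliftP ord0 i) => [j ->|->]; last exact: h.1.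
by have := h.2 j; rewrite mxE.
Qed.

End lebesgue_rV.

(* An alias of 'rV[int]_m, so that it carries the sigma-field of all subsets. *)
Definition lattice (m : nat) := 'rV[int]_m.

Section lattice.
Variables (R : realType) (m : nat).

HB.instance Definition _ := Countable.on (lattice m).
HB.instance Definition _ := isPointed.Build (lattice m) (0 : 'rV[int]_m).
HB.instance Definition _ := @isMeasurable.Build default_measure_display (lattice m)
  discrete_measurable discrete_measurable0 discrete_measurableC
  discrete_measurableU.

Lemma sigma_finite_counting_lattice : sigma_finite setT (@counting (lattice m) R).
Proof.
exists (fun k => [set t | pickle t = k]).
  by apply/esym; rewrite -subTset => t _; exists (pickle t).
move=> k; split => //; have fk : finite_set [set t : lattice m | pickle t = k].
  case: (pselect (exists t : lattice m, pickle t = k)) => [[t tk]|nk].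
    apply: (sub_finite_set _ (finite_set1 t)) => u /= uk.
    by apply: (pcan_inj pickleK); rewrite uk.
  by apply: (sub_finite_set _ (finite_set0 _)) => u /= uk; apply: nk; exists u.
by rewrite /counting asboolT// ltry.
Qed.

HB.instance Definition _ := @Measure_isSigmaFinite.Build _ _ _ (@counting (lattice m) R)
  sigma_finite_counting_lattice.

End lattice.

Variant index_kind := Euclidean | Lattice.

Definition index_space (R : realType) (K : index_kind) (m : nat) :
    measurableType default_measure_display :=
  match K with Euclidean => 'rV[R]_m | Lattice => lattice m end.

Definition index_measure (R : realType) (K : index_kind) (m : nat) :
    {sigma_finite_measure set (index_space R K m) -> \bar R} :=
  match K return {sigma_finite_measure set (index_space R K m) -> \bar R} with
  | Euclidean => lebesgue_rV R m
  | Lattice => @counting (lattice m) R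
  end.

Definition index_origin (R : realType) (K : index_kind) (m : nat) :
    index_space R K m :=
  match K return index_space R K m with
  | Euclidean => (0 : 'rV[R]_m)
  | Lattice => (0 : 'rV[int]_m)
  end.

Definition index_add (R : realType) (K : index_kind) (m : nat) :
    index_space R K m -> index_space R K m -> index_space R K m :=
  match K return
    index_space R K m -> index_space R K m -> index_space R K m with
  | Euclidean => fun s t : 'rV[R]_m => s + t
  | Lattice => fun s t : 'rV[int]_m => s + t
  end.

Definition index_bounded (R : realType) (K : index_kind) (m : nat) :
    set (index_space R K m) -> Prop :=
  match K return set (index_space R K m) -> Prop with
  | Euclidean => fun A : set 'rV[R]_m => bounded_set A
  | Lattice => fun A : set 'rV[int]_m =>
      exists M : int, forall t, A t -> forall i, `|t ord0 i| <= M
  end.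

Definition space_average (R : realType) (K : index_kind) (m : nat)
    (A : set (index_space R K m)) (f : index_space R K m -> R) : R :=
  (fine (index_measure R K m A))^-1 * \int[index_measure R K m]_(t in A) f t.

Arguments index_origin {R K m}.

Section conditional_expectation.
Context d (Omega : measurableType d) (R : realType) (P : probability Omega R).
Implicit Types (I : set (set Omega)) (X W : Omega -> R).

Definition is_cond_exp I X W :=
  [/\ forall B : set R, measurable B -> I (W @^-1` B),
      P.-integrable setT (EFin \o W) &
      forall A, I A ->
        (\int[P]_(w in A) (W w)%:E = \int[P]_(w in A) (X w)%:E)%E].

(* An arbitrary version of E[X | I]; see cond_expP. *)
Definition cond_exp I X : Omega -> R := get (is_cond_exp I X).

Definition cond_var I X : Omega -> R :=
  cond_exp I (fun w => (X w - cond_exp I X w) ^+ 2).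

End conditional_expectation.

Lemma cond_expP d (Omega : measurableType d) (R : realType) (P : probability Omega R)
   (I : set (set Omega)) (X : Omega -> R) :
  sigma_algebra setT I -> I `<=` measurable ->
  P.-integrable setT (EFin \o X) -> is_cond_exp P I X (cond_exp P I X).
Proof.
move=> sI Im iX; rewrite /cond_exp; apply: getPex.
pose T' := g_sigma_algebraType I.
have mI : @measurable _ T' = I by exact: sigma_algebra_id.
pose phi : Omega -> T' := idfun.
have mphi : measurable_fun setT phi.
  by move=> _ A mA; rewrite setTI; apply: Im; rewrite -mI.
have mpre (A : set T') : measurable A -> @measurable _ Omega (phi @^-1` A).
  by move=> mA; apply: Im; rewrite -mI.
pose phiM : {mfun Omega >-> T'} :=
  MeasurableFun.Pack (MeasurableFun.Class (isMeasurableFun.Build _ _ _ _ phi mphi)).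
pose mu : probability T' R := distribution P phiM.
have [nu nuX] : exists nu : {charge set T' -> \bar R},
    forall A, nu A = (\int[P]_(w in A) (X w)%:E)%E.
  by unshelve eexists (pushforward (induced_charge iX) phi : {charge set T' -> \bar R}).
have numu : nu `<< mu.
  apply/null_content_dominatesP => A mA muA.
  have mA' := mpre _ mA.
  rewrite nuX; apply: null_set_integral => //.
  by apply: measurable_funTS; exact: measurable_int iX.
have fW x := Radon_Nikodym_fin_num x numu.
have /integrableP[mW iW] := Radon_Nikodym_integrable numu.
have nuE := Radon_Nikodym_integral numu.
set W := Radon_Nikodym nu mu in fW mW iW nuE.
have iWP : P.-integrable setT W.
  apply/integrableP; split; first exact: (measurableT_comp mW mphi).
  move: iW; rewrite ge0_integral_pushforward//.
  exact: measurableT_comp.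
have WE : EFin \o (fine \o W) = W by apply/funext => x; rewrite /= fineK.
exists (fine \o W); split.
- move=> B mB; rewrite -mI -[X in measurable X]setTI.
  have : measurable_fun setT (fine \o W) by exact: measurableT_comp.
  by apply.
- by rewrite WE.
- move=> A IA; have mA : @measurable _ T' A by rewrite mI.
  transitivity (\int[P]_(w in A) W w)%E.
    by apply: eq_integral => w _; rewrite -[in RHS]WE.
  transitivity (\int[mu]_(w in A) W w)%E; last by rewrite -nuE// nuX.
  rewrite integral_pushforward//.
  by apply: integrableS iWP => //; exact: Im.
Qed.

Definition mutually_independent d d' (Omega : measurableType d)
    (E : measurableType d') (R : realType) (P : probability Omega R)
    (I : finType) (X : I -> Omega -> E) :=
  forall (J : {set I}) (B : I -> set E),
    (forall i, i \in J -> measurable (B i)) ->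
    P (\bigcap_(i in [set` J]) (X i @^-1` B i)) =
    (\prod_(i in J) P (X i @^-1` B i))%E.

(* The limit Z may live on another probability space than the Y n. *)
Definition cvg_in_distribution d d' (Omega : measurableType d)
    (Omega' : measurableType d') (R : realType) (E : topologicalType)
    (P : probability Omega R) (Y : nat -> Omega -> E)
    (P' : probability Omega' R) (Z : Omega' -> E) :=
  forall f : E -> R, continuous f -> bounded_fun f ->
    ('E_P[f \o Y n] @[n --> \oo] --> 'E_P'[f \o Z])%E.

Definition standard_normal_vector d (Omega : measurableType d) (R : realType)
    (P : probability Omega R) (n : nat) (Z : Omega -> 'rV[R]_n) :=
  [/\ measurable_fun setT Z,
      forall i (B : set R), measurable B ->
        P [set w | B (Z w ord0 i)] = normal_prob 0 1 B &
      mutually_independent P (fun i w => Z w ord0 i)].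

Section random_field.
Context (R : realType) (K : index_kind) (m : nat).
Local Notation T := (index_space R K m).
Local Notation lambda := (index_measure R K m).

(* On the countable Z^m, joint measurability is automatic. *)
Definition random_field d d' (Omega : measurableType d) (E : measurableType d')
    (X : T -> Omega -> E) :=
  (forall t, measurable_fun setT (X t)) /\
  (K = Euclidean -> measurable_fun setT (fun p : T * Omega => X p.1 p.2)).

Definition component d (Omega : measurableType d) n
    (X : T -> Omega -> 'rV[R]_n) (l : 'I_n) : T -> Omega -> R :=
  fun t w => X t w ord0 l.

Definition cylinder_sigma_field : set (set (T -> R)) :=
  <<s [set C | exists t (B : set R),
               measurable B /\ C = [set y : T -> R | B (y t)]] >>.

Section scalar_field.
Context d (Omega : measurableType d) (P : probability Omega R).
Variable Y : T -> Omega -> R.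

Definition homogeneous :=
  forall n (t : 'I_n -> T) (h : T) (B : set 'rV[R]_n), measurable B ->
    P [set w | B (\row_i Y (index_add (t i) h) w)] =
    P [set w | B (\row_i Y (t i) w)].

Definition invariant_events : set (set Omega) :=
  [set F | exists A : set (T -> R),
     [/\ cylinder_sigma_field A,
         F = [set w | A (Y ^~ w)] &
         forall t, P ([set w | A (Y ^~ w)] `+`
                      [set w | A (fun s => Y (index_add s t) w)]) = 0%E]].

Definition ergodic := forall F, invariant_events F -> P F = 0%E \/ P F = 1%E.

End scalar_field.

Definition pointwise_averaging (S : nat -> set T) :=
  [/\ forall n, [/\ measurable (S n), index_bounded (S n) &
                    (0 < lambda (S n))%E],
      lambda (S n) @[n --> \oo] --> +oo%E &
      forall d (Omega : measurableType d) (P : probability Omega R)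
             (Y : T -> Omega -> R) (f : R -> R),
        random_field Y -> homogeneous P Y -> measurable_fun setT f ->
        P.-integrable setT (fun w => (f (Y index_origin w))%:E) ->
        {ae P, forall w,
           space_average (S n) (fun t => f (Y t w)) @[n --> \oo] -->
           cond_exp P (invariant_events P Y)
             (fun w => f (Y index_origin w)) w}].

Definition randomizing_points d (Omega : measurableType d)
    (P : probability Omega R) (q k : nat) (S : 'I_q -> set T)
    (tau : 'I_q -> Omega -> k.-tuple T) :=
  [/\ forall l, measurable_fun setT (tau l),
      mutually_independent P tau,
      forall l, mutually_independent P (fun i w => tnth (tau l w) i) &
      forall l i (B : set T), measurable B ->
        P [set w | B (tnth (tau l w) i)] =
        (fine (lambda (B `&` S l)) / fine (lambda (S l)))%:E].

End random_field.

(* Main.v *)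
(* Fix a realization of X. Under P_tau the summands (X^l(tau_i) - mu^l) / (k_n N)^(1/2), with
   N the normalizer (V_n^l or the variance), are i.i.d., and their moments are spatial averages
   over T_n^l. Lindeberg's replacement argument bounds the distance between E_tau[psi(sum)] and
   the Gaussian integral of a smooth psi by an explicit error, in which the spatial averages
   converge for almost every realization. Only the drift k_n^(1/2) (M_n^l - mu^l) is merely
   small in probability: one restricts to the event that it is small and takes P_X-expectations
   by dominated convergence. The assumption on the drift also forces E[X^l(0) | I^l] = mu^l,
   whence V_n^l tends to Var[X^l(0) | I^l]. Finally the independence of tau^1, ..., tau^d turns
   the expectation of a product of functions psi_l of the coordinates into a product, and such
   products, for psi_l a spline, suffice to obtain convergence in distribution. *)
Require Import Defs.
From HB Require Import structures.
From mathcomp Require Import all_boot all_order all_algebra.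
From mathcomp Require Import all_classical all_reals all_analysis.
From mathcomp Require Import measurable_realfun ring lra.
Import Order.TTheory GRing.Theory Num.Theory.
Import numFieldNormedType.Exports.
Local Open Scope classical_set_scope.
Local Open Scope ring_scope.
Set Implicit Arguments.
Unset Strict Implicit.
Unset Printing Implicit Defensive.

(** * Integrals over probability spaces and the standard normal law *)

(** The drift tends to 0 in probability only, so for a fixed realization the randomized sums need
    not converge, and a limit theorem realization by realization is out of reach. It is replaced by
    a bound valid for each large n, in which the drift is a separate summand: the drift can be
    required to stay below a deterministic [eta n], and the event where it does not is removed by
    Markov's inequality. The components of X may depend on one another in any way. This does no
    harm: given X, the expectation of each factor tends in mean to a constant, a Gaussian integral,
    and products of bounded factors converge along with them. Lindeberg's condition along a
    realization involves truncation levels that grow with n, whereas pointwise averaging speaks of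
    one fixed function of Y(t). Averages are therefore taken at fixed integer levels, and their
    limits, conditional expectations of truncated squares, are shown to become arbitrarily small.
    Splines serve twice: their Taylor expansion with cubic remainder reduces to algebra on truncated
    cubes, and their differences form a partition of unity. *)

Lemma Rintegral_EFin d (T : measurableType d) (R : realType)
    (mu : {measure set T -> \bar R}) (D : set T) (f : T -> R) :
  measurable D -> mu.-integrable D (EFin \o f) ->
  (\int[mu]_(x in D) f x)%:E = (\int[mu]_(x in D) (f x)%:E)%E.
Proof. by move=> mD iF; rewrite fineK// integrable_fin_num. Qed.

Section bounded_integral.
Context d (T : measurableType d) (R : realType) (P : probability T R).
Implicit Types f g : T -> R.

Lemma bounded_integrable f (C : R) : measurable_fun setT f ->
  (forall x, `|f x| <= C) -> P.-integrable setT (EFin \o f).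
Proof.
move=> mf fC; apply: measurable_bounded_integrable => //.
  by rewrite (le_lt_trans (probability_le1 P measurableT)) ?ltry.
exists C; split; first exact: num_real.
by move=> M CM x _; rewrite /= (le_trans (fC x))// ltW.
Qed.

Lemma prob_Rintegral_cst (r : R) : \int[P]_x r = r.
Proof.
by rewrite Rintegral_cst// -[X in _ * fine X]/(P setT) probability_setT/= mulr1.
Qed.

Lemma prob_le_Rintegral f g : P.-integrable setT (EFin \o f) ->
  P.-integrable setT (EFin \o g) -> (forall x, f x <= g x) ->
  \int[P]_x f x <= \int[P]_x g x.
Proof. by move=> *; apply: le_Rintegral. Qed.

Lemma prob_Rintegral_bound f (C : R) : measurable_fun setT f ->
  (forall x, `|f x| <= C) -> `|\int[P]_x f x| <= C.
Proof.
move=> mf fC; have iF := bounded_integrable mf fC.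
rewrite (le_trans (le_normr_Rintegral _ _))//.
rewrite -[leRHS](prob_Rintegral_cst C) prob_le_Rintegral//.
  exact: integrable_norm.
exact: finite_measure_integrable_cst.
Qed.

End bounded_integral.

Section bounded_fubini.
Context d d' (T : measurableType d) (T' : measurableType d') (R : realType).
Variables (P : probability T R) (Q : probability T' R) (f : T * T' -> R) (C : R).
Hypothesis mf : measurable_fun setT f.
Hypothesis fC : forall x, `|f x| <= C.

Let iF : (P \x Q)%E.-integrable setT (EFin \o f).
Proof. exact: (bounded_integrable (P \x Q)%E mf fC). Qed.

Let mfx x : measurable_fun setT (fun y => f (x, y)).
Proof. by apply: measurableT_comp => //; exact: measurable_pair1. Qed.

Let mfy y : measurable_fun setT (fun x => f (x, y)).
Proof. by apply: measurableT_comp => //; exact: measurable_pair2. Qed.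

Let iFx x : Q.-integrable setT (EFin \o (fun y => f (x, y))).
Proof. exact: (bounded_integrable Q (mfx x) (fun y => fC (x, y))). Qed.

Let iFy y : P.-integrable setT (EFin \o (fun x => f (x, y))).
Proof. exact: (bounded_integrable P (mfy y) (fun x => fC (x, y))). Qed.

Lemma measurable_Rintegral1 : measurable_fun setT (fun x => \int[Q]_y f (x, y)).
Proof.
apply/measurable_EFinP; rewrite (_ : _ \o _ = fubini_F Q (EFin \o f)).
  exact: (measurable_fubini_F iF).
by apply/funext => x /=; rewrite Rintegral_EFin.
Qed.

Lemma measurable_Rintegral2 : measurable_fun setT (fun y => \int[P]_x f (x, y)).
Proof.
apply/measurable_EFinP; rewrite (_ : _ \o _ = fubini_G P (EFin \o f)).
  exact: (measurable_fubini_G iF).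
by apply/funext => x /=; rewrite Rintegral_EFin.
Qed.

Let iF1 : P.-integrable setT (EFin \o (fun x => \int[Q]_y f (x, y))).
Proof.
apply: (bounded_integrable P measurable_Rintegral1 (C := C)) => x.
exact: prob_Rintegral_bound.
Qed.

Let iF2 : Q.-integrable setT (EFin \o (fun y => \int[P]_x f (x, y))).
Proof.
apply: (bounded_integrable Q measurable_Rintegral2 (C := C)) => x.
exact: prob_Rintegral_bound.
Qed.

Lemma Rintegral_prod : \int[(P \x Q)%E]_z f z = \int[P]_x \int[Q]_y f (x, y).
Proof.
apply: EFin_inj; rewrite (Rintegral_EFin _ iF)// (Rintegral_EFin _ iF1)//.
rewrite -(integral12_prod_meas1 iF); apply: eq_integral => x _.
by rewrite (Rintegral_EFin _ (iFx x)).
Qed.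

Lemma Rfubini : \int[P]_x \int[Q]_y f (x, y) = \int[Q]_y \int[P]_x f (x, y).
Proof.
rewrite -Rintegral_prod; apply: EFin_inj.
rewrite (Rintegral_EFin _ iF)// (Rintegral_EFin _ iF2)//.
rewrite -(integral21_prod_meas1 iF); apply: eq_integral => x _.
by rewrite (Rintegral_EFin _ (iFy x)).
Qed.

End bounded_fubini.

Section std_normal.
Variable R : realType.

Let mid : measurable_fun setT (idfun : measurableTypeR R -> R).
Proof. by move=> _ A mA; rewrite setTI. Qed.

Let idm : {mfun measurableTypeR R >-> R} :=
  MeasurableFun.Pack (MeasurableFun.Class (isMeasurableFun.Build _ _ _ _ _ mid)).

(* The library puts normal_prob on measurableTypeR R, which is not unifiable with
   the canonical measurable structure of R. *)
Definition std_normal : probability R R := distribution (normal_prob 0 1) idm.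

Lemma ge0_integral_std_normal (f : R -> \bar R) :
  measurable_fun setT f -> (forall x, 0 <= f x)%E ->
  (\int[std_normal]_x f x = \int[normal_prob 0 1]_x f x)%E.
Proof. by move=> mf f0; rewrite ge0_integral_distribution. Qed.

End std_normal.

(** * Moments and rotation invariance of the standard normal law *)

Section gaussian.
Context {R : realType}.
Notation mu := (@lebesgue_measure R).
Notation gauss := (std_normal R).

(** The Radon-Nikodym derivative of the normal law and [normal_pdf] have the same integral over
    every measurable set, hence agree almost everywhere, and the change of variables for dominated
    measures can be read with the explicit density. *)
Lemma ge0_integral_normal_prob (f : R -> \bar R) :
  measurable_fun setT f -> (forall x, 0 <= f x)%E ->
  (\int[gauss]_x f x = \int[mu]_x (f x * (normal_pdf 0 1 x)%:E))%E.
Proof.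
move=> mf f0.
pose nu := normal_prob (0 : R) 1 : {finite_measure set _ -> \bar R}.
have numu : nu `<< mu by exact: (normal_prob_dominates 0 1).
rewrite ge0_integral_std_normal//.
rewrite -(Radon_Nikodym_SigmaFinite.change_of_variables numu f0 measurableT mf).
apply: ae_eq_integral => //.
- apply: emeasurable_funM => //.
  exact: measurable_int (Radon_Nikodym_SigmaFinite.f_integrable numu).
- by apply: emeasurable_funM => //; apply/measurable_EFinP; exact: measurable_normal_pdf.
- have : ae_eq mu setT (Radon_Nikodym_SigmaFinite.f nu mu)
      (EFin \o normal_pdf 0 1).
    apply: integral_ae_eq => //.
    + exact: (Radon_Nikodym_SigmaFinite.f_integrable numu).
    + apply/measurable_EFinP; exact: measurable_normal_pdf.
    + by move=> A _ mA; rewrite -Radon_Nikodym_SigmaFinite.f_integral.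
  by apply: filterS => x /[apply] -> /=.
Qed.

Lemma integral_normal_prob (f : R -> R) :
  measurable_fun setT f -> (forall x, 0 <= f x) ->
  (\int[gauss]_x (f x)%:E = \int[mu]_x (f x * normal_pdf 0 1 x)%:E)%E.
Proof.
move=> mf f0; rewrite (ge0_integral_normal_prob (f := EFin \o f))//.
exact/measurable_EFinP.
Qed.

Lemma normal_peak_scale (s : R) : 0 < s -> normal_peak s = s^-1 * normal_peak 1.
Proof.
move=> s0; rewrite /normal_peak.
have -> : Num.sqrt (s ^+ 2 * pi *+ 2) = s * Num.sqrt (1 ^+ 2 * pi *+ 2).
  by rewrite expr1n mul1r -mulrnAr sqrtrM ?sqr_ge0// sqrtr_sqr gtr0_norm.
by rewrite invfM.
Qed.

(** The exponent is a multiple of [x ^+ 2], so its linear lower bound under the integral brings out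
    the second moment. *)
Lemma normal_pdf_scale (s x : R) : 0 < s ->
  s * normal_pdf 0 s x = normal_pdf 0 1 x * expR (x ^+ 2 / 2 * (1 - s ^- 2)).
Proof.
move=> s0; rewrite !normal_pdfE ?gt_eqF// normal_peak_scale// /normal_fun.
rewrite -!mulrA mulVKf ?gt_eqF//; congr (_ * _).
rewrite -expRD; congr expR; rewrite subr0 expr1n -(mulr_natl 1) -mulr_natl.
by field; rewrite gt_eqF.
Qed.

(** Completing the square; since the shifted density has mass one, this yields the Laplace transform
    of the standard normal law. *)
Lemma normal_pdf_tilt (h x : R) :
  normal_pdf 0 1 x * expR (h * x) = expR (h ^+ 2 / 2) * normal_pdf h 1 x.
Proof.
rewrite !normal_pdfE// mulrCA -!mulrA; congr (_ * _).
rewrite /normal_fun -!expRD; congr expR.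
by rewrite subr0 expr1n -(mulr_natl 1); field.
Qed.

(** Bayes' formula for [u = a x + b y] with independent standard normal x and y: on the left the
    density of x times that of u given x, on the right the density of u times that of x given u,
    which is normal with mean [a * u] and standard deviation [b]. *)
Lemma normal_pdf_rotation (a b u x : R) : 0 < b -> a ^+ 2 + b ^+ 2 = 1 ->
  normal_pdf 0 1 x * (normal_pdf 0 1 ((u - a * x) / b) / b) =
  normal_pdf 0 1 u * normal_pdf (a * u) b x.
Proof.
move=> b0 ab1; have b2 : b ^+ 2 = 1 - a ^+ 2 by rewrite -ab1 addrAC subrr add0r.
rewrite !normal_pdfE ?gt_eqF// (normal_peak_scale b0) /normal_fun.
set p := normal_peak 1.
transitivity (p * p / b * (expR (- (x - 0) ^+ 2 / (1 ^+ 2 *+ 2)) *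
   expR (- ((u - a * x) / b - 0) ^+ 2 / (1 ^+ 2 *+ 2)))); first by ring.
transitivity (p * p / b * (expR (- (u - 0) ^+ 2 / (1 ^+ 2 *+ 2)) *
   expR (- (x - a * u) ^+ 2 / (b ^+ 2 *+ 2)))); last by ring.
congr (_ * _); rewrite -!expRD; congr expR.
rewrite !subr0 expr1n -(mulr_natl 1) -(mulr_natl (b ^+ 2)) expr_div_n b2.
have : 1 - a ^+ 2 != 0 by rewrite -b2 gt_eqF// exprn_gt0.
by move=> ?; field.
Qed.

Let mpdf m s : measurable_fun setT (EFin \o normal_pdf (m : R) s).
Proof. by apply/measurable_EFinP; exact: measurable_normal_pdf. Qed.

Let M2 := (\int[gauss]_x (x ^+ 2 : R)%:E)%E.

(** The integrated inequality is [1 + (1 - s ^- 2) / 2 * M2 <= s]. Its positive coefficient rules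
    out an infinite [M2], and it gives [M2 <= 2 s^2 / (s + 1)], which is at most [s ^+ 2] because
    [s > 1]. *)
Let M2_ub (s : R) : 1 < s -> (M2 <= (s ^+ 2)%:E)%E.
Proof.
move=> s1; have s0 : 0 < s by rewrite (lt_trans _ s1).
have s21 : 0 < 1 - s ^- 2 by rewrite subr_gt0 invf_lt1 ?exprn_gt0// exprn_egt1.
have M0 : (0 <= M2)%E by apply: integral_ge0 => x _; rewrite lee_fin sqr_ge0.
suff : (1 + ((1 - s ^- 2) / 2)%:E * M2 <= s%:E)%E.
  case: M2 M0 => [M| |]//=; last first.
    by move=> _; rewrite gt0_muley ?lte_fin ?divr_gt0.
  rewrite -EFinM -EFinD !lee_fin => M0 h.
  have {}h : (1 - s ^- 2) / 2 * M <= s - 1 by rewrite lerBrDl.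
  have e1 : (1 - s ^- 2) / 2 * (2 * s ^+ 2 / (s + 1)) = s - 1.
    by field; rewrite (gt_eqF s0)/= gt_eqF// addr_gt0.
  have e2 : M <= 2 * s ^+ 2 / (s + 1).
    by rewrite -(ler_pM2l (_ : 0 < (1 - s ^- 2) / 2)) ?divr_gt0// e1.
  rewrite (le_trans e2)// ler_pdivrMr ?addr_gt0// mulrC ler_pM2l ?exprn_gt0//.
  lra.
rewrite /M2 integral_normal_prob//; last by move=> x; exact: sqr_ge0.
rewrite -[X in (X + _)%E](integral_normal_pdf 0 1).
rewrite -ge0_integralZl//; last 3 first.
  - by apply/measurable_EFinP/measurable_funM => //; exact: measurable_normal_pdf.
  - by move=> x _; rewrite lee_fin mulr_ge0 ?sqr_ge0 ?normal_pdf_ge0.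
  - by rewrite lee_fin divr_ge0// ltW.
rewrite -ge0_integralD//; last 4 first.
  - by move=> x _; rewrite lee_fin normal_pdf_ge0.
  - exact: mpdf.
  - move=> x _; rewrite -EFinM lee_fin mulr_ge0 ?divr_ge0 ?(ltW s21)//.
    by rewrite mulr_ge0 ?sqr_ge0 ?normal_pdf_ge0.
  - by apply/measurable_EFinP/measurable_funM => //; apply: measurable_funM => //;
      exact: measurable_normal_pdf.
rewrite -[leRHS]mule1 -(integral_normal_pdf 0 s) -ge0_integralZl//; last 3 first.
  - exact: mpdf.
  - by move=> x _; rewrite lee_fin normal_pdf_ge0.
  - by rewrite lee_fin ltW.
apply: ge0_le_integral => //.
- move=> x _; rewrite -EFinM -EFinD lee_fin addr_ge0 ?normal_pdf_ge0// mulr_ge0//.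
    by rewrite divr_ge0// ltW.
  by rewrite mulr_ge0 ?sqr_ge0 ?normal_pdf_ge0.
- apply: emeasurable_funD; first exact: mpdf.
  by apply/measurable_EFinP/measurable_funM => //; apply: measurable_funM => //;
      exact: measurable_normal_pdf.
- by apply: emeasurable_funM => //; exact: mpdf.
- move=> x _; rewrite -!EFinM -EFinD lee_fin normal_pdf_scale//.
  rewrite (_ : _ + _ = normal_pdf 0 1 x * (1 + x ^+ 2 / 2 * (1 - s ^- 2))); last first.
    by ring.
  by rewrite ler_wpM2l ?normal_pdf_ge0// expR_ge1Dx.
Qed.

(** For [s < 1] the coefficient of the second moment changes sign; that term is moved to the other
    side, so that again only nonnegative functions are integrated. *)
Let M2_lb (s : R) : 0 < s -> s < 1 -> ((s ^+ 2)%:E <= M2)%E.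
Proof.
move=> s0 s1.
have s21 : 0 < s ^- 2 - 1 by rewrite subr_gt0 invf_gt1 ?exprn_gt0// exprn_ilt1// ltW.
have M0 : (0 <= M2)%E by apply: integral_ge0 => x _; rewrite lee_fin sqr_ge0.
suff : (1 <= s%:E + ((s ^- 2 - 1) / 2)%:E * M2)%E.
  case: M2 M0 => [M M0|_ _|//]; last by rewrite leey.
  rewrite -EFinM -EFinD !lee_fin => h.
  have {}h : 1 - s <= (s ^- 2 - 1) / 2 * M by rewrite lerBlDl.
  have e1 : (s ^- 2 - 1) / 2 * (2 * s ^+ 2 / (s + 1)) = 1 - s.
    by field; rewrite (gt_eqF s0)/= gt_eqF// addr_gt0.
  have e2 : 2 * s ^+ 2 / (s + 1) <= M.
    by rewrite -(ler_pM2l (_ : 0 < (s ^- 2 - 1) / 2)) ?divr_gt0// e1.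
  apply: le_trans e2; rewrite ler_pdivlMr ?addr_gt0// mulrC ler_pM2r ?exprn_gt0//.
  lra.
rewrite /M2 integral_normal_prob//; last by move=> x; exact: sqr_ge0.
rewrite -[leLHS](integral_normal_pdf 0 1).
rewrite -[X in (X + _)%E]mule1 -(integral_normal_pdf 0 s) -ge0_integralZl//; last 3 first.
  - exact: mpdf.
  - by move=> x _; rewrite lee_fin normal_pdf_ge0.
  - by rewrite lee_fin ltW.
rewrite -ge0_integralZl//; last 3 first.
  - by apply/measurable_EFinP/measurable_funM => //; exact: measurable_normal_pdf.
  - by move=> x _; rewrite lee_fin mulr_ge0 ?sqr_ge0 ?normal_pdf_ge0.
  - by rewrite lee_fin divr_ge0// ltW.
rewrite -ge0_integralD//; last 4 first.
  - by move=> x _; rewrite -EFinM lee_fin mulr_ge0 ?normal_pdf_ge0// ltW.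
  - by apply: emeasurable_funM => //; exact: mpdf.
  - move=> x _; rewrite -EFinM lee_fin mulr_ge0 ?divr_ge0 ?(ltW s21)//.
    by rewrite mulr_ge0 ?sqr_ge0 ?normal_pdf_ge0.
  - by apply/measurable_EFinP/measurable_funM => //; apply: measurable_funM => //;
      exact: measurable_normal_pdf.
apply: ge0_le_integral => //.
- by move=> x _; rewrite lee_fin normal_pdf_ge0.
- exact: mpdf.
- apply: emeasurable_funD; first by apply: emeasurable_funM => //; exact: mpdf.
  by apply/measurable_EFinP/measurable_funM => //; apply: measurable_funM => //;
      exact: measurable_normal_pdf.
- move=> x _; rewrite -!EFinM -EFinD lee_fin normal_pdf_scale//.
  rewrite -lerBlDr.
  rewrite (_ : _ - _ = normal_pdf 0 1 x * (1 + x ^+ 2 / 2 * (1 - s ^- 2))); last first.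
    by ring.
  by rewrite ler_wpM2l ?normal_pdf_ge0// expR_ge1Dx.
Qed.

(* Both bounds come from integrating expR u >= 1 + u against the density, u being
   the log-ratio of the densities of N(0, s^2) and N(0, 1). *)
Lemma normal_second_moment : (\int[gauss]_x (x ^+ 2 : R)%:E = 1)%E.
Proof.
rewrite -/M2; apply/eqP; rewrite eq_le; apply/andP; split.
  apply/lee_addgt0Pr => e e0.
  (* For [0 < t <= 1], [(1 + t) ^+ 2 <= 1 + 3 t]; hence the choice [e / 3]. *)
  have [t t0 te] : exists2 t : R, 0 < t & (1 + t) ^+ 2 <= 1 + e.
    exists (Num.min 1 (e / 3)); first by rewrite lt_min ltr01 divr_gt0.
    have [h|h] := leP 1 (e / 3).
      by nra.
    by nra.
  by rewrite (le_trans (M2_ub (_ : 1 < 1 + t)))// ?ltrDl//; rewrite lee_fin.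
apply/lee_addgt0Pr => e e0.
have [t /andP[t0 t1] te] : exists2 t : R, 0 < t < 1 & 1 - e <= (1 - t) ^+ 2.
  exists (Num.min 2^-1 (e / 2)).
    by rewrite lt_min invr_gt0 ltr0n divr_gt0//= gt_min invf_lt1 ?ltr1n.
  have [h|h] := leP 2^-1 (e / 2); nra.
rewrite -leeBlDr//; apply: le_trans (M2_lb (_ : 0 < 1 - t) _).
- by rewrite lee_fin.
- lra.
- lra.
Qed.

Lemma integrable_normal_sqr :
  gauss.-integrable setT (fun x : R => (x ^+ 2)%:E).
Proof.
apply/integrableP; split; first exact/measurable_EFinP.
under eq_integral do rewrite gee0_abs ?lee_fin ?sqr_ge0//.
by rewrite normal_second_moment ltry.
Qed.

Lemma integrable_normal_id :
  gauss.-integrable setT (fun x : R => x%:E).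
Proof.
have i1 := @finite_measure_integrable_cst _ _ R gauss setT 1 measurableT.
apply: le_integrable (integrableD _ i1 integrable_normal_sqr) => //.
  exact/measurable_EFinP.
move=> x _ /=; rewrite lee_fin [leRHS]ger0_norm ?addr_ge0 ?sqr_ge0//.
by rewrite -(real_normK (num_real x)); have := normr_ge0 x; nra.
Qed.

(** Integrating [expR u >= 1 + u] at [u = h x] and using the Laplace transform gives
    [1 + h * m <= expR (h ^+ 2 / 2)] for h of either sign. The right side is 1 up to order two in h,
    so the linear term must vanish. *)
Lemma normal_first_moment : \int[gauss]_x (x : R) = 0.
Proof.
set m := (X in X = 0).
have mexp (h : R) : measurable_fun setT (fun x : R => expR (h * x)).
  by apply: measurableT_comp => //; exact: measurable_funM.
have exph (h : R) : (\int[gauss]_x (expR (h * x))%:E = (expR (h ^+ 2 / 2))%:E)%E.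
  rewrite integral_normal_prob//.
  under eq_integral do rewrite mulrC normal_pdf_tilt EFinM.
  rewrite ge0_integralZl//; last 2 first.
    - exact: mpdf.
    - by move=> x _; rewrite lee_fin normal_pdf_ge0.
  by rewrite integral_normal_pdf mule1.
have iexp (h : R) : gauss.-integrable setT (fun x : R => (expR (h * x))%:E).
  apply/integrableP; split.
    by apply/measurable_EFinP; exact: mexp.
  under eq_integral do rewrite gee0_abs ?lee_fin ?expR_ge0//.
  by rewrite exph ltry.
have hm (h : R) : 1 + h * m <= expR (h ^+ 2 / 2).
  rewrite -[leRHS]/(fine (expR (h ^+ 2 / 2))%:E) -exph.
  rewrite -(RintegralZl _ _ integrable_normal_id)//.
  have i1 := @finite_measure_integrable_cst _ _ R gauss setT 1 measurableT.
  have ih := integrableZl measurableT h integrable_normal_id.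
  rewrite -[X in X + _](prob_Rintegral_cst gauss) -RintegralD//.
  apply: (@prob_le_Rintegral _ _ _ gauss (fun x => 1 + h * x)
    (fun x => expR (h * x)) (integrableD _ i1 ih) (iexp h)) => // x.
  exact: expR_ge1Dx.
(* With [q = h ^+ 2 <= 1], [expR (- q / 2) >= 1 - q / 2] and [(1 + q) (1 - q / 2) >= 1] give
   [expR (q / 2) <= 1 + q]. *)
have hm2 (h : R) : h ^+ 2 <= 1 -> h * m <= h ^+ 2.
  move=> h1; have := hm h; have e1 : expR (h ^+ 2 / 2) <= 1 + h ^+ 2.
    have := expR_ge1Dx (- (h ^+ 2 / 2)); have := expR_gt0 (h ^+ 2 / 2).
    have := expRxMexpNx_1 (h ^+ 2 / 2).
    set E := expR (h ^+ 2 / 2); set F := expR _; have := sqr_ge0 h.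
    set q := h ^+ 2 in h1 * => q0 EF E0 F0.
    by nra.
  lra.
(* If m is nonzero with absolute value at most 1, [h = m / 2] gives [m^2 / 2 <= m^2 / 4]; for a
   larger absolute value, h equal to 1 or -1 according to the sign of m contradicts [h * m <= 1]. *)
apply/eqP; rewrite eq_le; apply/andP; split; rewrite leNgt; apply/negP => m0.
  have [m1|m1] := leP m 1.
    have := hm2 (m / 2); nra.
  have := hm2 1; nra.
have [m1|m1] := leP (-1) m.
  have := hm2 (m / 2); nra.
have := hm2 (-1); nra.
Qed.

Let affine_substitution (a b : R) (G : R -> R) : 0 < b -> continuous G ->
  (forall u, 0 <= G u) ->
  (\int[mu]_u (G u)%:E = \int[mu]_y (G (a + b * y) * b)%:E)%E.
Proof.
move=> b0 cG G0; pose F (y : R) := a + b * y.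
have dF (y : R) : is_derive y 1 F b.
  have := is_deriveD (is_derive_cst a y 1) (is_deriveZ b (is_derive_id y (1 : R))).
  by rewrite add0r scaler1.
have F'E : F^`()%classic = cst b.
  by apply/funext => y; rewrite derive1E; apply: derive_val.
rewrite (increasing_ge0_integration_by_substitutionT (F := F))//.
- by apply: eq_integral => y _; rewrite F'E.
- by move=> x y xy; rewrite /F ltrD2l ltr_pM2l.
- by rewrite F'E => ?; exact: cvg_cst.
- by rewrite F'E; exact: is_cvg_cst.
- by rewrite F'E; exact: is_cvg_cst.
- rewrite /F; apply: cvg_comp (_ : _ @ -oo --> -oo) _; last first.
    exact: cvg_addrl_Ny.
  by apply: gt0_cvgMrNy.
- rewrite /F; apply: cvg_comp (_ : _ @ +oo --> +oo) _; last first.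
    exact: cvg_addrl.
  by apply: gt0_cvgMry.
Qed.

(** The inner variable is changed to [u = a x + b y], Tonelli exchanges the integrals, and by
    [normal_pdf_rotation] the integral over x is then the mass of a normal density. *)
Let normal_rotation_ge0 (G : R -> R) (a b : R) : 0 < b -> a ^+ 2 + b ^+ 2 = 1 ->
  continuous G -> (forall u, 0 <= G u) ->
  (\int[gauss]_x \int[gauss]_y (G (a * x + b * y))%:E =
   \int[gauss]_u (G u)%:E)%E.
Proof.
move=> b0 ab1 cG G0.
have mG : measurable_fun setT G by exact: continuous_measurable_fun.
pose K (x u : R) := G u * (normal_pdf 0 1 ((u - a * x) / b) / b).
have mK : measurable_fun setT (fun p : R * R => K p.1 p.2).
  apply: measurable_funM; first exact: measurableT_comp.
  apply: measurable_funM => //.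
  apply: measurableT_comp; first exact: measurable_normal_pdf.
  apply: measurable_funM => //; apply: measurable_funB => //.
  exact: measurable_funM.
have K0 x u : 0 <= K x u.
  by rewrite /K mulr_ge0// mulr_ge0 ?normal_pdf_ge0// invr_ge0 ltW.
have inner x : (\int[gauss]_y (G (a * x + b * y))%:E =
    \int[mu]_u (K x u)%:E)%E.
  rewrite integral_normal_prob//; last first.
    by apply: measurableT_comp => //; apply: measurable_funD => //; exact: measurable_funM.
  rewrite (affine_substitution (a * x) b0 (G := K x))//; last first.
    move=> u; apply: cvgM; first exact: cG.
    apply: cvgM; last exact: cvg_cst.
    apply: (cvg_comp (fun u => (u - a * x) / b) (normal_pdf 0 1)); last first.
      by apply: continuous_normal_pdf; exact: oner_neq0.
    apply: cvgM; last exact: cvg_cst.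
    by apply: cvgB; [exact: cvg_id|exact: cvg_cst].
  apply: eq_integral => y _; congr EFin; rewrite /K -mulrA; congr (_ * _).
  by rewrite divfK ?gt_eqF// addrAC subrr add0r mulrAC divff ?mul1r// gt_eqF.
under eq_integral do rewrite inner.
have mKE : measurable_fun setT (fun p : R * R => (K p.1 p.2)%:E).
  exact/measurable_EFinP.
have mI : measurable_fun setT (fun x => \int[mu]_u (K x u)%:E)%E.
  apply: (@measurable_fun_fubini_tonelli_F _ _ _ _ R mu (fun p => (K p.1 p.2)%:E)) => //.
  by move=> p; rewrite lee_fin.
rewrite [LHS]ge0_integral_normal_prob//; last first.
  by move=> x; apply: integral_ge0 => u _; rewrite lee_fin.
pose L (x u : R) := K x u * normal_pdf 0 1 x.
have L0 x u : 0 <= L x u by rewrite /L mulr_ge0// normal_pdf_ge0.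
have mL : measurable_fun setT (fun p : R * R => (L p.1 p.2)%:E).
  apply/measurable_EFinP/measurable_funM => //.
  by apply: measurableT_comp => //; exact: measurable_normal_pdf.
transitivity (\int[mu]_x \int[mu]_u (L x u)%:E)%E.
  apply: eq_integral => x _; rewrite -ge0_integralZr//.
  - apply/measurable_EFinP; apply: measurable_funM => //; apply: measurable_funM => //.
    apply: measurableT_comp; first exact: measurable_normal_pdf.
    by apply: measurable_funM => //; exact: measurable_funB.
  - by move=> u _; rewrite lee_fin.
  - by rewrite lee_fin normal_pdf_ge0.
rewrite (@fubini_tonelli _ _ _ _ R mu mu (fun p => (L p.1 p.2)%:E))//; last first.
  by move=> p; rewrite lee_fin.
rewrite integral_normal_prob//; apply: eq_integral => u _ /=.
have LE x : L x u = G u * normal_pdf 0 1 u * normal_pdf (a * u) b x.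
  rewrite /L /K -mulrA -[in RHS]mulrA -normal_pdf_rotation//.
  by congr (_ * _); rewrite mulrC.
under eq_integral do rewrite LE EFinM.
rewrite ge0_integralZl//; last 3 first.
  - exact: mpdf.
  - by move=> x _; rewrite lee_fin normal_pdf_ge0.
  - by rewrite lee_fin mulr_ge0// normal_pdf_ge0.
by rewrite integral_normal_pdf mule1.
Qed.

Lemma normal_rotation (g : R -> R) (C w a b c : R) : 0 < b -> 0 < c ->
  a ^+ 2 + b ^+ 2 = c ^+ 2 -> continuous g -> (forall x, `|g x| <= C) ->
  \int[gauss]_x \int[gauss]_y g (w + a * x + b * y) =
  \int[gauss]_z g (w + c * z).
Proof.
move=> b0 c0 abc cg gC.
pose G u := C + g (w + c * u).
have G0 u : 0 <= G u.
  by rewrite /G; have := gC (w + c * u); rewrite ler_norml => /andP[]; lra.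
have cG : continuous G.
  move=> u; apply: cvgD; first exact: cvg_cst.
  apply: (cvg_comp (fun u => w + c * u) g); last exact: cg.
  by apply: cvgD; [exact: cvg_cst|apply: cvgM; [exact: cvg_cst|exact: cvg_id]].
have mg : measurable_fun setT g by exact: continuous_measurable_fun.
have GC u : `|G u| <= C + C.
  rewrite ger0_norm// lerD2l.
  by have := gC (w + c * u); rewrite ler_norml => /andP[].
have mG : measurable_fun setT G by exact: continuous_measurable_fun.
have b'0 : 0 < b / c by rewrite divr_gt0.
have ab1 : (a / c) ^+ 2 + (b / c) ^+ 2 = 1.
  by rewrite !expr_div_n -mulrDl abc divff// gt_eqF// exprn_gt0.
have mG2 : measurable_fun setT (fun p : R * R => G (a / c * p.1 + b / c * p.2)).
  by apply: measurableT_comp => //; apply: measurable_funD; exact: measurable_funM.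
have mG1 x : measurable_fun setT (fun y => G (a / c * x + b / c * y)).
  by apply: measurableT_comp => //; apply: measurable_funD => //; exact: measurable_funM.
have iG := bounded_integrable gauss mG GC.
have iG1 x := bounded_integrable gauss (mG1 x) (fun y => GC _).
have mIG := measurable_Rintegral1 gauss gauss mG2 (fun p => GC _).
have bIG x := prob_Rintegral_bound gauss (mG1 x) (fun y => GC _).
have iIG := bounded_integrable gauss mIG bIG.
have : \int[gauss]_x \int[gauss]_y G (a / c * x + b / c * y) =
  \int[gauss]_z G z.
  apply: EFin_inj; rewrite (Rintegral_EFin _ iG)// (Rintegral_EFin _ iIG)//.
  transitivity (\int[gauss]_x \int[gauss]_y (G (a / c * x + b / c * y))%:E)%E.
    2: exact: normal_rotation_ge0.
  apply: eq_integral => x _.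
  by rewrite (Rintegral_EFin _ (iG1 x)).
have iC := @finite_measure_integrable_cst _ _ R gauss setT C measurableT.
have mgc : measurable_fun setT (fun z => g (w + c * z)).
  by apply: measurableT_comp => //; apply: measurable_funD => //; exact: measurable_funM.
have igc := bounded_integrable gauss mgc (fun y => gC _).
rewrite [RHS]RintegralD// prob_Rintegral_cst.
pose g2 (p : R * R) := g (w + a * p.1 + b * p.2).
have mg2 : measurable_fun setT g2.
  apply: measurableT_comp => //; apply: measurable_funD; last exact: measurable_funM.
  by apply: measurable_funD => //; exact: measurable_funM.
have mg1 x : measurable_fun setT (fun y => g2 (x, y)).
  by apply: measurableT_comp => //; apply: measurable_funD => //; exact: measurable_funM.
have ig1 x := bounded_integrable gauss (mg1 x) (fun y => gC _).
have mIg := measurable_Rintegral1 gauss gauss mg2 (fun p => gC _).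
have bIg x := prob_Rintegral_bound gauss (mg1 x) (fun y => gC _).
have iIg := bounded_integrable gauss mIg bIg.
have inner x : \int[gauss]_y G (a / c * x + b / c * y) =
    C + \int[gauss]_y g2 (x, y).
  rewrite -[in RHS](prob_Rintegral_cst gauss C) -RintegralD//.
  apply: eq_Rintegral => y _; rewrite /G /g2 /=; congr (_ + g _).
  by field; rewrite gt_eqF.
under eq_Rintegral do rewrite inner.
rewrite RintegralD// prob_Rintegral_cst => /addrI; exact.
Qed.

End gaussian.

(** * Independence *)

Lemma Rintegral_distribution d d' (T : measurableType d) (T' : measurableType d')
    (R : realType) (P : probability T R) (X : {mfun T >-> T'}) (f : T' -> R) :
  measurable_fun setT f -> P.-integrable setT (EFin \o (f \o X)) ->
  \int[distribution P X]_y f y = \int[P]_w f (X w).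
Proof.
by move=> mf iF; congr fine; rewrite (integral_distribution (f := EFin \o f))//;
  exact/measurable_EFinP.
Qed.

Section independent_pair.
Context d d1 d2 (T : measurableType d) (T1 : measurableType d1)
  (T2 : measurableType d2) (R : realType) (P : probability T R).
Variables (A : T -> T1) (B : T -> T2) (f : T1 * T2 -> R) (C : R).
Hypotheses (mA : measurable_fun setT A) (mB : measurable_fun setT B).
Hypothesis AB : forall U V, measurable U -> measurable V ->
  P (A @^-1` U `&` B @^-1` V) = (P (A @^-1` U) * P (B @^-1` V))%E.
Hypotheses (mf : measurable_fun setT f) (fC : forall x, `|f x| <= C).

(** By [AB] the joint law agrees with the product of the two laws on rectangles, hence everywhere,
    and Fubini's theorem applies. *)
Lemma independent_pair_integral :
  \int[P]_w f (A w, B w) = \int[P]_w \int[P]_w' f (A w, B w').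
Proof.
have mAB : measurable_fun setT (fun w => (A w, B w)) by exact: measurable_fun_pair.
pose A' : {mfun T >-> T1} := MeasurableFun.Pack
  (MeasurableFun.Class (isMeasurableFun.Build _ _ _ _ _ mA)).
pose B' : {mfun T >-> T2} := MeasurableFun.Pack
  (MeasurableFun.Class (isMeasurableFun.Build _ _ _ _ _ mB)).
pose AB' : {mfun T >-> (T1 * T2)%type} := MeasurableFun.Pack
  (MeasurableFun.Class (isMeasurableFun.Build _ _ _ _ _ mAB)).
rewrite -(Rintegral_distribution (X := AB') mf); last first.
  by apply: bounded_integrable (fun w => fC _); exact: measurableT_comp.
transitivity (\int[(distribution P A' \x distribution P B')%E]_z f z).
  congr fine; apply: eq_measure_integral => Z mZ _; apply/esym.
  apply: (@product_measure_unique _ _ _ _ _ _ _ (distribution P AB')) => //.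
have mf1 x : measurable_fun setT (fun y => f (x, y)).
  by apply: measurableT_comp => //; exact: measurable_pair1.
rewrite (Rintegral_prod _ _ mf fC) (Rintegral_distribution (X := A')); last 2 first.
- exact: (measurable_Rintegral1 (distribution P A') (distribution P B') mf fC).
- apply: (@bounded_integrable _ _ _ _ _ C).
    apply: (measurableT_comp _ mA).
    exact: (measurable_Rintegral1 (distribution P A') (distribution P B') mf fC).
  by move=> w; apply: prob_Rintegral_bound.
apply: eq_Rintegral => w _; rewrite (Rintegral_distribution (X := B'))//.
apply: (@bounded_integrable _ _ _ _ _ C); first exact: measurableT_comp.
by move=> w' /=; exact: fC.
Qed.

End independent_pair.

Section mutual_independence.
Context d d' (T : measurableType d) (E : measurableType d') (R : realType)
  (P : probability T R) (I : finType) (X : I -> T -> E).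
Hypothesis mX : forall i, measurable_fun setT (X i).
Hypothesis indX : mutually_independent P X.
Implicit Types (J : {set I}) (j : I).

Let mXp i B : measurable B -> measurable (X i @^-1` B).
Proof. by move=> mB; rewrite -[X in measurable X]setTI; exact: mX. Qed.

(** A pi-system generating the sigma-field of the [X i] with [i] in [J]. Every index of [J] carries
    a set, possibly [setT], which makes stability under intersection immediate. *)
Definition rectangles J : set (set T) :=
  [set H | exists B : I -> set E, (forall i, measurable (B i)) /\
     H = \bigcap_(i in [set` J]) (X i @^-1` B i)].

Lemma rectangles_measurable J : rectangles J `<=` measurable.
Proof. by move=> _ [B [mB ->]]; apply: fin_bigcap_measurable => // i _; exact: mXp. Qed.

Lemma rectangles_setI J : setI_closed (rectangles J).
Proof.
move=> _ _ [B [mB ->]] [B' [mB' ->]].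
exists (fun i => B i `&` B' i); split; first by move=> i; exact: measurableI.
by rewrite -bigcapI.
Qed.

Lemma rectangles_setT J : rectangles J setT.
Proof.
exists (fun=> setT); split => //.
by apply/esym/seteqP; split => // w _ i _.
Qed.

(** As functions of [H], both sides are finite measures. They agree on the pi-system of rectangles
    by mutual independence, hence on the sigma-field it generates. *)
Lemma independent_of_generated J j H D : j \notin J -> measurable D ->
  <<s rectangles J >> H ->
  P (H `&` X j @^-1` D) = (P H * P (X j @^-1` D))%E.
Proof.
move=> jJ mD sH; have mXD := mXp j mD.
have pD0 : 0 <= fine (P (X j @^-1` D)) by exact: fine_ge0.
pose m2 := mscale (NngNum pD0) P.
have m2E A : m2 A = (P A * P (X j @^-1` D))%E.
  by rewrite /m2 /mscale/= fineK ?fin_num_measure// muleC.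
rewrite -m2E -[LHS]/(mrestr P mXD H).
apply: (@g_sigma_algebra_measure_unique _ _ _ (rectangles J) _ (fun=> setT)) => //.
- exact: rectangles_measurable.
- by move=> _; exact: rectangles_setT.
- by rewrite bigcup_const//; exists 0%N.
- exact: rectangles_setI.
- move=> _ [B [mB ->]]; rewrite -[RHS]/(m2 _) m2E /= /mrestr.
  (* [D] is stored at the index [j], which is free because [j] is not in [J]; the intersection
     becomes a rectangle over [j |: J]. *)
  pose B' i := if i == j then D else B i.
  have mB' i : measurable (B' i) by rewrite /B'; case: ifP.
  have -> : \bigcap_(i in [set` J]) (X i @^-1` B i) =
      \bigcap_(i in [set` J]) (X i @^-1` B' i).
    apply: eq_bigcapr => i /= iJ; rewrite /B'; case: eqP iJ => // ->.
    by move=> jJ'; rewrite jJ' in jJ.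
  have -> : X j @^-1` D = X j @^-1` B' j by rewrite /B' eqxx.
  have -> : \bigcap_(i in [set` J]) (X i @^-1` B' i) `&` X j @^-1` B' j =
      \bigcap_(i in [set` j |: J]) (X i @^-1` B' i).
    apply/seteqP; split => w /=.
      by move=> [wJ wj] i /=; rewrite !inE => /predU1P[->//|]; exact: wJ.
    move=> wJ; split => [i /= iJ|]; apply: wJ => /=.
      by rewrite !inE iJ orbT.
    by rewrite !inE eqxx.
  by rewrite !indX// big_setU1//= muleC.
- move=> _; apply: le_lt_trans (ltry 1).
  exact: probability_le1 (measurableI _ _ measurableT mXD).
Qed.

(** The same points with a smaller sigma-field: being a function of the [X i], [i] in [J], becomes
    ordinary measurability on this type. *)
Definition generated J : measurableType _ := g_sigma_algebraType (rectangles J).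

Lemma measurable_generated J i : i \in J ->
  measurable_fun setT (X i : generated J -> E).
Proof.
move=> iJ _ B mB; rewrite setTI; apply: sub_sigma_algebra.
exists (fun k => if k == i then B else setT); split.
  by move=> k; case: ifP.
apply/seteqP; split => w /=.
  by move=> wB k /= kJ; case: eqP => [->|].
by move=> /(_ i iJ); rewrite /= eqxx.
Qed.

Lemma generated_measurable d1 (T1 : measurableType d1) J (U : T -> T1) :
  measurable_fun setT (U : generated J -> T1) -> measurable_fun setT U.
Proof.
move=> mU _ B mB; rewrite setTI; have := mU measurableT B mB; rewrite setTI.
apply: smallest_sub; last exact: rectangles_measurable.
exact: sigma_algebra_measurable.
Qed.

(** The form in which independence is used later: [U] depends on the earlier variables, such as a
    partial sum, and [X j] is a fresh one that may be integrated first. *)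
Lemma independent_generated_integral d1 (T1 : measurableType d1) J j
    (U : T -> T1) (f : T1 * E -> R) (C : R) : j \notin J ->
  measurable_fun setT (U : generated J -> T1) ->
  measurable_fun setT f -> (forall x, `|f x| <= C) ->
  \int[P]_w f (U w, X j w) = \int[P]_w \int[P]_w' f (U w, X j w').
Proof.
move=> jJ mU mf fC; apply: (independent_pair_integral _ _ _ mf fC) => //.
  exact: generated_measurable mU.
move=> A B mA mB; apply: (independent_of_generated jJ) => //.
by have := mU measurableT A mA; rewrite setTI.
Qed.

Lemma independent_prod_integral (h : I -> E -> R) (C : R) J :
  (forall i, measurable_fun setT (h i)) -> (forall i x, `|h i x| <= C) ->
  \int[P]_w \prod_(i in J) h i (X i w) = \prod_(i in J) \int[P]_w h i (X i w).
Proof.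
move=> mh hC; have [n] := ubnP #|J|; elim: n J => // n IH J.
have [->|[j jJ]] := set_0Vmem J.
  move=> _; rewrite big_set0; under eq_Rintegral do rewrite big_set0.
  exact: prob_Rintegral_cst.
rewrite (cardsD1 j) jJ add1n ltnS => Jn.
have jJ' : j \notin J :\ j by rewrite !inE eqxx.
pose U w := \prod_(i in J :\ j) h i (X i w).
pose K := \prod_(i in J :\ j) C.
have UK w : `|U w| <= K by rewrite normr_prod; apply: ler_prod => i _; rewrite normr_ge0 hC.
(* The first variable is clipped to [[-K, K]], where [U] takes its values, so that [f] is bounded on
   the whole product space. *)
pose f (p : R * E) := Num.max (- K) (Num.min K p.1) * h j p.2.
have fE w w' : U w * h j w' = f (U w, w').
  rewrite /f /=; have := UK w; rewrite ler_norml => /andP[U1 U2].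
  by rewrite (min_idPr U2) (max_idPr U1).
have K0 : 0 <= K.
  by have := UK point; apply: le_trans; exact: normr_ge0.
have C0 : 0 <= C.
  by have := hC j point; apply: le_trans; exact: normr_ge0.
have mU : measurable_fun setT (U : generated (J :\ j) -> R).
  rewrite (_ : U = fun w => \prod_(i <- enum (J :\ j)) h i (X i w)); last first.
    by apply/funext => w; rewrite big_enum.
  apply: measurable_prod => i; rewrite mem_enum => iJ.
  by apply: (measurableT_comp (mh i)); exact: measurable_generated.
transitivity (\int[P]_w f (U w, X j w)).
  by apply: eq_Rintegral => w _; rewrite (big_setD1 j)//= mulrC fE.
rewrite (independent_generated_integral (C := K * C) jJ' mU); last 2 first.
- apply: measurable_funM; last exact: measurableT_comp.
  by apply: measurable_maxr => //; exact: measurable_minr.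
- move=> x; rewrite /f normrM ler_pM// ler_norml.
  by rewrite le_max lexx ge_max ge_min lexx ge0_cp//= andbT.
have iU : P.-integrable setT (EFin \o U).
  exact: (bounded_integrable P (generated_measurable mU) UK).
have ih : P.-integrable setT (EFin \o (fun w => h j (X j w))).
  by apply: (bounded_integrable P _ (fun w => hC j _)); exact: measurableT_comp.
transitivity (\int[P]_w (U w * \int[P]_w' h j (X j w'))).
  apply: eq_Rintegral => w _; rewrite -RintegralZl//.
  by apply: eq_Rintegral => w' _; rewrite fE.
by rewrite RintegralZr// IH// [RHS](big_setD1 j)//= mulrC.
Qed.

End mutual_independence.

(** * Lindeberg's replacement argument *)

(** [g1] and [g2] stand for the first two derivatives, but only the expansion is demanded; piecewise
    cubic functions qualify by pure algebra. *)
Definition taylor2 (R : realType) (C : R) (g g1 g2 : R -> R) :=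
  [/\ continuous g, forall x, `|g x| <= C, forall x, `|g1 x| <= C,
      forall x, `|g2 x| <= C &
      forall x y, `|g (x + y) - (g x + g1 x * y + g2 x * (y ^+ 2 / 2))| <= C * `|y| ^+ 3].

Definition test_function (R : realType) (g : R -> R) :=
  exists C g1 g2, taylor2 C g g1 g2.

(** The integrand of Lindeberg's condition: the square beyond the truncation level [e]. *)
Definition tail2 (R : realType) (e y : R) : R := if e < `|y| then y ^+ 2 else 0.

Lemma measurable_tail2 (R : realType) (e : R) : measurable_fun setT (@tail2 R e).
Proof.
apply: measurable_fun_ifT => //.
by apply: measurable_fun_ltr => //; exact: measurableT_comp.
Qed.

Lemma tail2_ge0 (R : realType) (e y : R) : 0 <= tail2 e y.
Proof. by rewrite /tail2; case: ifP; rewrite ?sqr_ge0. Qed.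

Lemma tail2_le (R : realType) (e y : R) : tail2 e y <= y ^+ 2.
Proof. by rewrite /tail2; case: ifP; rewrite ?sqr_ge0. Qed.

Section taylor_integral.
Context d (T : measurableType d) (R : realType) (P : probability T R).
Variables (C : R) (g g1 g2 : R -> R).
Hypothesis tg : taylor2 C g g1 g2.
Variable xi : T -> R.
Hypothesis mxi : measurable_fun setT xi.
Hypothesis ixi : P.-integrable setT (EFin \o (fun w => xi w ^+ 2)).

(** For [|y| <= e] the cubic remainder is at most [C e y^2], and for [e < |y| <= 1] at most [C y^2].
    For [|y| > 1] the four terms are bounded separately by [C + C + C |y| + C y^2 / 2], at most
    [7/2 C y^2]; hence the constant 4. *)
Lemma taylor2_remainder (e x y : R) : 0 < e ->
  `|g (x + y) - (g x + g1 x * y + g2 x * (y ^+ 2 / 2))| <=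
  4 * C * (e * y ^+ 2 + tail2 e y).
Proof.
move=> e0; have [_ gC g1C g2C gr] := tg.
have C0 : 0 <= C by have := gC 0; apply: le_trans.
have ey : 0 <= e * y ^+ 2 by rewrite mulr_ge0 ?sqr_ge0// ltW.
have y0 := normr_ge0 y; have y2 : y ^+ 2 = `|y| ^+ 2 by rewrite real_normK ?num_real.
have E3 : `|y| ^+ 3 = `|y| * `|y| ^+ 2 by rewrite exprS.
rewrite /tail2; case: ltP => ye.
  have [y1|y1] := leP `|y| 1.
    apply: (le_trans (gr x y)); rewrite E3 y2.
    have : 0 <= C * `|y| ^+ 2 by rewrite mulr_ge0// exprn_ge0.
    set q := `|y| ^+ 2; have : 0 <= q by rewrite exprn_ge0.
    move=> q0 Cq0; rewrite mulrCA -mulrA mulrDr.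
    have : `|y| * (C * q) <= C * q by rewrite ler_piMl.
    have : 0 <= C * (e * q) by rewrite mulr_ge0// mulr_ge0// ltW.
    lra.
  apply: le_trans (_ : C + (C + C * `|y| + C * (y ^+ 2 / 2)) <= _).
    rewrite (le_trans (ler_normB _ _))// lerD//.
    rewrite (le_trans (ler_normD _ _))// lerD//.
      by rewrite (le_trans (ler_normD _ _))// lerD// normrM ler_wpM2r.
    rewrite normrM [`|_ / 2|]ger0_norm ?divr_ge0 ?sqr_ge0// ler_wpM2r//.
    by rewrite divr_ge0// sqr_ge0.
  have h1 : C <= C * y ^+ 2.
    by rewrite ler_peMr// y2 exprn_ege1// ltW.
  have h2 : C * `|y| <= C * y ^+ 2.
    by rewrite ler_wpM2l// y2 expr2 ler_peMr// ltW.
  have h3 := mulr_ge0 C0 ey.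
  by rewrite -mulrA mulrDr; lra.
apply: (le_trans (gr x y)); rewrite E3 addr0.
have : C * (`|y| * `|y| ^+ 2) <= C * (e * y ^+ 2).
  by rewrite ler_wpM2l// y2 ler_wpM2r// exprn_ge0.
have := mulr_ge0 C0 ey.
rewrite -mulrA; lra.
Qed.

Lemma square_integrable_integrable : P.-integrable setT (EFin \o xi).
Proof.
have i1 := @finite_measure_integrable_cst _ _ R P setT 1 measurableT.
apply: le_integrable (integrableD _ i1 ixi) => //; first exact/measurable_EFinP.
move=> w _ /=; rewrite lee_fin [leRHS]ger0_norm ?addr_ge0 ?sqr_ge0//.
by rewrite -(real_normK (num_real (xi w))); have := normr_ge0 (xi w); nra.
Qed.

Lemma integrable_tail2 (e : R) : P.-integrable setT (EFin \o (fun w => tail2 e (xi w))).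
Proof.
apply: le_integrable ixi => //.
  by apply/measurable_EFinP; apply: measurableT_comp => //; exact: measurable_tail2.
move=> w _; rewrite lee_fin ger0_norm ?tail2_ge0// ger0_norm ?sqr_ge0//.
exact: tail2_le.
Qed.

(** Only the mean, the second moment and the truncated second moment of [xi] enter, so a summand can
    be compared with a Gaussian one through these numbers. *)
Lemma taylor2_integral (e x : R) : 0 < e ->
  `|\int[P]_w g (x + xi w) -
    (g x + g1 x * \int[P]_w xi w + g2 x * (\int[P]_w (xi w ^+ 2) / 2))| <=
  4 * C * (e * \int[P]_w (xi w ^+ 2) + \int[P]_w tail2 e (xi w)).
Proof.
move=> e0; have [cg gC g1C g2C gr] := tg.
have mg : measurable_fun setT g by exact: continuous_measurable_fun.
have ig : P.-integrable setT (EFin \o (fun w => g (x + xi w))).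
  apply: (bounded_integrable P _ (fun w => gC _)); apply: measurableT_comp => //.
  exact: measurable_funD.
have ix := square_integrable_integrable.
have i0 := @finite_measure_integrable_cst _ _ R P setT (g x) measurableT.
have i1 : P.-integrable setT (EFin \o (fun w => g1 x * xi w)).
  exact: (integrableZl _ (g1 x) ix).
have i2 : P.-integrable setT (EFin \o (fun w => g2 x * (xi w ^+ 2 / 2))).
  apply: (integrableZl _ (g2 x) (f := EFin \o (fun w => xi w ^+ 2 / 2))) => //.
  exact: (integrableZr _ 2^-1 ixi).
have i01 : P.-integrable setT (EFin \o (fun w => g x + g1 x * xi w)).
  exact: integrableD i0 i1.
have i012 : P.-integrable setT
    (EFin \o (fun w => g x + g1 x * xi w + g2 x * (xi w ^+ 2 / 2))).
  exact: integrableD i01 i2.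
have -> : g x + g1 x * \int[P]_w xi w + g2 x * (\int[P]_w (xi w ^+ 2) / 2) =
    \int[P]_w (g x + g1 x * xi w + g2 x * (xi w ^+ 2 / 2)).
  rewrite (RintegralD _ i01 i2)// (RintegralD _ i0 i1)// prob_Rintegral_cst.
  rewrite (RintegralZl _ _ ix)//; congr (_ + _).
  rewrite (RintegralZl (f := fun w => xi w ^+ 2 / 2))//.
    by rewrite (RintegralZr _ _ ixi).
  exact: (integrableZr _ 2^-1 ixi).
rewrite -RintegralB//.
have it := integrable_tail2 e.
have ie : P.-integrable setT (EFin \o (fun w => e * xi w ^+ 2)).
  exact: (integrableZl _ e ixi).
rewrite -(RintegralZl _ _ ixi)// -(RintegralD _ ie it)//.
have iet : P.-integrable setT (EFin \o (fun w => e * xi w ^+ 2 + tail2 e (xi w))).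
  exact: integrableD ie it.
rewrite -(RintegralZl _ _ iet)//.
have idf : P.-integrable setT (EFin \o (fun w => g (x + xi w) -
    (g x + g1 x * xi w + g2 x * (xi w ^+ 2 / 2)))) by exact: integrableB ig i012.
rewrite (le_trans (le_normr_Rintegral _ idf))//.
apply: prob_le_Rintegral; first exact: integrable_norm.
  exact: (integrableZl _ (4 * C) iet).
by move=> w; exact: taylor2_remainder.
Qed.

(** Dominated convergence: at each point the integrand is eventually 0, and it never exceeds the
    integrable square. *)
Lemma tail2_integral_cvg (a : nat -> R) : a n @[n --> \oo] --> +oo ->
  \int[P]_w tail2 (a n) (xi w) @[n --> \oo] --> (0 : R).
Proof.
move=> ay.
have mt n : measurable_fun setT (fun w => (tail2 (a n) (xi w))%:E).
  by apply/measurable_EFinP; apply: measurableT_comp => //; exact: measurable_tail2.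
have := @dominated_cvg _ _ R P setT measurableT
  (fun n w => (tail2 (a n) (xi w))%:E) (cst 0%E) (fun w => (xi w ^+ 2)%:E) mt.
rewrite integral0 => h; apply: fine_cvg; apply: h => //.
- move=> w _; apply: cvg_near_cst; have /cvgryPgt/(_ `|xi w|) := ay.
  by apply: filterS => n; rewrite /tail2 => /ltW; rewrite leNgt => /negbTE ->.
- by move=> n w _; rewrite lee_fin ger0_norm ?tail2_ge0// tail2_le.
Qed.

End taylor_integral.

(** * Replacement of the summands by Gaussian ones, one at a time *)

Section lindeberg.
Context d (T : measurableType d) (R : realType) (P : probability T R).
Variables (n : nat) (xi : 'I_n -> T -> R) (m q t e : R).
Hypothesis n0 : (0 < n)%N.
Hypothesis e0 : 0 < e.
Hypothesis mxi : forall i, measurable_fun setT (xi i).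
Hypothesis indxi : mutually_independent P xi.
Hypothesis ixi : forall i, P.-integrable setT (EFin \o (fun w => xi i w ^+ 2)).
Hypothesis xi1 : forall i, \int[P]_w xi i w = m.
Hypothesis xi2 : forall i, \int[P]_w (xi i w ^+ 2) = q.
Hypothesis xit : forall i, \int[P]_w tail2 e (xi i w) = t.
Variables (C : R) (g g1 g2 : R -> R).
Hypothesis tg : taylor2 C g g1 g2.
Notation gauss := (std_normal R).

Let nR : (n%:R : R) != 0. Proof. by rewrite pnatr_eq0 -lt0n. Qed.
Let nR0 : (0 : R) < n%:R. Proof. by rewrite ltr0n. Qed.

(** The standard deviation of a sum of [k] independent Gaussian variables of variance [1 / n]. *)
Let c (k : nat) : R := Num.sqrt (k%:R / n%:R).

Let c_ge0 k : 0 <= c k. Proof. exact: sqrtr_ge0. Qed.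

Let c_gt0 k : (0 < k)%N -> 0 < c k.
Proof. by move=> k0; rewrite sqrtr_gt0 divr_gt0// ltr0n. Qed.

Let c_sqr k : c k ^+ 2 = k%:R / n%:R.
Proof. by rewrite sqr_sqrtr// divr_ge0. Qed.

Let gC x : `|g x| <= C. Proof. by have [_ +] := tg. Qed.

Let C0 : 0 <= C. Proof. by have := gC 0; apply: le_trans. Qed.

Let cg : continuous g. Proof. by have [] := tg. Qed.

Let mg : measurable_fun setT g.
Proof. exact: continuous_measurable_fun. Qed.

(* h k is g smoothed by the law of k of the n Gaussian summands N(0, 1/n). *)
Let h (k : nat) (x : R) := \int[gauss]_z g (x + c k * z).

Let mh2 k : measurable_fun setT (fun p : R * R => g (p.1 + c k * p.2)).
Proof.
by apply: measurableT_comp => //; apply: measurable_funD => //; exact: measurable_funM.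
Qed.

Let mh k : measurable_fun setT (h k).
Proof. exact: (measurable_Rintegral1 gauss gauss (mh2 k) (fun p => gC _)). Qed.

Let mh1 k x : measurable_fun setT (fun z => g (x + c k * z)).
Proof.
by apply: measurableT_comp => //; apply: measurable_funD => //; exact: measurable_funM.
Qed.

Let hC k x : `|h k x| <= C.
Proof. exact: (prob_Rintegral_bound gauss (mh1 k x) (fun z => gC _)). Qed.

Let h0 x : h 0 x = g x.
Proof.
rewrite /h (_ : c 0 = 0); last by rewrite /c mul0r sqrtr0.
under eq_Rintegral do rewrite mul0r addr0.
exact: prob_Rintegral_cst.
Qed.

Let hn : h n 0 = \int[gauss]_z g z.
Proof.
rewrite /h /c divff// sqrtr1; apply: eq_Rintegral => z _.
by rewrite mul1r add0r.
Qed.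

(** Rotation invariance with coefficients [c k] and [c 1], whose squares add up to the square of
    [c k.+1]. *)
Let hS k x : h k.+1 x = \int[gauss]_y h k (x + c 1 * y).
Proof.
rewrite /h -(normal_rotation x (a := c k) (c_gt0 (ltn0Sn 0)) (c_gt0 (ltn0Sn k)) _ cg gC).
  have M : measurable_fun setT (fun p : R * R => g (x + c k * p.1 + c 1 * p.2)).
    apply: measurableT_comp => //; apply: measurable_funD; last exact: measurable_funM.
    by apply: measurable_funD => //; exact: measurable_funM.
  rewrite (Rfubini gauss gauss M (fun p => gC _)).
  apply: eq_Rintegral => y _; apply: eq_Rintegral => z _ /=.
  by rewrite addrAC.
by rewrite !c_sqr -mulrDl natr1.
Qed.

Let G := \int[gauss]_z tail2 (e * Num.sqrt n%:R) z.

(** In this order: the drift, the mismatch of the variances, the Taylor remainder of the given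
    summands and that of the Gaussian ones, each accumulated over [n] replacements. *)
Definition lindeberg_error : R :=
  C * `|n%:R * m| + C * `|n%:R * q - 1| +
  4 * C * (e * (n%:R * q) + n%:R * t) + 4 * C * (e + G).

Let scaled_moment2 : \int[gauss]_z ((c 1 * z) ^+ 2) = n%:R^-1.
Proof.
under eq_Rintegral do rewrite exprMn c_sqr mul1r.
rewrite RintegralZl//; last exact: integrable_normal_sqr.
by rewrite [X in _ * X](_ : _ = 1) ?mulr1// /Rintegral normal_second_moment.
Qed.

Let c1E : c 1 = (Num.sqrt n%:R)^-1.
Proof. by rewrite /c mul1r sqrtrV. Qed.

Let sn0 : 0 < Num.sqrt n%:R :> R. Proof. by rewrite sqrtr_gt0. Qed.

Let scaled_tail : \int[gauss]_z tail2 e (c 1 * z) = n%:R^-1 * G.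
Proof.
rewrite /G -RintegralZl//.
  apply: eq_Rintegral => z _; rewrite /tail2 normrM exprMn c_sqr mul1r.
  rewrite (ger0_norm (c_ge0 1)) c1E [X in e < X]mulrC ltr_pdivlMr//.
  by case: ifP => _; rewrite ?mulr0.
exact: (@integrable_tail2 _ _ _ gauss (fun z => z) (@measurable_id _ _ _)
  integrable_normal_sqr).
Qed.

Let iscaled : gauss.-integrable setT (EFin \o (fun z => (c 1 * z) ^+ 2)).
Proof.
rewrite (_ : _ \o _ = (fun z => (c 1 ^+ 2)%:E * (z ^+ 2)%:E)%E).
  by apply: integrableZl => //; exact: integrable_normal_sqr.
by apply/funext => z /=; rewrite exprMn EFinM.
Qed.

(** Both integrals are compared with their second order expansions at [x]. The Gaussian summand has
    mean 0 and variance [1 / n], so the expansions differ only through [m] and [q - 1 / n]. *)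
Let one_step i x :
  `|\int[P]_w g (x + xi i w) - \int[gauss]_z g (x + c 1 * z)| <=
  n%:R^-1 * lindeberg_error.
Proof.
have [_ _ g1C g2C _] := tg.
have A := taylor2_integral tg (mxi i) (ixi i) x e0.
have mc1 : measurable_fun setT (fun z : R => c 1 * z) by exact: measurable_funM.
have B := taylor2_integral tg mc1 iscaled x e0.
move: A B; rewrite xi1 xi2 xit scaled_moment2 scaled_tail.
rewrite (_ : \int[gauss]_z (c 1 * z) = 0); last first.
  rewrite RintegralZl//; last exact: integrable_normal_id.
  by rewrite normal_first_moment mulr0.
set A := \int[P]_w _; set B := \int[gauss]_z _; move=> hA hB.
have -> : A - B = (A - (g x + g1 x * m + g2 x * (q / 2))) -
    (B - (g x + g1 x * 0 + g2 x * (n%:R^-1 / 2))) +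
    (g1 x * m + g2 x * ((q - n%:R^-1) / 2)) by ring.
rewrite (le_trans (ler_normD _ _))//.
have h1 := le_trans (ler_normB _ _) (lerD hA hB).
have h2 : `|g1 x * m + g2 x * ((q - n%:R^-1) / 2)| <= C * `|m| + C * `|q - n%:R^-1|.
  rewrite (le_trans (ler_normD _ _))// lerD// normrM.
    by rewrite ler_wpM2r.
  rewrite ler_pM// normrM [`|2^-1|]ger0_norm// ler_piMr//.
  by rewrite invf_le1// ler1n.
apply: (le_trans (lerD h1 h2)).
rewrite /lindeberg_error normrM (ger0_norm (ltW nR0)).
have -> : `|n%:R * q - 1| = n%:R * `|q - n%:R^-1|.
  by rewrite -[X in X * `|_|](ger0_norm (ltW nR0)) -normrM mulrBr divff.
rewrite le_eqVlt; apply/orP; left; apply/eqP; field.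
by rewrite nR.
Qed.

(** Smoothing keeps the bound: by Fubini the difference for [h k] is a Gaussian average of
    differences for [g] at shifted points, and [one_step] is uniform in the point. Thus [h k] needs
    no expansion of its own. *)
Let one_step_h k i x :
  `|\int[P]_w h k (x + xi i w) - \int[gauss]_z h k (x + c 1 * z)| <=
  n%:R^-1 * lindeberg_error.
Proof.
have swap d' (T' : measurableType d') (Q : probability T' R) (u : T' -> R) :
    measurable_fun setT u ->
    \int[Q]_w h k (x + u w) = \int[gauss]_z \int[Q]_w g (x + c k * z + u w).
  move=> mu; rewrite /h.
  have M : measurable_fun setT (fun p : T' * R => g (x + u p.1 + c k * p.2)).
    apply: measurableT_comp => //; apply: measurable_funD; last exact: measurable_funM.
    by apply: measurable_funD => //; exact: measurableT_comp.
  rewrite (Rfubini Q gauss M (fun p => gC _)).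
  by apply: eq_Rintegral => z _; apply: eq_Rintegral => w _; rewrite addrAC.
have m1 d' (T' : measurableType d') (Q : probability T' R) (u : T' -> R) :
    measurable_fun setT u ->
    measurable_fun setT (fun z => \int[Q]_w g (x + c k * z + u w)).
  move=> mu; apply: (@measurable_Rintegral1 _ _ _ _ _ gauss Q
    (fun p => g (x + c k * p.1 + u p.2)) C) => //.
  apply: measurableT_comp => //; apply: measurable_funD; last exact: measurableT_comp.
  by apply: measurable_funD => //; exact: measurable_funM.
have b1 d' (T' : measurableType d') (Q : probability T' R) (u : T' -> R) z :
    measurable_fun setT u -> `|\int[Q]_w g (x + c k * z + u w)| <= C.
  move=> mu; apply: prob_Rintegral_bound => //.
  by apply: measurableT_comp => //; exact: measurable_funD.
have mc1 : measurable_fun setT (fun z : R => c 1 * z) by exact: measurable_funM.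
rewrite !swap// -RintegralB//; last 2 first.
- by apply: (bounded_integrable gauss (m1 _ _ P _ (mxi i))) => z; exact: b1.
- by apply: (bounded_integrable gauss (m1 _ _ gauss _ mc1)) => z; exact: b1.
apply: prob_Rintegral_bound.
  by apply: measurable_funB; exact: m1.
by move=> z; exact: one_step.
Qed.

Let S (j : nat) w := \sum_(i < n | (i < j)%N) xi i w.

Let J (j : nat) : {set 'I_n} := [set i : 'I_n | (i < j)%N]%SET.

Let mS j : measurable_fun setT (S j : generated xi (J j) -> R).
Proof.
rewrite (_ : S j = fun w => \sum_(i < n) (if (i < j)%N then xi i w else 0)); last first.
  by apply/funext => w; rewrite /S big_mkcond.
apply: measurable_sum => i; case: (boolP (i < j)%N) => ij; last exact: measurable_cst.
by apply: measurable_generated; rewrite inE.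
Qed.

Let SS j (jn : (j < n)%N) w : S j.+1 w = S j w + xi (Ordinal jn) w.
Proof.
rewrite /S (bigD1 (Ordinal jn))//= addrC; congr (_ + _).
apply: eq_bigl => i; rewrite ltnS -val_eqE/= [RHS]ltn_neqAle.
by rewrite andbC.
Qed.

(** The hybrid in which the first [j] summands are the given ones and the other [n - j] are
    Gaussian. *)
Let a j := \int[P]_w h (n - j) (S j w).

(** Both hybrids are integrals over the law of [S j]: one adds the independent summand [xi i] to it,
    the other, by [hS], a Gaussian summand. Then [one_step_h] applies pointwise. *)
Let aS j : (j < n)%N -> `|a j.+1 - a j| <= n%:R^-1 * lindeberg_error.
Proof.
move=> jn; pose i := Ordinal jn; pose k := (n - j.+1)%N.
have mSj := generated_measurable mxi (@mS j).
pose f (p : R * R) := h k (p.1 + p.2).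
have mf : measurable_fun setT f.
  by apply: measurableT_comp => //; exact: measurable_funD.
pose U w := \int[P]_w' h k (S j w + xi i w').
pose V w := \int[gauss]_z h k (S j w + c 1 * z).
have mU2 : measurable_fun setT (fun p : T * T => h k (S j p.1 + xi i p.2)).
  by apply: measurableT_comp => //; apply: measurable_funD; exact: measurableT_comp.
have mV2 : measurable_fun setT (fun p : T * R => h k (S j p.1 + c 1 * p.2)).
  apply: measurableT_comp => //; apply: measurable_funD; first exact: measurableT_comp.
  exact: measurable_funM.
have mU : measurable_fun setT U := measurable_Rintegral1 P P mU2 (fun p => hC _ _).
have mV : measurable_fun setT V := measurable_Rintegral1 P gauss mV2 (fun p => hC _ _).
have UC w : `|U w| <= C.
  apply: prob_Rintegral_bound => //.
  by apply: measurableT_comp => //; exact: measurable_funD.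
have VC w : `|V w| <= C.
  apply: prob_Rintegral_bound => //.
  by apply: measurableT_comp => //; apply: measurable_funD.
have -> : a j.+1 = \int[P]_w U w.
  rewrite /a; under eq_Rintegral do rewrite (SS jn).
  have iJ : i \notin J j by rewrite inE ltnn.
  exact: (independent_generated_integral mxi indxi iJ (@mS j) mf (fun p => hC _ _)).
have -> : a j = \int[P]_w V w.
  apply: eq_Rintegral => w _; rewrite (_ : (n - j)%N = k.+1) ?hS//.
  by rewrite /k -subSn.
rewrite -RintegralB//; last 2 first.
- exact: (bounded_integrable P mU UC).
- exact: (bounded_integrable P mV VC).
apply: prob_Rintegral_bound; first exact: measurable_funB.
by move=> w; exact: one_step_h.
Qed.

(** Telescoping through the hybrids, from [a 0], the Gaussian integral, to [a n]: there are [n]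
    steps, each costing an [n]-th of the error. *)
Theorem lindeberg_bound :
  `|\int[P]_w g (\sum_(i < n) xi i w) - \int[gauss]_z g z| <= lindeberg_error.
Proof.
have bnd j : (j <= n)%N -> `|a j - a 0| <= j%:R * (n%:R^-1 * lindeberg_error).
  elim: j => [|j IH] jn; first by rewrite subrr normr0 mul0r.
  have -> : a j.+1 - a 0 = (a j.+1 - a j) + (a j - a 0) by rewrite subrKA.
  rewrite (le_trans (ler_normD _ _))// -natr1 mulrDl mul1r addrC lerD//.
    by apply: IH; exact: ltnW.
  exact: aS.
have := bnd n (leqnn n); rewrite mulrA divff// mul1r.
rewrite /a subnn subn0.
have -> : \int[P]_w h 0 (S n w) = \int[P]_w g (\sum_(i < n) xi i w).
  apply: eq_Rintegral => w _; rewrite h0 /S; congr g.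
  by apply: eq_bigl => i; rewrite ltn_ord.
rewrite (_ : \int[P]_w h n (S 0 w) = \int[gauss]_z g z)//.
rewrite -hn -[RHS](prob_Rintegral_cst P); apply: eq_Rintegral => w _.
by rewrite /S big1// => i; rewrite ltn0.
Qed.

End lindeberg.

(** * Smooth splines *)

Section spline.
Variable R : realType.
Implicit Types (x y u a h : R).

Let pos x : R := Num.max x 0.

Let pos_ge0 x : 0 <= x -> pos x = x. Proof. exact: max_l. Qed.

Let pos_le0 x : x <= 0 -> pos x = 0. Proof. exact: max_r. Qed.

Let cube_le x y : x <= y -> x ^+ 3 <= y ^+ 3.
Proof.
move=> xy; rewrite -subr_ge0.
have -> : y ^+ 3 - x ^+ 3 = (y - x) * ((y + x / 2) ^+ 2 + 3 / 4 * x ^+ 2) by field.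
by rewrite mulr_ge0 ?subr_ge0// addr_ge0 ?sqr_ge0// mulr_ge0 ?sqr_ge0.
Qed.

(** If [x] and [x + y] lie on the same side of 0, the remainder is [y ^+ 3] or 0; if they are
    separated by 0, it lies between 0 and [y ^+ 3] because cubing is monotone. *)
Let cube_taylor x y :
  `|pos (x + y) ^+ 3 - (pos x ^+ 3 + 3 * pos x ^+ 2 * y + 6 * pos x * (y ^+ 2 / 2))| <=
  `|y| ^+ 3.
Proof.
rewrite -normrX; have [x0|x0] := leP 0 x; have [xy0|xy0] := leP 0 (x + y).
- rewrite !pos_ge0// (_ : _ - _ = y ^+ 3)//; by field.
- rewrite (pos_ge0 x0) (pos_le0 (ltW xy0)) expr0n/=.
  rewrite (_ : 0 - _ = y ^+ 3 - (x + y) ^+ 3); last by field.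
  have h1 : (x + y) ^+ 3 <= 0 by have := cube_le (ltW xy0); rewrite expr0n.
  have h2 : y ^+ 3 <= (x + y) ^+ 3 by apply: cube_le; lra.
  rewrite (ler0_norm (le_trans h2 h1)) ler_norml; apply/andP; split; lra.
- rewrite (pos_ge0 xy0) (pos_le0 (ltW x0)) !expr0n/= !(mulr0, mul0r, addr0, subr0).
  have h1 : 0 <= (x + y) ^+ 3 by rewrite exprn_ge0.
  have h2 : (x + y) ^+ 3 <= y ^+ 3 by apply: cube_le; lra.
  by rewrite ger0_norm// ger0_norm// (le_trans h1).
- by rewrite (pos_le0 (ltW x0)) (pos_le0 (ltW xy0)) !expr0n/= !(mulr0, mul0r, addr0, subr0) normr0.
Qed.

(* The distribution function of the sum of three uniform variables on [0, 1]. *)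
Definition spline x : R :=
  (pos x ^+ 3 - 3 * pos (x - 1) ^+ 3 + 3 * pos (x - 2) ^+ 3 - pos (x - 3) ^+ 3) / 6.

(** [spline1] and [spline2] are the first and second derivatives of [spline]. *)
Let spline1 x : R :=
  (pos x ^+ 2 - 3 * pos (x - 1) ^+ 2 + 3 * pos (x - 2) ^+ 2 - pos (x - 3) ^+ 2) / 2.

Let spline2 x : R := pos x - 3 * pos (x - 1) + 3 * pos (x - 2) - pos (x - 3).

(** The local variable [t] in [[0, 1]] turns every estimate on a polynomial piece into linear
    arithmetic in [t], [t ^+ 2] and [t ^+ 3]. *)
Let zone x : x <= 0 \/ (exists2 t : R, 0 <= t <= 1 & [\/ x = t, x = 1 + t | x = 2 + t]) \/ 3 <= x.
Proof.
have [x0|x0] := leP x 0; first by left.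
have [x3|x3] := leP 3 x; first by right; right.
right; left; have [x1|x1] := leP x 1.
  by exists x; [lra|exact: Or31].
have [x2|x2] := leP x 2.
  by exists (x - 1); [lra|apply: Or32; ring].
by exists (x - 2); [lra|apply: Or33; ring].
Qed.

Lemma spline_eq0 x : x <= 0 -> spline x = 0.
Proof. by move=> x0; rewrite /spline !pos_le0; [ring|lra..]. Qed.

Lemma spline_eq1 x : 3 <= x -> spline x = 1.
Proof. by move=> x3; rewrite /spline !pos_ge0; [field|lra..]. Qed.

Let eval1 x : 0 <= x <= 1 ->
  [/\ spline x = x ^+ 3 / 6, spline1 x = x ^+ 2 / 2 & spline2 x = x].
Proof.
move=> /andP[x0 x1]; rewrite /spline /spline1 /spline2.
rewrite (pos_ge0 x0) !pos_le0; [|lra..].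
by split; field.
Qed.

Let eval2 x : 0 <= x <= 1 ->
  [/\ spline (1 + x) = (1 + 3 * x + 3 * x ^+ 2 - 2 * x ^+ 3) / 6,
     spline1 (1 + x) = (1 + 2 * x - 2 * x ^+ 2) / 2 & spline2 (1 + x) = 1 - 2 * x].
Proof.
move=> /andP[x0 x1]; rewrite /spline /spline1 /spline2.
rewrite (@pos_ge0 (1 + x)); last lra.
rewrite (@pos_ge0 (1 + x - 1)); last lra.
rewrite !pos_le0; [|lra..].
by split; field.
Qed.

Let eval3 x : 0 <= x <= 1 ->
  [/\ spline (2 + x) = (6 - (1 - x) ^+ 3) / 6,
     spline1 (2 + x) = (1 - x) ^+ 2 / 2 & spline2 (2 + x) = x - 1].
Proof.
move=> /andP[x0 x1]; rewrite /spline /spline1 /spline2.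
rewrite (@pos_le0 (2 + x - 3)); last lra.
rewrite !pos_ge0; [|lra..].
by split; field.
Qed.

Let powers x : 0 <= x <= 1 -> [/\ 0 <= x ^+ 3, x ^+ 3 <= x ^+ 2, 0 <= x ^+ 2 & x ^+ 2 <= x].
Proof.
move=> /andP[x0 x1]; split; rewrite ?exprn_ge0//.
  by rewrite exprS ler_piMl ?exprn_ge0.
by rewrite expr2 ler_piMl.
Qed.

Let onem_powers x : 0 <= x <= 1 ->
  [/\ (1 - x) ^+ 2 = 1 - 2 * x + x ^+ 2, (1 - x) ^+ 3 = 1 - 3 * x + 3 * x ^+ 2 - x ^+ 3,
    0 <= 1 - 3 * x + 3 * x ^+ 2 - x ^+ 3,
    1 - 3 * x + 3 * x ^+ 2 - x ^+ 3 <= 1 - 2 * x + x ^+ 2 & 0 <= 1 - 2 * x + x ^+ 2].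
Proof.
move=> x01; have : 0 <= 1 - x <= 1 by lra.
move=> /powers.
have -> : (1 - x) ^+ 2 = 1 - 2 * x + x ^+ 2 by ring.
have -> : (1 - x) ^+ 3 = 1 - 3 * x + 3 * x ^+ 2 - x ^+ 3 by ring.
by move=> [? ? ? ?]; split.
Qed.

Lemma spline_itv x : 0 <= spline x <= 1.
Proof.
have [/spline_eq0 ->|[[t t01 tx]|/spline_eq1 ->]] := zone x; [lra| |lra].
have [U2 U3 u3 u32 u2] := onem_powers t01; have [t3 t32 t2 t21] := powers t01.
have /andP[t0 t1] := t01.
case: tx => ->; [have [-> _ _] := eval1 t01|have [-> _ _] := eval2 t01|
  have [-> _ _] := eval3 t01; rewrite U3]; lra.
Qed.

(** The difference of the two sides is the cubic B-spline, the density of a sum of four uniform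
    variables; its positivity makes the partition of unity nonnegative. *)
Lemma spline_step x : spline (x - 1) <= spline x.
Proof.
have [x0|[[t t01 tx]|/spline_eq1 ->]] := zone x.
- by rewrite !spline_eq0//; lra.
- have [U2 U3 u3 u32 u2] := onem_powers t01; have [t3 t32 t2 t21] := powers t01.
  have /andP[t0 t1] := t01.
  case: tx => ->.
  + by rewrite (@spline_eq0 (t - 1)); [have /andP[] := spline_itv t|lra].
  + rewrite (_ : 1 + t - 1 = t); last by ring.
    have [-> _ _] := eval1 t01; have [-> _ _] := eval2 t01; lra.
  + rewrite (_ : 2 + t - 1 = 1 + t); last by ring.
    have [-> _ _] := eval2 t01; have [-> _ _] := eval3 t01.
    have -> : (1 - t) ^+ 3 = 1 - 3 * t + 3 * t ^+ 2 - t ^+ 3 by ring.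
    (* Six times the difference to be bounded is [4 - 6 t^2 + 3 t^3], which exceeds this product by
       [t^3]. *)
    have : 0 <= (1 - t) * (4 + 4 * t - 2 * t ^+ 2) by rewrite mulr_ge0//; lra.
    have -> : (1 - t) * (4 + 4 * t - 2 * t ^+ 2) = 4 - 6 * t ^+ 2 + 2 * t ^+ 3 by ring.
    lra.
- by have /andP[] := spline_itv (x - 1).
Qed.

Let spline1_bound x : `|spline1 x| <= 1.
Proof.
have [x0|[[t t01 tx]|x3]] := zone x.
- by rewrite /spline1 !pos_le0 ?expr0n/=; [rewrite !(mulr0, subr0, addr0) mul0r normr0|lra..].
- have [U2 U3 u3 u32 u2] := onem_powers t01; have [t3 t32 t2 t21] := powers t01.
  have /andP[t0 t1] := t01.
  rewrite ler_norml.
  case: tx => ->; [have [_ -> _] := eval1 t01|have [_ -> _] := eval2 t01|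
    have [_ -> _] := eval3 t01; rewrite U2]; lra.
- rewrite /spline1 !pos_ge0; [|lra..].
  by rewrite (_ : _ / 2 = 0) ?normr0//; field.
Qed.

Let spline2_bound x : `|spline2 x| <= 1.
Proof.
rewrite ler_norml.
have [x0|[[t t01 tx]|x3]] := zone x.
- by rewrite /spline2 !pos_le0; lra.
- have /andP[t0 t1] := t01.
  case: tx => ->; [have [_ _ ->] := eval1 t01|have [_ _ ->] := eval2 t01|
    have [_ _ ->] := eval3 t01]; lra.
- by rewrite /spline2 !pos_ge0; lra.
Qed.

(** The remainder is a combination of four truncated cubes with weights 1/6, 1/2, 1/2, 1/6 in
    absolute value; their sum 4/3 is rounded up to 2. *)
Let spline_taylor x y :
  `|spline (x + y) - (spline x + spline1 x * y + spline2 x * (y ^+ 2 / 2))| <=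
  2 * `|y| ^+ 3.
Proof.
have E : spline (x + y) - (spline x + spline1 x * y + spline2 x * (y ^+ 2 / 2)) =
  \sum_(k < 4) [tuple 6^-1; - 2^-1; 2^-1; - 6^-1]`_k *
    (pos (x - k%:R + y) ^+ 3 - (pos (x - k%:R) ^+ 3 + 3 * pos (x - k%:R) ^+ 2 * y +
      6 * pos (x - k%:R) * (y ^+ 2 / 2))).
  rewrite !big_ord_recr big_ord0/= /spline /spline1 /spline2 subr0 add0r.
  by rewrite ![x + y - _]addrAC; field.
rewrite E; apply: (le_trans (ler_norm_sum _ _ _)).
rewrite !big_ord_recr big_ord0/= add0r !normrM.
have T k := cube_taylor (x - k%:R) y.
have t0 := T 0%N; have t1 := T 1%N; have t2 := T 2%N; have t3 := T 3%N.
rewrite !normrN ![`|_^-1|]ger0_norm//.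
have : 0 <= `|y| ^+ 3 by rewrite exprn_ge0.
lra.
Qed.

Lemma test_function_spline a h : 0 < h -> test_function (fun x => spline ((x - a) / h)).
Proof.
move=> h0; have h0' := ltW h0; pose k := h^-1; have k0 : 0 <= k by rewrite invr_ge0.
(* The four terms bound, in turn, the spline, its two rescaled derivatives and the remainder. *)
exists (1 + k + k ^+ 2 + 2 * k ^+ 3), (fun x => k * spline1 ((x - a) * k)),
  (fun x => k ^+ 2 * spline2 ((x - a) * k)).
have k2 : 0 <= k ^+ 2 by rewrite exprn_ge0.
have k3 : 0 <= k ^+ 3 by rewrite exprn_ge0.
split.
- move=> x; rewrite /spline /pos.
  have cpos (u : R -> R) : {for x, continuous u} ->
      {for x, continuous (fun x => Num.max (u x) 0 ^+ 3)}.
    move=> cu; apply: (cvg_comp (fun x => Num.max (u x) 0) (fun x => x ^+ 3)); last first.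
      exact: exprn_continuous.
    by apply: (@continuous_max _ _ u (cst 0)) => //; exact: cvg_cst.
  have cu : {for x, continuous (fun x => (x - a) / h)}.
    apply: cvgM; last exact: cvg_cst.
    by apply: cvgB; [exact: cvg_id|exact: cvg_cst].
  have cub b : {for x, continuous (fun x => (x - a) / h - b)}.
    by apply: cvgB => //; exact: cvg_cst.
  apply: cvgM; last exact: cvg_cst.
  apply: cvgB; last exact: cpos.
  apply: cvgD; last by apply: cvgM; [exact: cvg_cst|exact: cpos].
  by apply: cvgB; [exact: cpos|apply: cvgM; [exact: cvg_cst|exact: cpos]].
- move=> x; have /andP[s0 s1] := spline_itv ((x - a) / h).
  rewrite ger0_norm//; lra.
- move=> x; rewrite normrM (ger0_norm k0).
  have := ler_wpM2l k0 (spline1_bound ((x - a) * k)); lra.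
- move=> x; rewrite normrM (ger0_norm k2).
  have := ler_wpM2l k2 (spline2_bound ((x - a) * k)); lra.
- move=> x y; have := spline_taylor ((x - a) * k) (y * k).
  rewrite (_ : (x - a) * k + y * k = (x + y - a) / h); last by rewrite /k; ring.
  rewrite -/k normrM (ger0_norm k0) exprMn.
  set A := spline ((x + y - a) * k); set B := spline _; set B1 := spline1 _.
  set B2 := spline2 _.
  rewrite (_ : B1 * (y * k) = k * B1 * y); last by ring.
  rewrite (_ : B2 * _ = k ^+ 2 * B2 * (y ^+ 2 / 2)); last by ring.
  move=> /le_trans; apply; rewrite (_ : 2 * (`|y| * k) ^+ 3 = 2 * k ^+ 3 * `|y| ^+ 3); last by ring.
  by rewrite ler_wpM2r ?exprn_ge0//; lra.
Qed.

Lemma test_functionB (f g : R -> R) : test_function f -> test_function g ->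
  test_function (fun x => f x - g x).
Proof.
move=> [C [f1 [f2 [cf fC f1C f2C fr]]]] [D [g1 [g2 [cg gD g1D g2D gr]]]].
exists (C + D), (fun x => f1 x - g1 x), (fun x => f2 x - g2 x); split.
- by move=> x; apply: cvgB; [exact: cf|exact: cg].
- by move=> x; rewrite (le_trans (ler_normB _ _))// lerD.
- by move=> x; rewrite (le_trans (ler_normB _ _))// lerD.
- by move=> x; rewrite (le_trans (ler_normB _ _))// lerD.
- move=> x y; rewrite [leRHS]mulrDl; apply: le_trans (lerD (fr x y) (gr x y)).
  apply: le_trans (ler_normB _ _); rewrite le_eqVlt; apply/orP; left; apply/eqP.
  by rewrite (_ : _ - _ = f (x + y) - (f x + f1 x * y + f2 x * (y ^+ 2 / 2))
    - (g (x + y) - (g x + g1 x * y + g2 x * (y ^+ 2 / 2))))//; ring.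
Qed.

End spline.

(** * Convergence in distribution from products of smooth functions *)

Lemma test_function_continuous (R : realType) (g : R -> R) :
  test_function g -> continuous g.
Proof. by move=> [C [g1 [g2 []]]]. Qed.

Lemma test_function_bounded (R : realType) (g : R -> R) :
  test_function g -> exists C, forall x, `|g x| <= C.
Proof. by move=> [C [g1 [g2 []]]]; exists C. Qed.

Lemma Rintegral_sum d (T : measurableType d) (R : realType) (P : probability T R)
    (J : Type) (s : seq J) (F : J -> T -> R) :
  (forall j, P.-integrable setT (EFin \o F j)) ->
  P.-integrable setT (EFin \o (fun w => \sum_(j <- s) F j w)) /\
  \int[P]_w (\sum_(j <- s) F j w) = \sum_(j <- s) \int[P]_w F j w.
Proof.
move=> iF; elim: s => [|j s [iH IH]].
  under eq_fun do rewrite big_nil.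
  by rewrite big_nil prob_Rintegral_cst; split => //; exact: finite_measure_integrable_cst.
under eq_fun do rewrite big_cons.
rewrite big_cons RintegralD// IH; split => //; exact: integrableD (iF j) iH.
Qed.

Lemma continuous_measurable_rV (R : realType) d (f : 'rV[R]_d -> R) :
  continuous f -> measurable_fun setT f.
Proof.
move=> /continuousP cf; apply: (measurability _ (RGenOpens.measurableE R)).
move=> _ [_ [a [b ->] <-]]; rewrite setTI; apply: sub_sigma_algebra.
by apply: cf; exact: interval_open.
Qed.

Lemma box_compact (R : realType) d (a : R) :
  compact [set x : 'rV[R]_d | forall i, `|x ord0 i| <= a].
Proof.
have -> : [set x : 'rV[R]_d | forall i, `|x ord0 i| <= a] =
    [set x : 'rV[R]_d | forall i, [set` `[- a, a]] (x ord0 i)].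
  by apply/seteqP; split => x /= h i; have := h i; rewrite in_itv/= ler_norml.
by apply: (@rV_compact _ d (fun=> [set` `[- a, a]])) => i; exact: segment_compact.
Qed.

(** Only [x] is confined to [K], while [y] may leave it, so the covering form of compactness is
    applied to [f] on the whole space. Later [x] is a grid node in a box and [y] an arbitrary nearby
    point. *)
Lemma compact_uniform_continuity (R : realType) d (K : set 'rV[R]_d) (f : 'rV[R]_d -> R)
    (e : R) : compact K -> continuous f -> 0 < e ->
  exists2 del : R, 0 < del & forall x y, K x -> ball x del y -> `|f x - f y| < e.
Proof.
move=> /compact_near_coveringP cK cf e0.
have /(cK _ _ _ (@at_right_proper_filter R 0)) : forall x, K x ->
    \forall x' \near x & del \near 0^'+, forall y, ball x' del y -> `|f x' - f y| < e.
  move=> x _; have e20 : 0 < e / 2 by rewrite divr_gt0.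
  have /nbhs_ballP[r /= r0 fr] : \forall z \near x, `|f x - f z| < e / 2.
    by move/cvgrPdist_lt : (cf x); exact.
  have r20 : 0 < r / 2 by rewrite divr_gt0.
  exists (ball x (r / 2), [set del | del < r / 2]) => /=.
    by split; [exact: nbhsx_ballx|exact: nbhs_right_lt].
  move=> [x' del] /= [xx' delr] y x'y.
  have xy : ball x r y.
    rewrite (splitr r); apply: ball_triangle xx' _.
    by apply: le_ball x'y; exact: ltW.
  have xx'2 : ball x r x'.
    by apply: le_ball xx'; rewrite ler_pdivrMr// ler_peMr ?ltW// ltr1n.
  rewrite -(subrKA (f x)) (splitr e) (le_lt_trans (ler_normD _ _))// ltrD//.
    by rewrite distrC; exact: fr.
  exact: fr.
move=> h.
have [del [del0 hd]] : exists del : R, 0 < del /\ forall x, K x -> forall y,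
    ball x del y -> `|f x - f y| < e.
  have : \forall del \near (0 : R)^'+, 0 < del /\ forall x, K x -> forall y,
    ball x del y -> `|f x - f y| < e.
    near=> del; split; first by near: del; exact: nbhs_right_gt.
    by near: del.
  by move=> /filter_ex.
by exists del => // x y Kx; exact: hd.
Unshelve. all: by end_near. Qed.

Section weak_convergence.
Context d d' (T : measurableType d) (T' : measurableType d') (R : realType)
  (P : probability T R) (P' : probability T' R) (q : nat).
Variables (Y : nat -> T -> 'rV[R]_q) (Z : T' -> 'rV[R]_q).
Hypothesis mY : forall n, measurable_fun setT (Y n).
Hypothesis mZ : measurable_fun setT Z.
Hypothesis YZ : forall psi : 'I_q -> R -> R, (forall l, test_function (psi l)) ->
  \int[P]_w (\prod_l psi l (Y n w ord0 l)) @[n --> \oo] -->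
  \int[P']_w (\prod_l psi l (Z w ord0 l)).

(** * Approximation by tensor products of B-splines *)

Section approximation.
Variables (f : 'rV[R]_q -> R) (M : R) (A k : nat).
Hypotheses (cf : continuous f) (fM : forall x, `|f x| <= M) (k0 : (0 < k)%N).

(* The B-splines with nodes (j - 3) / k - A, for j < N, form a partition of unity
   on [-A, A]; their supports have length 4 / k. *)
Let N := (2 * A * k + 3)%N.
Let node (j : nat) : R := (j%:R - 3) / k%:R - A%:R.
Let hk : R := k%:R^-1.
Let B (j : nat) (x : R) := spline ((x - node j) / hk) - spline ((x - node j.+1) / hk).
Let chi x := spline ((x - node 0) / hk) - spline ((x - node N) / hk).

Let hk0 : 0 < hk. Proof. by rewrite invr_gt0 ltr0n. Qed.

Let kn0 : k%:R != 0 :> R. Proof. by rewrite pnatr_eq0 -lt0n. Qed.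

Let div_le0 u : u <= 0 -> u / hk <= 0.
Proof. by move=> u0; rewrite pmulr_lle0// invr_gt0. Qed.

Let nodeS j : node j.+1 = node j + hk.
Proof. by rewrite /node -natr1 /hk; field. Qed.

Let test_B j : test_function (B j).
Proof. by apply: test_functionB; exact: test_function_spline. Qed.

Let test_chi : test_function chi.
Proof. by apply: test_functionB; exact: test_function_spline. Qed.

Let B_ge0 j x : 0 <= B j x.
Proof.
rewrite subr_ge0 nodeS (_ : (x - (node j + hk)) / hk = (x - node j) / hk - 1).
  exact: spline_step.
by rewrite opprD addrA mulrBl divff// gt_eqF.
Qed.

(** The sum telescopes to a difference of two splines. The total weight is thus itself a test
    function, and [YZ] can control the mass left outside the box. *)
Let sumB x : \sum_(j < N) B j x = chi x.
Proof.
rewrite -(big_mkord xpredT (fun j => B j x)) /chi /B.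
by rewrite -opprB -(telescope_sumr (fun j => spline ((x - node j) / hk)))// -sumrN;
  apply: eq_bigr => j _; rewrite opprB.
Qed.

Let chi_itv x : 0 <= chi x <= 1.
Proof.
apply/andP; split; first by rewrite -sumB sumr_ge0.
have /andP[_ h1] := spline_itv ((x - node 0) / hk).
have /andP[h2 _] := spline_itv ((x - node N) / hk).
by rewrite /chi; lra.
Qed.

Let chi1 x : `|x| <= A%:R -> chi x = 1.
Proof.
rewrite ler_norml => /andP[x1 x2]; rewrite /chi spline_eq1 ?spline_eq0 ?subr0//.
  apply: div_le0; rewrite subr_le0 (le_trans x2)// /node /N.
  rewrite natrD !natrM addrK mulfK// lerBrDr; lra.
rewrite ler_pdivlMr// lerBrDr /node /hk; apply: le_trans x1.
by rewrite le_eqVlt; apply/orP; left; apply/eqP; field.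
Qed.

(** Below [node j] both splines are 0, and four steps above it both are 1. *)
Let B_support j x : B j x != 0 -> `|node j - x| < 4 * hk.
Proof.
apply: contraNT; rewrite -leNgt => h; rewrite /B nodeS.
have [h1|h1] := leP x (node j).
  rewrite !spline_eq0 ?subrr//; apply: div_le0; rewrite subr_le0//.
  by rewrite (le_trans h1)// lerDl ltW.
have h2 : 4 * hk <= x - node j by move: h; rewrite distrC gtr0_norm// subr_gt0.
rewrite !spline_eq1 ?subrr// ler_pdivlMr//; have := hk0; lra.
Qed.

Let node_box j : (j < N)%N -> `|node j| <= A%:R + 3.
Proof.
move=> jN; have k1 : 1 <= k%:R :> R by rewrite ler1n.
have hk1 : hk <= 1 by rewrite invf_le1// ltr0n.
have a0 : 0 <= A%:R :> R by [].
have j0 : 0 <= j%:R / k%:R :> R by rewrite divr_ge0.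
have jA : j%:R / k%:R <= 2 * A%:R + 3 * hk :> R.
  rewrite ler_pdivrMr ?ltr0n// mulrDl /hk mulfVK//.
  by rewrite -!natrM -natrD ler_nat -/N ltnW.
move: j0 jA; rewrite /node mulrBl ler_norml -/hk => j0 jA; apply/andP; split; lra.
Qed.

(** [f] sampled on the grid and interpolated: a finite combination of products of test functions, to
    which [YZ] applies term by term. *)
Let fa (x : 'rV[R]_q) := \sum_(J : {ffun 'I_q -> 'I_N})
  f (\row_l node (J l)) * \prod_l B (J l) (x ord0 l).

Variables (e del : R).
Hypothesis e_gt0 : 0 < e.
Let e0 : 0 <= e := ltW e_gt0.
Hypothesis fdel : forall x y : 'rV[R]_q, (forall i, `|x ord0 i| <= A%:R + 3) ->
  ball x del y -> `|f x - f y| < e.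
Hypothesis kdel : 4 / k%:R <= del.

Let prod_chi_itv (x : 'rV[R]_q) : 0 <= \prod_l chi (x ord0 l) <= 1.
Proof.
apply/andP; split; first by apply: prodr_ge0 => l _; have /andP[] := chi_itv (x ord0 l).
by apply: prodr_ile1 => l _; exact: chi_itv.
Qed.

(** Where a weight is nonzero, [x] is within [del] of its grid point, so there [f] varies by less
    than [e]. The weight missing to 1 multiplies a value of [f], hence the factor [M]. *)
Let fa_close x : `|f x - fa x| <= e + M * (1 - \prod_l chi (x ord0 l)).
Proof.
have /andP[c0 c1] := prod_chi_itv x; set c := \prod_l _ in c0 c1 *.
have cE : c = \sum_(J : {ffun 'I_q -> 'I_N}) \prod_l B (J l) (x ord0 l).
  rewrite /c -(bigA_distr_bigA (fun l j => B (j : 'I_N) (x ord0 l))).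
  by apply: eq_bigr => l _; rewrite sumB.
have -> : f x - fa x = (f x * c - fa x) + f x * (1 - c) by ring.
rewrite (le_trans (ler_normD _ _))// lerD//; last first.
  by rewrite normrM ler_pM// ger0_norm// subr_ge0.
rewrite cE mulr_sumr -sumrB (le_trans (ler_norm_sum _ _ _))//.
apply: (@le_trans _ _ (e * c)); last by rewrite ler_piMr.
rewrite cE mulr_sumr; apply: ler_sum => J _.
have pB : 0 <= \prod_l B (J l) (x ord0 l) by apply: prodr_ge0.
rewrite -mulrBl normrM (ger0_norm pB).
have [->|pB0] := eqVneq (\prod_l B (J l) (x ord0 l)) 0; first by rewrite !mulr0.
rewrite ler_wpM2r// distrC ltW// fdel//.
  by move=> i; rewrite mxE node_box.
split; first by rewrite (lt_le_trans _ kdel)// divr_gt0// ltr0n.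
move=> i l; rewrite (ord1 i) mxE -ball_normE /ball_/=.
apply: lt_le_trans kdel; apply: B_support.
by move/prodf_neq0 : pB0 => /(_ l isT).
Qed.

Let mcoordZ l : measurable_fun setT (fun w => Z w ord0 l).
Proof. exact: (measurableT_comp (measurable_coord l) mZ). Qed.

Let iprod d0 (T0 : measurableType d0) (P0 : probability T0 R) (W : T0 -> 'rV[R]_q)
    (psi : 'I_q -> R -> R) : measurable_fun setT W ->
  (forall l, test_function (psi l)) ->
  P0.-integrable setT (EFin \o (fun w => \prod_l psi l (W w ord0 l))).
Proof.
move=> mW tpsi.
have /choice[C psiC] := fun l => test_function_bounded (tpsi l).
apply: (@bounded_integrable _ _ _ _ _ (\prod_l C l)).
  apply: (@measurable_prod _ _ _ _ _ _ (fun l w => psi l (W w ord0 l))) => l _.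
  apply: measurableT_comp; last exact: (measurableT_comp (measurable_coord l) mW).
  by apply: continuous_measurable_fun; exact: test_function_continuous.
by move=> w; rewrite normr_prod; apply: ler_prod => l _; rewrite normr_ge0/=.
Qed.

Let integral_fa d0 (T0 : measurableType d0) (P0 : probability T0 R) (W : T0 -> 'rV[R]_q) :
  measurable_fun setT W ->
  P0.-integrable setT (EFin \o (fun w => fa (W w))) /\
  \int[P0]_w fa (W w) = \sum_(J : {ffun 'I_q -> 'I_N})
    f (\row_l node (J l)) * \int[P0]_w \prod_l B (J l) (W w ord0 l).
Proof.
move=> mW.
have iJ (J : {ffun 'I_q -> 'I_N}) := iprod P0 mW (fun l => test_B (J l)).
have [i1 ->] := @Rintegral_sum _ _ _ P0 _ (index_enum _)
  (fun (J : {ffun 'I_q -> 'I_N}) w =>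
    f (\row_l node (J l)) * \prod_l B (J l) (W w ord0 l))
  (fun J => integrableZl measurableT (f (\row_l node (J l))) (iJ J)).
split => //; apply: eq_bigr => J _.
by rewrite (RintegralZl _ _ (iJ J)).
Qed.

Let fa_cvg : \int[P]_w fa (Y n w) @[n --> \oo] --> \int[P']_w fa (Z w).
Proof.
rewrite (integral_fa P' mZ).2.
under eq_fun do rewrite (integral_fa P (mY _)).2.
apply: cvg_big => //; first by move=> x; exact: add_continuous.
by move=> J _; apply: cvgM; [exact: cvg_cst|exact: (YZ (fun l => test_B (J l)))].
Qed.

(** Stated for an arbitrary random vector [W], since both the [Y n] and [Z] need it. *)
Let bound_close d0 (T0 : measurableType d0) (P0 : probability T0 R) (W : T0 -> 'rV[R]_q) :
  measurable_fun setT W ->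
  `|\int[P0]_w f (W w) - \int[P0]_w fa (W w)| <=
  e + M * (1 - \int[P0]_w \prod_l chi (W w ord0 l)).
Proof.
move=> mW; have [ifa _] := integral_fa P0 mW.
have mf := continuous_measurable_rV cf.
have iF : P0.-integrable setT (EFin \o (fun w => f (W w))).
  by apply: (bounded_integrable P0 _ (fun w => fM _)); exact: measurableT_comp.
have ic := iprod P0 mW (fun=> test_chi).
have i1 := @finite_measure_integrable_cst _ _ R P0 setT 1 measurableT.
have ie := @finite_measure_integrable_cst _ _ R P0 setT e measurableT.
have i1c : P0.-integrable setT (EFin \o (fun w => 1 - \prod_l chi (W w ord0 l))).
  exact: integrableB i1 ic.
have iM : P0.-integrable setT (EFin \o (fun w => M * (1 - \prod_l chi (W w ord0 l)))).
  exact: (integrableZl measurableT M i1c).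
rewrite -RintegralB// (le_trans (le_normr_Rintegral _ _))//.
  exact: integrableB iF ifa.
have -> : e + M * (1 - \int[P0]_w \prod_l chi (W w ord0 l)) =
    \int[P0]_w (e + M * (1 - \prod_l chi (W w ord0 l))).
  rewrite RintegralD// prob_Rintegral_cst (RintegralZl _ _ i1c)//.
  by rewrite RintegralB// prob_Rintegral_cst.
apply: prob_le_Rintegral.
- by apply: integrable_norm => //; exact: integrableB iF ifa.
- exact: integrableD ie iM.
- by move=> w; exact: fa_close.
Qed.

Hypothesis Ze :
  1 - e <= \int[P']_w \prod_l (if `|Z w ord0 l| <= A%:R then 1 else 0).

Let chi_tight : 1 - \int[P']_w \prod_l chi (Z w ord0 l) <= e.
Proof.
rewrite lerBlDr -lerBlDl (le_trans Ze)//; apply: prob_le_Rintegral.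
- apply: (@bounded_integrable _ _ _ _ _ 1).
    apply: (@measurable_prod _ _ _ _ _ _
      (fun l w => if `|Z w ord0 l| <= A%:R then 1 else 0)) => l _.
    apply: measurable_fun_ifT => //; apply: measurable_fun_ler => //.
    exact: measurableT_comp.
  move=> w; rewrite ger0_norm ?prodr_ge0//; last by move=> l _; case: ifP.
  by apply: prodr_ile1 => l _; case: ifP => _; rewrite lexx ler01.
- exact: (iprod P' mZ (fun=> test_chi)).
- move=> w; apply: ler_prod => l _.
  have /andP[c0 _] := chi_itv (Z w ord0 l).
  by case: ifPn => [/chi1 ->|_]; rewrite ?ler01 ?lexx.
Qed.

Let M0 : 0 <= M.
Proof. by have := fM 0; apply: le_trans. Qed.

(** Tightness of the [Y n] is inherited from [Z]: the integrals of the cutoff converge, so its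
    defect is at most [e] for [Z] and [2 e] for [Y n]. With three further errors [e] the total is
    [3 e + 3 M e]. *)
Lemma weak_approximation :
  \forall n \near \oo, `|\int[P]_w f (Y n w) - \int[P']_w f (Z w)| <= 3 * (1 + M) * e.
Proof.
have chi_cvg : \int[P]_w \prod_l chi (Y n w ord0 l) @[n --> \oo] -->
    \int[P']_w \prod_l chi (Z w ord0 l) := YZ (fun=> test_chi).
near=> n.
have h1 : `|\int[P']_w fa (Z w) - \int[P]_w fa (Y n w)| <= e.
  by near: n; move/cvgrPdist_le : fa_cvg; exact.
have h2 : `|\int[P']_w \prod_l chi (Z w ord0 l) -
    \int[P]_w \prod_l chi (Y n w ord0 l)| <= e.
  by near: n; move/cvgrPdist_le : chi_cvg; exact.
have h3 := bound_close P (mY n); have h4 := bound_close P' mZ.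
move: h1 h2 h3 h4 chi_tight.
set a := \int[P']_w fa (Z w); set b := \int[P]_w fa (Y n w).
set c := \int[P']_w \prod_l _; set c' := \int[P]_w \prod_l _.
set x := \int[P]_w f (Y n w); set y := \int[P']_w f (Z w) => h1 h2 h3 h4 h5.
have -> : x - y = (x - b) - (y - a) - (a - b) by ring.
rewrite (le_trans (ler_normB _ _))//.
apply: le_trans (lerD (le_trans (ler_normB _ _) (lerD h3 h4)) h1) _.
have h6 : 1 - c' <= 2 * e by move: h2; rewrite ler_norml => /andP[]; lra.
have h7 := ler_wpM2l M0 h5; have h8 := ler_wpM2l M0 h6.
lra.
Unshelve. all: by end_near. Qed.

End approximation.

Let tight (e : R) : 0 < e -> exists A : nat,
  1 - e <= \int[P']_w \prod_l (if `|Z w ord0 l| <= A%:R then 1 else 0).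
Proof.
move=> e0; pose u (A : nat) w : R := \prod_l (if `|Z w ord0 l| <= A%:R then 1 else 0).
have mu A : measurable_fun setT (u A).
  apply: (@measurable_prod _ _ _ _ _ _
    (fun l w => if `|Z w ord0 l| <= A%:R then 1 else 0)) => l _.
  apply: measurable_fun_ifT => //; apply: measurable_fun_ler => //.
  apply: measurableT_comp => //.
  exact: (measurableT_comp (measurable_coord l) mZ).
have u1 A w : `|u A w| <= 1.
  rewrite ger0_norm ?prodr_ge0//; last by move=> l _; case: ifP.
  by apply: prodr_ile1 => l _; case: ifP => _; rewrite lexx ler01.
have cu w : u A w @[A --> \oo] --> (1 : R).
  apply: cvg_near_cst; near=> A; apply: big1 => l _.
  rewrite ifT//; apply: (@le_trans _ _ (\sum_j `|Z w ord0 j|)).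
    by rewrite (bigD1 l)//= lerDl sumr_ge0.
  by near: A; exact: nbhs_infty_ger.
have : \int[P']_w u A w @[A --> \oo] --> \int[P']_w (1 : R).
  apply: fine_cvg; rewrite Rintegral_EFin//; last exact: finite_measure_integrable_cst.
  apply: (@dominated_cvg _ _ _ _ _ _ _ _ (cst 1%E)) => //.
  - by move=> A; exact/measurable_EFinP.
  - by move=> w _; apply: cvg_EFin; [exact: nearW|exact: cu].
  - exact: finite_measure_integrable_cst.
  - by move=> A w _; rewrite lee_fin.
rewrite prob_Rintegral_cst => /cvgrPdist_le /(_ _ e0) /filter_ex[A hA].
by exists A; move: hA; rewrite ler_norml => /andP[_]; rewrite lerBlDl -lerBlDr.
Unshelve. all: by end_near. Qed.

(** The parameters are chosen in this order: the box from the tightness of [Z], then [del] from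
    uniform continuity on the box enlarged by 3, which contains all nodes, then the mesh [1 / k]
    from [del]. *)
Lemma test_function_weak_convergence : cvg_in_distribution P Y P' Z.
Proof.
move=> f cf [M0 [_ fM0]].
have [M fM] : exists M : R, forall x, `|f x| <= M.
  by exists (M0 + 1) => x; apply: fM0 => //; rewrite ltrDl.
have M_ge0 : 0 <= M by have := fM 0; apply: le_trans.
have mf := continuous_measurable_rV cf.
have EE d0 (T0 : measurableType d0) (P0 : probability T0 R) (W : T0 -> 'rV[R]_q) :
    measurable_fun setT W -> ('E_P0[f \o W] = (\int[P0]_w f (W w))%:E)%E.
  move=> mW; rewrite unlock Rintegral_EFin//.
  by apply: (bounded_integrable P0 _ (fun w => fM _)); exact: measurableT_comp.
rewrite (EE _ _ _ _ mZ); under eq_fun do rewrite EE//.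
apply: cvg_EFin; first exact: nearW.
apply/cvgrPdist_le => e e0.
pose e' := e / (3 * (1 + M)).
have M3 : 0 < 3 * (1 + M) by rewrite mulr_gt0// ltr_pwDl.
have e'0 : 0 < e' by rewrite divr_gt0.
have [A hA] := tight e'0.
have [del del0 fdel] := compact_uniform_continuity (@box_compact R q (A%:R + 3)) cf e'0.
pose k := (Num.truncn (4 / del)).+1.
have kdel : 4 / k%:R <= del.
  rewrite ler_pdivrMr ?ltr0n// mulrC -ler_pdivrMr//.
  by rewrite ltW// truncnS_gt.
have k0 : (0 < k)%N by [].
have := weak_approximation cf fM k0 e'0 fdel kdel hA.
apply: filterS => n; rewrite distrC (_ : 3 * (1 + M) * e' = e)//.
by rewrite /e' mulrC divfK// gt_eqF.
Qed.

End weak_convergence.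

(** * Conditional expectations and homogeneous fields *)

Section conditional_expectation_lemmas.
Context d (T : measurableType d) (R : realType) (P : probability T R).
Variable I : set (set T).
Hypotheses (sI : sigma_algebra setT I) (Im : I `<=` measurable).
Implicit Types X W : T -> R.

Let IT : I setT.
Proof. by have [I0 IC _] := sI; rewrite -(setD0 setT); exact: IC. Qed.

Lemma is_cond_exp_measurable X W : is_cond_exp P I X W -> measurable_fun setT W.
Proof. by move=> [mW _ _] _ B mB; rewrite setTI; exact/Im/mW. Qed.

Lemma is_cond_exp_integral X W : is_cond_exp P I X W ->
  (\int[P]_w (W w)%:E = \int[P]_w (X w)%:E)%E.
Proof. by move=> [_ _]; exact. Qed.

(** Functions that agree almost everywhere have exactly the same versions of the conditional
    expectation, so [get] picks the same one and the equality is literal. *)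
Lemma eq_ae_cond_exp X X' : measurable_fun setT X -> measurable_fun setT X' ->
  {ae P, forall w, X w = X' w} -> cond_exp P I X = cond_exp P I X'.
Proof.
move=> mX mX' XX'; congr (get _); apply/funext => W; apply/propext.
have E A : I A -> (\int[P]_(w in A) (X w)%:E = \int[P]_(w in A) (X' w)%:E)%E.
  move=> IA; apply: ae_eq_integral.
  - exact: Im.
  - by apply/measurable_EFinP; exact: measurable_funTS.
  - by apply/measurable_EFinP; exact: measurable_funTS.
  - by apply: filterS XX' => w -> _.
by split=> -[mW iW WX]; split => // A IA; rewrite WX// E.
Qed.

(** The events [W > c] and [W < c] belong to [I], hence have probability 0 or 1. Probability 1 would
    contradict that [W - c] has integral 0. *)
Lemma trivial_cond_exp X : P.-integrable setT (EFin \o X) ->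
  (forall F, I F -> P F = 0%E \/ P F = 1%E) ->
  {ae P, forall w, cond_exp P I X w = \int[P]_w X w}.
Proof.
move=> iX I01; have cX := cond_expP sI Im iX; set W := cond_exp P I X in cX *.
have [mWI iW _] := cX; have mW := is_cond_exp_measurable cX.
have EW : \int[P]_w W w = \int[P]_w X w by rewrite /Rintegral (is_cond_exp_integral cX).
rewrite -EW; set c := \int[P]_w W w.
have ic := @finite_measure_integrable_cst _ _ R P setT c measurableT.
(* The sign of [s] selects the event: [s = 1] treats [W > c], [s = -1] treats [W < c]. *)
have key (s : R) : s != 0 -> P [set w | 0 < s * (W w - c)] = 1%E -> False.
  move=> s0 P1; have mF : measurable [set w | 0 < s * (W w - c)].
    rewrite -[X in measurable X]setTI.
    apply: (measurable_fun_ltr (f := cst 0)) => //.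
    by apply: measurable_funM => //; exact: measurable_funB.
  have iWc : P.-integrable setT (EFin \o (fun w => W w - c)) by exact: integrableB iW ic.
  have isc : P.-integrable setT (EFin \o (fun w => s * (W w - c))).
    exact: (integrableZl measurableT s iWc).
  have E0 : (\int[P]_w (s * (W w - c))%:E = 0)%E.
    rewrite -Rintegral_EFin// RintegralZl// RintegralB// prob_Rintegral_cst.
    by rewrite -/c subrr mulr0.
  have pae : {ae P, forall w, 0 < s * (W w - c)}.
    exists (~` [set w | 0 < s * (W w - c)]); split => //.
      exact: measurableC.
    by rewrite probability_setC// P1 subee.
  have : ae_eq P setT (EFin \o (fun w => s * (W w - c))) (cst 0%E).
    have mis : measurable_fun setT (EFin \o (fun w => s * (W w - c))).
      by have /integrableP[] := isc.
    apply: (ae_eq_integral_abs P measurableT mis).1.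
    rewrite -[RHS]E0; apply: ae_eq_integral => //.
    - by apply: measurableT_comp => //; have /integrableP[] := isc.
    - by apply: filterS pae => w h _ /=; rewrite ger0_norm// ltW.
  move=> a0; have : {ae P, forall w : T, False}.
    move: pae a0; apply: filterS2 => w /= h /(_ Logic.I) [h0].
    by rewrite h0 ltxx in h.
  move=> [N [mN N0 sN]]; have NT : N = setT by rewrite -subTset => w _; apply: sN => /=; exact.
  by move: N0; rewrite NT probability_setT => -[/eqP]; rewrite oner_eq0.
have ltW_I (s : R) : I [set w | 0 < s * (W w - c)].
  rewrite (_ : [set w | _] = W @^-1` [set x | 0 < s * (x - c)])//; apply: mWI.
  rewrite -[X in measurable X]setTI; apply: (measurable_fun_ltr (f := cst 0)) => //.
  by apply: measurable_funM => //; exact: measurable_funB.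
have p0 (s : R) : s != 0 -> P.-negligible [set w | 0 < s * (W w - c)].
  move=> s0; have mF := Im (ltW_I s).
  have [h|h] := I01 _ (ltW_I s); first exact/negligibleP.
  by have := key s s0 h.
have := negligibleU (p0 1 (oner_neq0 R)) (p0 (-1) _); rewrite oppr_eq0 oner_eq0.
move=> /(_ isT); apply: negligibleS => w /= Wc.
have : W w - c != 0 by rewrite subr_eq0; exact/eqP.
by rewrite neq_lt => /orP[h|h]; [right|left]; lra.
Qed.

End conditional_expectation_lemmas.

(** * Integrals over windows and the sigma-field of invariant events *)

Section field_lemmas.
Context (R : realType) (K : index_kind) (m : nat).
Local Notation T := (index_space R K m).
Local Notation lambda := (index_measure R K m).
Context d (Omega : measurableType d) (P : probability Omega R).
Variable Y : T -> Omega -> R.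
Hypotheses (fY : random_field Y) (homY : homogeneous P Y).

Lemma field_jointly_measurable :
  measurable_fun setT (fun p : T * Omega => Y p.1 p.2).
Proof.
move: Y fY => Y' [mY jY]; case: K Y' mY jY => Y' mY jY; first exact: jY.
move=> _ B mB; rewrite setTI.
rewrite (_ : _ @^-1` _ = \bigcup_(t : lattice m) ([set t] `*` (Y' t @^-1` B))).
  apply: countable_bigcupT_measurable => [|t]; first exact: countableP.
  apply: measurableX => //.
  by rewrite -[X in measurable X]setTI; exact: mY.
apply/seteqP; split => [[t w] /= Bw|[t w] [s _ [/= -> //]]].
by exists t.
Qed.

Let mYt t : measurable_fun setT (Y t). Proof. exact: fY.1. Qed.

Let index_addO (t : T) : index_add index_origin t = t.
Proof. by case: K t => t; exact: add0r. Qed.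

Lemma homogeneous_marginal t (B : set R) : measurable B ->
  P (Y t @^-1` B) = P (Y index_origin @^-1` B).
Proof.
move=> mB; have := @homY 1 (fun=> index_origin) t [set v | B (v ord0 ord0)].
rewrite index_addO.
have -> : [set w | [set v : 'rV[R]_1 | B (v ord0 ord0)] (\row__ Y t w)] = Y t @^-1` B.
  by apply/seteqP; split => w /=; rewrite mxE.
have -> : [set w | [set v : 'rV[R]_1 | B (v ord0 ord0)] (\row__ Y index_origin w)] =
    Y index_origin @^-1` B.
  by apply/seteqP; split => w /=; rewrite mxE.
apply; rewrite -[X in measurable X]setTI.
exact: (@measurable_coord R 1 ord0).
Qed.

Lemma homogeneous_integral t (f : R -> \bar R) : measurable_fun setT f ->
  (forall x, 0 <= f x)%E ->
  (\int[P]_w f (Y t w) = \int[P]_w f (Y index_origin w))%E.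
Proof.
move=> mf f0; pose M t : {mfun Omega >-> R} := MeasurableFun.Pack
  (MeasurableFun.Class (isMeasurableFun.Build _ _ _ _ _ (mYt t))).
rewrite -(ge0_integral_distribution (M t))// -(ge0_integral_distribution (M index_origin))//.
by apply: eq_measure_integral => B mB _; exact: homogeneous_marginal.
Qed.

(** By Tonelli and homogeneity, the expectation of the window integral is the measure of the window
    times the expectation at the origin. It is finite, so the window integral is finite almost
    surely. *)
Lemma integrable_on_window (S : set T) (f : R -> R) : measurable S ->
  (lambda S < +oo)%E -> measurable_fun setT f -> (forall x, 0 <= f x) ->
  (\int[P]_w (f (Y index_origin w))%:E < +oo)%E ->
  {ae P, forall w, lambda.-integrable S (EFin \o (fun t => f (Y t w)))}.
Proof.
move=> mS Sfin mf f0 fin.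
pose g (p : T * Omega) := ((f (Y p.1 p.2))%:E * (\1_S p.1)%:E)%E.
have g0 p : (0 <= g p)%E by rewrite mule_ge0// lee_fin.
have mfY := measurableT_comp mf field_jointly_measurable.
have mg : measurable_fun setT g.
  apply: emeasurable_funM; first exact/measurable_EFinP.
  by apply/measurable_EFinP; apply: measurableT_comp.
have := fubini_tonelli (m1 := lambda) (m2 := P) g mg g0.
have -> : (\int[lambda]_t \int[P]_w g (t, w) =
    (\int[P]_w (f (Y index_origin w))%:E) * lambda S)%E.
  have gE t : (\int[P]_w g (t, w) =
      (\int[P]_w (f (Y index_origin w))%:E) * (\1_S t)%:E)%E.
    transitivity (\int[P]_w ((f (Y t w))%:E * (\1_S t)%:E))%E; first by [].
    rewrite ge0_integralZr//; last 2 first.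
    - by apply/measurable_EFinP; exact: (measurableT_comp mf (mYt t)).
    - by move=> w _; rewrite lee_fin.
    congr (_ * _)%E; apply: (homogeneous_integral t (f := EFin \o f)) => //.
    exact/measurable_EFinP.
  under eq_integral do rewrite gE.
  rewrite ge0_integralZl//; last 2 first.
  - exact/measurable_EFinP.
  - by apply: integral_ge0 => w _; rewrite lee_fin.
  by rewrite integral_indic// setIT.
move=> FE; pose G w := (\int[lambda]_t g (t, w))%E.
have mG : measurable_fun setT G := measurable_fun_fubini_tonelli_G (m1 := lambda) g mg g0.
have G0 w : (0 <= G w)%E by apply: integral_ge0.
have iG : P.-integrable setT G.
  apply/integrableP; split => //; under eq_integral do rewrite gee0_abs//.
  rewrite -FE lte_mul_pinfty//; first by apply: integral_ge0 => w _; rewrite lee_fin.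
  by rewrite ge0_fin_numE//; apply: integral_ge0 => w _; rewrite lee_fin.
have := integrable_ae measurableT iG; apply: filterS => w /(_ I) Gw.
apply/integrableP; split.
  apply/measurable_EFinP; apply: measurable_funTS.
  have : measurable_fun setT (fun t => (f \o (fun p : T * Omega => Y p.1 p.2)) (t, w)).
    by apply: measurableT_comp => //; exact: measurable_pair2.
  exact.
rewrite (_ : (\int[_]_(_ in _) _)%E = G w); first by rewrite ltey_eq Gw.
rewrite integral_mkcond; apply: eq_integral => t _.
rewrite patchE /g/= indicE; case: ifPn => tS.
  by rewrite mule1 ger0_norm.
by rewrite mule0.
Qed.

(** The integral may fail to be finite for some [w], so the positive and negative parts are handled
    separately by Tonelli's theorem. *)
Lemma measurable_space_average (S : set T) (g : T * Omega -> R) : measurable S ->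
  measurable_fun setT g ->
  measurable_fun setT (fun w => space_average S (fun t => g (t, w))).
Proof.
move=> mS mg; apply: measurable_funM => //.
pose gS (p : T * Omega) : R := g p * \1_S p.1.
have mgS : measurable_fun setT gS.
  by apply: measurable_funM => //; exact: measurableT_comp.
have mgE : measurable_fun setT (EFin \o gS).
  exact/measurable_EFinP.
have E w : \int[lambda]_(t in S) g (t, w) =
    fine (\int[lambda]_t (EFin \o gS) (t, w))%E.
  congr fine; rewrite integral_mkcond; apply: eq_integral => t _.
  by rewrite patchE /gS /= indicE; case: ifPn => tS; rewrite ?mulr1 ?mulr0.
under eq_fun do rewrite E.
apply: measurableT_comp => //.
under eq_fun do rewrite integralE.
apply: emeasurable_funB.
- rewrite [X in measurable_fun _ X](_ : _ = fubini_G lambda ((EFin \o gS)^\+)%E); last first.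
    by apply/funext => x; apply: eq_integral => t _; rewrite !funeposE.
  by apply: measurable_fun_fubini_tonelli_G => //; exact: measurable_funepos.
- rewrite [X in measurable_fun _ X](_ : _ = fubini_G lambda ((EFin \o gS)^\-)%E); last first.
    by apply/funext => x; apply: eq_integral => t _; rewrite !funenegE.
  by apply: measurable_fun_fubini_tonelli_G => //; exact: measurable_funeneg.
Qed.

Let cylinder_measurable (A : set (T -> R)) (h : Omega -> T -> R) :
  (forall t, measurable_fun setT (h ^~ t)) -> cylinder_sigma_field A ->
  measurable (h @^-1` A).
Proof.
move=> mh; suff : @cylinder_sigma_field R K m `<=` [set A | measurable (h @^-1` A)] by exact.
apply: smallest_sub; last first.
  move=> _ [t [B [mB ->]]] /=; rewrite -[X in measurable X]setTI.
  exact: mh.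
split.
- by rewrite /= preimage_set0.
- move=> C mC; rewrite /= setTD preimage_setC; exact: measurableC.
- move=> F mF; rewrite /= preimage_bigcup; exact: bigcupT_measurable.
Qed.

Lemma invariant_events_measurable : invariant_events P Y `<=` measurable.
Proof.
move=> _ [A [cA -> _]].
exact: (cylinder_measurable (h := fun w t => Y t w) mYt cA).
Qed.

Let mcyl A t : cylinder_sigma_field A -> measurable [set w | A (fun s => Y (index_add s t) w)].
Proof.
by move=> cA; exact: (cylinder_measurable (h := fun w s => Y (index_add s t) w)
  (fun s => mYt _) cA).
Qed.

Let mcyl0 A : cylinder_sigma_field A -> measurable [set w | A (Y ^~ w)].
Proof.
by move=> cA; exact: (cylinder_measurable (h := fun w t => Y t w) mYt cA).
Qed.

(** Complements leave the symmetric difference unchanged; for a countable union it is contained in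
    the union of the symmetric differences, a null set. *)
Lemma invariant_events_sigma_algebra : sigma_algebra setT (invariant_events P Y).
Proof.
have cs : sigma_algebra setT (@cylinder_sigma_field R K m) by exact: smallest_sigma_algebra.
have [c0 cC cU] := cs.
split.
- exists set0; split => //.
  by move=> t; rewrite (_ : _ `+` _ = set0) ?measure0//; apply/seteqP; split => // w [] [].
- move=> _ [A [cA -> Ainv]]; exists (setT `\` A); split.
  + exact: cC.
  + by rewrite !setTD.
  + move=> t; rewrite -(Ainv t); congr (P _).
    rewrite !setTD; apply/seteqP; split => w /=; rewrite /setY /setC/=;
      case: (pselect (A (Y ^~ w))) => a1;
      case: (pselect (A (fun s => Y (index_add s t) w))) => a2; tauto.
- move=> F FI; have /choice[A AE] : forall n, exists A, [/\ cylinder_sigma_field A,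
      F n = [set w | A (Y ^~ w)] & forall t, P ([set w | A (Y ^~ w)] `+`
        [set w | A (fun s => Y (index_add s t) w)]) = 0%E] by move=> n; exact: FI.
  exists (\bigcup_n A n); split.
  + by apply: cU => n; have [] := AE n.
  + by apply/seteqP; split => w [n _ h]; exists n => //; move: h; have [_ -> _] := AE n.
  + move=> t; apply/eqP; rewrite -measure_le0.
    have mD n : measurable ([set w | A n (Y ^~ w)] `+`
        [set w | A n (fun s => Y (index_add s t) w)]).
      have [cAn _ _] := AE n.
      by apply: measurableU; apply: measurableD; [exact: mcyl0|exact: mcyl..|exact: mcyl0].
    have cUA : cylinder_sigma_field (\bigcup_n A n) by apply: cU => n; have [] := AE n.
    have mX : measurable ([set w | (\bigcup_n A n) (Y ^~ w)] `+`
        [set w | (\bigcup_n A n) (fun s => Y (index_add s t) w)]).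
      by apply: measurableU; apply: measurableD; [exact: mcyl0|exact: mcyl..|exact: mcyl0].
    have sX : [set w | (\bigcup_n A n) (Y ^~ w)] `+`
        [set w | (\bigcup_n A n) (fun s => Y (index_add s t) w)] `<=`
        \bigcup_n ([set w | A n (Y ^~ w)] `+`
          [set w | A n (fun s => Y (index_add s t) w)]).
      move=> w /= [[[n _ h1] h2]|[[n _ h1] h2]]; exists n => //; [left|right];
        by split => // h; apply: h2; exists n.
    have := @measure_sigma_subadditive _ _ _ P _ _ mD mX sX.
    rewrite (eseries0 (f := fun n => P ([set w | A n (Y ^~ w)] `+`
      [set w | A n (fun s => Y (index_add s t) w)])))//.
    by move=> n _ _; have [_ _ h] := AE n; exact: h.
Qed.

End field_lemmas.

(** * Spatial averages of a scalar field *)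

Lemma measurable_path (R : realType) (K : index_kind) (m : nat) d
    (Omega : measurableType d) (Y : index_space R K m -> Omega -> R) (w : Omega) :
  random_field Y -> measurable_fun setT (Y ^~ w).
Proof.
move=> fY.
exact: (measurableT_comp (field_jointly_measurable fY) (measurable_pair2 w)).
Qed.

Section average_algebra.
Context d (T : measurableType d) (R : realType) (lam : {measure set T -> \bar R}).
Variables (S : set T) (f : T -> R) (mu : R).
Hypotheses (mS : measurable S) (S0 : (0 < lam S)%E) (Sfin : (lam S < +oo)%E).
Hypotheses (mf : measurable_fun S f).
Hypothesis if2 : lam.-integrable S (EFin \o (fun t => (f t - mu) ^+ 2)).

Let avg (g : T -> R) := (fine (lam S))^-1 * \int[lam]_(t in S) g t.

Let icst (r : R) : lam.-integrable S (EFin \o cst r).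
Proof.
apply: measurable_bounded_integrable => //.
by exists `|r|; split; rewrite ?num_real// => x xr y _; exact: ltW.
Qed.

Let S_gt0 : 0 < fine (lam S).
Proof. by rewrite fine_gt0// S0. Qed.

Let avg_cst r : avg (cst r) = r.
Proof. by rewrite /avg Rintegral_cst// mulrCA mulVf ?mulr1// gt_eqF. Qed.

Lemma integrable_centered : lam.-integrable S (EFin \o (fun t => f t - mu)).
Proof.
apply: le_integrable (integrableD mS (icst 1) if2) => //.
  by apply/measurable_EFinP; exact: measurable_funB.
move=> t _ /=; rewrite lee_fin [leRHS]ger0_norm ?addr_ge0 ?sqr_ge0//.
by rewrite -(real_normK (num_real (f t - mu))); have := normr_ge0 (f t - mu); nra.
Qed.

Lemma average_mean : avg f = mu + avg (fun t => f t - mu).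
Proof.
rewrite -[X in X + _]avg_cst /avg -mulrDr -(RintegralD mS (icst mu) integrable_centered).
congr (_ * _).
by apply: eq_Rintegral => t _ /=; rewrite addrC subrK.
Qed.

(** The empirical center [avg f] changes with the window, so pointwise averaging does not apply to
    the left side directly. The right side averages a fixed function of [f] and corrects by the
    squared bias. *)
Lemma average_variance :
  avg (fun t => (f t - avg f) ^+ 2) = avg (fun t => (f t - mu) ^+ 2) - (avg f - mu) ^+ 2.
Proof.
have D : avg (fun t => f t - mu) = avg f - mu by rewrite average_mean addrAC subrr add0r.
set M := avg f in D *; set c := M - mu in D *.
have i3 : lam.-integrable S (EFin \o (fun t => - 2 * c * (f t - mu))).
  exact: (integrableZl mS (- 2 * c) integrable_centered).
have i23 : lam.-integrable S (EFin \o (fun t => (f t - mu) ^+ 2 + - 2 * c * (f t - mu))).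
  exact: (integrableD mS if2 i3).
transitivity ((fine (lam S))^-1 *
    \int[lam]_(t in S) ((f t - mu) ^+ 2 + - 2 * c * (f t - mu) + c ^+ 2)).
  by congr (_ * _); apply: eq_Rintegral => t _; rewrite /c; ring.
rewrite (RintegralD mS i23 (icst (c ^+ 2))) (RintegralD mS if2 i3).
rewrite (RintegralZl _ _ integrable_centered)//.
rewrite !mulrDr -/(avg _) -/(avg (cst (c ^+ 2))) avg_cst mulrCA -/(avg _) D /c.
ring.
Qed.

End average_algebra.

Lemma expectationE d (Omega : measurableType d) (R : realType)
    (P : probability Omega R) (X : Omega -> R) :
  ('E_P[X] = \int[P]_w (X w)%:E)%E.
Proof. by rewrite unlock. Qed.

(** Continuous, bounded and zero only at 0: its integral tends to 0 exactly when the argument tends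
    to 0 in probability. *)
Definition clip (R : realType) (x : R) : R := Num.min 1 `|x|.

Lemma clip_continuous (R : realType) : continuous (@clip R).
Proof.
move=> x; apply: (@continuous_min _ _ (cst 1) (fun x => `|x|)); first exact: cvg_cst.
exact: norm_continuous.
Qed.

Lemma measurable_clip (R : realType) : measurable_fun setT (@clip R).
Proof. by apply: continuous_measurable_fun; exact: clip_continuous. Qed.

Lemma clip_itv (R : realType) (x : R) : 0 <= clip x <= 1.
Proof. by rewrite /clip ge_min lexx le_min ler01 normr_ge0. Qed.

Lemma clip_norm_le1 (R : realType) (x : R) : `|clip x| <= 1.
Proof. by have /andP[c0 c1] := clip_itv x; rewrite ger0_norm. Qed.

Section scalar_field_limits.
Context (R : realType) (K : index_kind) (m : nat).
Local Notation T := (index_space R K m).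
Local Notation lambda := (index_measure R K m).
Context d (Omega : measurableType d) (P : probability Omega R).
Variable Y : T -> Omega -> R.
Hypotheses (fY : random_field Y) (homY : homogeneous P Y).
Hypothesis Y2 : ('E_P[(fun w => `|Y index_origin w| ^+ 2)%R] < +oo)%E.
Variables (S : nat -> set T) (k : nat -> nat).
Hypothesis SY : pointwise_averaging S.
Hypothesis Sfin : \forall n \near \oo, (lambda (S n) < +oo)%E.
Hypothesis koo : k n @[n --> \oo] --> \oo.

Local Notation mu := (fine 'E_P[Y index_origin]).
Local Notation I := (invariant_events P Y).
Local Notation avg n f := (space_average (S n) f).
Local Notation M n w := (avg n (fun t => Y t w)).

Hypothesis kM : cvg_in_distribution P
  (fun n w => Num.sqrt (k n)%:R * (M n w - mu)) P (cst 0).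

Let Y0 := Y index_origin.
Let mY0 : measurable_fun setT Y0. Proof. exact: fY.1. Qed.
Let mS n : measurable (S n). Proof. by have [/(_ n)[]] := SY. Qed.
Let S0 n : (0 < lambda (S n))%E. Proof. by have [/(_ n)[]] := SY. Qed.
Let sI := invariant_events_sigma_algebra P fY.
Let Im := @invariant_events_measurable _ _ _ _ _ P _ fY.

Let iY2 : P.-integrable setT (EFin \o (fun w => Y0 w ^+ 2)).
Proof.
apply/integrableP; split; first by apply/measurable_EFinP; exact: measurable_funX.
move: Y2; rewrite unlock; congr (_ < _)%E; apply: eq_integral => w _ /=.
by rewrite real_normK ?num_real// ger0_norm ?sqr_ge0.
Qed.

Let iY : P.-integrable setT (EFin \o Y0).
Proof. exact: square_integrable_integrable mY0 iY2. Qed.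

Let imu := @finite_measure_integrable_cst _ _ R P setT mu measurableT.

Let iYmu2 : P.-integrable setT (EFin \o (fun w => (Y0 w - mu) ^+ 2)).
Proof.
apply: (le_integrable measurableT _ _ (integrableD measurableT
  (integrableZl measurableT 2 iY2)
  (@finite_measure_integrable_cst _ _ R P setT (2 * mu ^+ 2) measurableT))).
  by apply/measurable_EFinP; apply: measurable_funX; exact: measurable_funB.
move=> w _ /=; rewrite lee_fin ger0_norm ?sqr_ge0// ger0_norm; last first.
  by rewrite addr_ge0// mulr_ge0// sqr_ge0.
have := sqr_ge0 (Y0 w + mu); have := sqr_ge0 (Y0 w - mu); nra.
Qed.

Let W := cond_exp P I Y0.
Let cW : is_cond_exp P I Y0 W. Proof. exact: cond_expP. Qed.
Let mW : measurable_fun setT W. Proof. exact: is_cond_exp_measurable Im _ _ cW. Qed.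

Let mM n : measurable_fun setT (fun w => M n w).
Proof.
exact: (measurable_space_average (mS n) (field_jointly_measurable fY)).
Qed.

Let MW : {ae P, forall w, M n w @[n --> \oo] --> W w}.
Proof.
have [_ _ /(_ _ _ P Y id fY homY)] := SY; exact.
Qed.

Let U n w := Num.sqrt (k n)%:R * (M n w - mu).

Let mU n : measurable_fun setT (U n).
Proof. by apply: measurable_funM => //; exact: measurable_funB. Qed.

(** The drift assumption [kM] acts through this limit. *)
Lemma clip_cvg0 : \int[P]_w clip (U n w) @[n --> \oo] --> (0 : R).
Proof.
have bclip : bounded_fun (@clip R).
  by exists 1; split => // x x1 y _; exact: le_trans (clip_norm_le1 y) (ltW x1).
have := kM (@clip_continuous R) bclip.
rewrite (_ : 'E_P[@clip R \o cst 0%R] = 0)%E; last first.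
  rewrite unlock /= (_ : clip 0 = 0) ?integral0//.
  by rewrite /clip normr0 min_r.
move=> /fine_cvg; rewrite (_ : fine \o _ = fun n => \int[P]_w clip (U n w))//.
by apply/funext => n /=; rewrite expectationE.
Qed.

(* M n converges a.e. to W, and sqrt(k n) (M n - mu) tends to 0 in probability. *)
Lemma cond_mean_constant : {ae P, forall w, W w = mu}.
Proof.
have iclip (X : Omega -> R) : measurable_fun setT X ->
    P.-integrable setT (EFin \o (fun w => clip (X w))).
  by move=> mX; apply: (bounded_integrable P _ (fun w => clip_norm_le1 _));
    exact: (measurableT_comp (@measurable_clip R)).
have mMmu n : measurable_fun setT (fun w => M n w - mu) by exact: measurable_funB.
have mWmu : measurable_fun setT (fun w => W w - mu) by exact: measurable_funB.
(* Once [k n >= 1], the factor [Num.sqrt (k n)%:R] is at least 1 and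
   [clip (M n w - mu) <= clip (U n w)]. By dominated convergence the same integrals tend to that of
   [clip (W w - mu)], which must therefore be 0. *)
have c1 : \int[P]_w clip (M n w - mu) @[n --> \oo] --> (0 : R).
  apply: (@squeeze_cvgr _ _ _ _ (cst 0) (fun n => \int[P]_w clip (U n w))).
  - have : \forall n \near \oo, (1 <= k n)%N.
      by move/cvgnyPge : koo; exact.
    apply: filterS => n kn; rewrite Rintegral_ge0/=; last first.
      by move=> w _; have /andP[] := clip_itv (M n w - mu).
    apply: prob_le_Rintegral; [exact: iclip|exact: iclip|move=> w].
    rewrite /clip le_min ge_min lexx/= ge_min; apply/orP; right.
    rewrite /U normrM ler_peMl// ger0_norm ?sqrtr_ge0//.
    by rewrite -[leLHS]sqrtr1 ler_sqrt// ler1n.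
  - exact: cvg_cst.
  - exact: clip_cvg0.
have c2 : \int[P]_w clip (M n w - mu) @[n --> \oo] --> \int[P]_w clip (W w - mu).
  apply: fine_cvg; rewrite Rintegral_EFin//; last exact: iclip.
  have mcM n : measurable_fun setT (fun w => (clip (M n w - mu))%:E).
    by apply/measurable_EFinP; exact: (measurableT_comp (@measurable_clip R)).
  have mcW : measurable_fun setT (fun w => (clip (W w - mu))%:E).
    by apply/measurable_EFinP; exact: (measurableT_comp (@measurable_clip R)).
  have cvg_clip : {ae P, forall w, setT w ->
      (clip (M n w - mu))%:E @[n --> \oo] --> (clip (W w - mu))%:E}.
    move: MW; apply: filterS => w h _; apply: cvg_EFin; first exact: nearW.
    apply: (cvg_comp (fun n => M n w - mu) (@clip R)); last exact: clip_continuous.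
    by apply: cvgB => //; exact: cvg_cst.
  have icst1 : P.-integrable setT (cst 1%E).
    exact: (finite_measure_integrable_cst P 1 measurableT).
  have bnd : {ae P, forall w n, setT w -> (`|(clip (M n w - mu))%:E| <= cst 1 w)%E}.
    by apply: aeW => w n _; rewrite lee_fin clip_norm_le1.
  by have [] := dominated_convergence measurableT mcM mcW cvg_clip icst1 bnd.
have c0 : \int[P]_w clip (W w - mu) = 0 by exact: cvg_unique c2 c1.
have : ae_eq P setT (EFin \o (fun w => clip (W w - mu))) (cst 0%E).
  apply: (ae_eq_integral_abs P measurableT _).1.
    by apply/measurable_EFinP; exact: (measurableT_comp (@measurable_clip R)).
  under eq_integral do rewrite /= ger0_norm ?(andP (clip_itv _)).1//.
  by rewrite -Rintegral_EFin ?c0//; exact: iclip.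
apply: filterS => w /(_ Logic.I) [h]; apply/eqP; rewrite -subr_eq0 -normr_eq0.
move: h; rewrite /clip /Num.min; case: ifP => // _ /eqP; by rewrite ?oner_eq0.
Qed.

Let avg_cvg (f : R -> R) : measurable_fun setT f ->
  P.-integrable setT (EFin \o (fun w => f (Y0 w))) ->
  {ae P, forall w, avg n (fun t => f (Y t w)) @[n --> \oo] -->
    cond_exp P I (fun w => f (Y0 w)) w}.
Proof. by move=> mf iF; have [_ _ /(_ _ _ P Y f fY homY mf iF)] := SY. Qed.

Let v := cond_exp P I (fun w => (Y0 w - mu) ^+ 2).

(** The conditional variance is centered at [W], which equals [mu] almost everywhere;
    [eq_ae_cond_exp] makes this a literal equality. *)
Lemma cond_var_centered : cond_var P I Y0 = v.
Proof.
apply: (eq_ae_cond_exp Im).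
- by apply: measurable_funX; exact: measurable_funB.
- by apply: measurable_funX; exact: measurable_funB.
- by move: cond_mean_constant; apply: filterS => w; rewrite /W => ->.
Qed.

Lemma ergodic_cond_var : ergodic P Y -> {ae P, forall w, v w = fine 'V_P[Y0]}.
Proof.
move=> eY; have := trivial_cond_exp sI Im iYmu2 eY.
rewrite /Rintegral (_ : 'V_P[Y0] = \int[P]_w ((Y0 w - mu) ^+ 2)%:E)%E//.
rewrite /variance covariance.unlock expectationE.
by apply: eq_integral => w _; rewrite expr2.
Qed.

(** Truncation levels are integers, so the exceptional null sets of all levels can be united. *)
Let tailY (a : nat) w := tail2 a%:R (Y0 w - mu).

Let mtail (a : nat) : measurable_fun setT (fun x : R => tail2 a%:R (x - mu)).
Proof.
by apply: (measurableT_comp (@measurable_tail2 R _)); exact: measurable_funB.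
Qed.

Let itail a : P.-integrable setT (EFin \o tailY a).
Proof. by apply: (integrable_tail2 _ iYmu2); exact: measurable_funB. Qed.

Let wa a := cond_exp P I (tailY a).
Let cwa a : is_cond_exp P I (tailY a) (wa a). Proof. exact: cond_expP. Qed.
Let mwa a : measurable_fun setT (wa a).
Proof. exact: is_cond_exp_measurable Im _ _ (cwa a). Qed.

Let tail_cvg a : {ae P, forall w,
  avg n (fun t => tail2 a%:R (Y t w - mu)) @[n --> \oo] --> wa a w}.
Proof. exact: (avg_cvg (mtail a) (itail a)). Qed.

Let avg_ge0 n (f : T -> R) : (forall t, 0 <= f t) -> 0 <= avg n f.
Proof.
move=> f0; apply: mulr_ge0; first by rewrite invr_ge0 fine_ge0.
by apply: Rintegral_ge0.
Qed.

Let wa_ge0 a : {ae P, forall w, 0 <= wa a w}.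
Proof.
move: (tail_cvg a); apply: filterS => w h.
apply: (@closed_cvg _ _ _ _ _ (fun x : R => 0 <= x) _ _ _ h).
- exact: closed_ge.
- by apply: nearW => n; apply: avg_ge0 => t; exact: tail2_ge0.
Qed.

(** On the event [B] that every [wa a] is at least [del], Markov's inequality gives [del * P B <=
    E[tailY a]] for each [a], and these expectations tend to 0. *)
Let wa_small (del : R) : 0 < del -> {ae P, forall w, exists a : nat, wa a w < del}.
Proof.
move=> del0; pose B := \bigcap_(a in [set: nat]) [set w | del <= wa a w].
have mB : measurable B.
  apply: bigcap_measurable => [|a _]; first by exists 0%N.
  rewrite -[X in measurable X]setTI.
  by apply: (measurable_fun_ler (f := cst del)).
suff B0 : P B = 0%E.
  exists B; split => // w /= wB a _ /=; rewrite leNgt; apply/negP => h.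
  by apply: wB; exists a.
have h a : (del%:E * P B <= (\int[P]_w tailY a w)%:E)%E.
  rewrite (Rintegral_EFin _ (itail a))//.
  rewrite -(is_cond_exp_integral sI (cwa a)).
  apply: (@le_trans _ _ (\int[P]_w `|(wa a w)%:E|)%E); last first.
    rewrite le_eqVlt; apply/orP; left; apply/eqP; apply: ae_eq_integral => //.
    - by apply: measurableT_comp => //; exact/measurable_EFinP.
    - exact/measurable_EFinP.
    - by move: (wa_ge0 a); apply: filterS => w w0 _ /=; rewrite ger0_norm.
  rewrite -[in leLHS](setIT B) -integral_indic// -ge0_integralZl//; last 2 first.
    - exact/measurable_EFinP.
    - by rewrite lee_fin ltW.
  apply: ge0_le_integral => //.
  - by move=> w _; rewrite -EFinM lee_fin mulr_ge0// ltW.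
  - by apply/measurable_EFinP; exact: measurable_funM.
  - by apply: measurableT_comp => //; exact/measurable_EFinP.
  - move=> w _; rewrite -EFinM indicE; case: (boolP (w \in B)) => wB.
      by rewrite mulr1 lee_fin ger0_norm; move: wB; rewrite inE => /(_ a Logic.I)//=;
        exact/le_trans/ltW.
    by rewrite mulr0 lee_fin normr_ge0.
have t0 : \int[P]_w tailY a w @[a --> \oo] --> (0 : R).
  apply: (@tail2_integral_cvg _ _ _ P (fun w => Y0 w - mu) _ iYmu2 (fun a => a%:R)).
    exact: measurable_funB.
  exact: cvgr_idn.
have Pfin : P B \is a fin_num by exact: fin_num_measure.
have : del * fine (P B) <= 0.
  apply: (@closed_cvg _ _ _ _ _ (fun x : R => del * fine (P B) <= x) _ _ _ t0).
    exact: closed_ge.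
  by apply: nearW => a; rewrite -lee_fin EFinM fineK//; exact: h.
rewrite pmulr_rle0// => p0; rewrite -(fineK Pfin); congr EFin; apply/eqP.
by rewrite eq_le p0 fine_ge0.
Qed.

(** Everything the randomized sums require of one realization, gathered in a single almost sure
    event. The last clause leads to Lindeberg's condition: averages at level [a] tend to [wa a], and
    some [wa a] is small. *)
Lemma average_limits : {ae P, forall w,
  [/\ \forall n \near \oo, lambda.-integrable (S n) (EFin \o (fun t => (Y t w - mu) ^+ 2)),
      avg n (fun t => (Y t w - mu) ^+ 2) @[n --> \oo] --> v w,
      avg n (fun t => (Y t w - M n w) ^+ 2) @[n --> \oo] --> v w &
      forall del : R, 0 < del -> exists a : nat, \forall n \near \oo,
        avg n (fun t => tail2 a%:R (Y t w - mu)) < del]}.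
Proof.
have msq : measurable_fun setT (fun x : R => (x - mu) ^+ 2).
  by apply: measurable_funX; exact: measurable_funB.
have h1 : {ae P, forall w n, (lambda (S n) < +oo)%E ->
    lambda.-integrable (S n) (EFin \o (fun t => (Y t w - mu) ^+ 2))}.
  apply: ae_foralln => n; case: (pselect (lambda (S n) < +oo)%E) => [Sn|nS]; last exact: aeW.
  have := integrable_on_window fY homY (mS n) Sn msq (fun x => sqr_ge0 _).
  have fin2 : (\int[P]_w ((Y0 w - mu) ^+ 2)%:E < +oo)%E.
    have /integrableP[_] := iYmu2.
    by under eq_integral do rewrite /= ger0_norm ?sqr_ge0//.
  by move=> /(_ fin2); apply: filterS.
have h2 := avg_cvg msq iYmu2.
have h3 : {ae P, forall w a, avg n (fun t => tail2 a%:R (Y t w - mu)) @[n --> \oo] --> wa a w}.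
  by apply: ae_foralln => a; exact: tail_cvg.
(* The countably many bounds [1 / (j + 1)] allow the quantifier over [del] to stand inside the
   almost sure statement. *)
have h4 : {ae P, forall w (j : nat), exists a : nat, wa a w < j.+1%:R^-1}.
  by apply: ae_foralln => j; apply: wa_small; rewrite invr_gt0.
have h12 : {ae P, forall w, (forall n, (lambda (S n) < +oo)%E ->
      lambda.-integrable (S n) (EFin \o (fun t => (Y t w - mu) ^+ 2))) /\
    avg n (fun t => (Y t w - mu) ^+ 2) @[n --> \oo] --> v w}.
  by move: h1 h2; apply: filterS2.
have h34 : {ae P, forall w, (forall a, avg n (fun t => tail2 a%:R (Y t w - mu)) @[n --> \oo]
      --> wa a w) /\ forall j : nat, exists a : nat, wa a w < j.+1%:R^-1}.
  by move: h3 h4; apply: filterS2.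
have h56 : {ae P, forall w, M n w @[n --> \oo] --> W w /\ W w = mu}.
  by move: MW cond_mean_constant; apply: filterS2.
move: h12 h34 h56; apply: filterS3 => w [{}h1 {}h2] [{}h3 {}h4] [h5 h6].
split => //.
- by move: Sfin; apply: filterS => n; exact: h1.
(* By [average_variance] the empirical variance is the centered second moment minus
   [(M n w - mu) ^+ 2], and the latter vanishes in the limit because [W w = mu]. *)
- rewrite -[v w]subr0 -[X in _ --> _ - X](expr0n R 2) -(subrr mu).
  have c2 : avg n (fun t => (Y t w - mu) ^+ 2) - (M n w - mu) ^+ 2 @[n --> \oo] -->
      v w - (mu - mu) ^+ 2.
    apply: cvgB => //; rewrite h6 in h5.
    have c1 : M n w - mu @[n --> \oo] --> mu - mu by apply: cvgB => //; exact: cvg_cst.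
    exact: (cvg_comp _ _ c1 (@exprn_continuous _ 2 _)).
  apply: cvg_trans c2; apply: near_eq_cvg; near=> n.
  apply/esym; apply: average_variance => //.
  + exact: S0.
  + by near: n.
  + apply: measurable_funTS; exact: measurable_path.
  + by apply: h1; near: n.
- move=> del del0; have [j jd] : exists j : nat, j.+1%:R^-1 < del.
    exists (Num.truncn del^-1); rewrite -[ltRHS]invrK ltf_pV2 ?posrE ?invr_gt0//.
    by rewrite truncnS_gt.
  have [a ad] := h4 j; exists a.
  have := h3 a; move=> /cvgr_lt; apply; exact: lt_trans jd.
Unshelve. all: by end_near. Qed.

End scalar_field_limits.

(** * Randomized spatial averages *)

Section uniform_law.
Context (R : realType) (K : index_kind) (m : nat).
Local Notation T := (index_space R K m).
Local Notation lambda := (index_measure R K m).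
Context d (Omega : measurableType d) (Q : probability Omega R).
Variables (A : set T) (theta : Omega -> T).
Hypotheses (mA : measurable A) (A0 : (0 < lambda A)%E) (Afin : (lambda A < +oo)%E).
Hypothesis mtheta : measurable_fun setT theta.
Hypothesis theta_law : forall B, measurable B ->
  Q [set w | B (theta w)] = (fine (lambda (B `&` A)) / fine (lambda A))%:E.

Let c := (fine (lambda A))^-1.

Let A_gt0 : 0 < fine (lambda A). Proof. by rewrite fine_gt0// A0. Qed.

Let c0 : 0 <= c. Proof. by rewrite invr_ge0 ltW. Qed.

(** The law of [theta] gives no mass to the complement of [A], and on subsets of [A] it is [lambda]
    scaled by [c]. *)
Lemma ge0_uniform_integral (f : T -> \bar R) : measurable_fun setT f ->
  (forall t, 0 <= f t)%E ->
  (\int[Q]_w f (theta w) = c%:E * \int[lambda]_(t in A) f t)%E.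
Proof.
move=> mf f0.
pose thetaM : {mfun Omega >-> T} :=
  MeasurableFun.Pack (MeasurableFun.Class (isMeasurableFun.Build _ _ _ _ theta mtheta)).
have lawE B : measurable B ->
    distribution Q thetaM B = (fine (lambda (B `&` A)) / fine (lambda A))%:E.
  by move=> mB; exact: theta_law.
transitivity (\int[distribution Q thetaM]_t f t)%E.
  by rewrite /distribution ge0_integral_pushforward.
rewrite -(setUv A) ge0_integral_setU//=; first last.
- by apply/eqP; exact: setICr.
- by rewrite setUv.
- exact: measurableC.
rewrite [X in (_ + X)%E](_ : _ = 0%E) ?adde0; last first.
  apply: null_set_integral; [exact: measurableC|exact: measurable_funTS|].
  apply: (etrans (lawE _ (measurableC mA))).
  by rewrite setICl measure0 mul0r.
rewrite -(@ge0_integral_mscale _ _ _ lambda A mA (NngNum c0))//; last exact: measurable_funTS.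
apply: eq_measure_integral => B mB BA; apply: (etrans (lawE _ mB)).
rewrite /mscale/= (setIidl BA).
rewrite mulrC EFinM fineK// ge0_fin_numE//.
by apply: le_lt_trans Afin; apply: le_measure; rewrite ?inE.
Qed.

Variable f : T -> R.
Hypotheses (mf : measurable_fun setT f) (iF : lambda.-integrable A (EFin \o f)).

Lemma uniform_integrable : Q.-integrable setT (EFin \o (f \o theta)).
Proof.
have /integrableP[_ fin] := iF.
apply/integrableP; split; first by apply/measurable_EFinP; exact: measurableT_comp.
rewrite (@ge0_uniform_integral (fun t => `|(f t)%:E|)%E)//.
  by rewrite lte_mul_pinfty// lee_fin.
by apply: measurableT_comp => //; exact/measurable_EFinP.
Qed.

Lemma uniform_integral : \int[Q]_w f (theta w) = space_average A f.
Proof.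
have mfE : measurable_fun setT (EFin \o f) by exact/measurable_EFinP.
rewrite /space_average /Rintegral -/c -[c in RHS]/(fine c%:E) -fineM//; last first.
  by have := integrable_fin_num mA iF.
congr fine; rewrite [LHS]integralE [X in (_ * X)%E]integralE muleBr//; last first.
  by apply: fin_num_adde_defr; exact: (integrable_pos_fin_num mA iF).
congr (_ - _)%E.
- rewrite -(ge0_uniform_integral (measurable_funepos mfE) (fun t => funepos_ge0 _ t)).
  by apply: eq_integral => w _; rewrite !funeposE.
- rewrite -(ge0_uniform_integral (measurable_funeneg mfE) (fun t => funeneg_ge0 _ t)).
  by apply: eq_integral => w _; rewrite !funenegE.
Qed.

End uniform_law.

Lemma mutually_independent_comp d d' d'' (Omega : measurableType d)
    (E : measurableType d') (E' : measurableType d'') (R : realType)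
    (P : probability Omega R) (I : finType) (X : I -> Omega -> E) (h : I -> E -> E') :
  (forall i, measurable_fun setT (h i)) -> mutually_independent P X ->
  mutually_independent P (fun i w => h i (X i w)).
Proof.
move=> mh indX J B mB.
apply: (indX J (fun i => h i @^-1` B i)) => i iJ.
by rewrite -[X in measurable X]setTI; apply: mh => //; exact: mB.
Qed.

Section randomized_average.
Context (R : realType) (K : index_kind) (m : nat).
Local Notation T := (index_space R K m).
Local Notation lambda := (index_measure R K m).
Context d (Omega : measurableType d) (Q : probability Omega R).
Variables (A : set T) (n : nat) (theta : Omega -> n.-tuple T).
Hypotheses (mA : measurable A) (A0 : (0 < lambda A)%E) (Afin : (lambda A < +oo)%E).
Hypothesis mtheta : measurable_fun setT theta.
Hypothesis indtheta : mutually_independent Q (fun i w => tnth (theta w) i).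
Hypothesis theta_law : forall i B, measurable B ->
  Q [set w | B (tnth (theta w) i)] = (fine (lambda (B `&` A)) / fine (lambda A))%:E.
Variables (f : T -> R) (mu N : R).
Hypothesis mf : measurable_fun setT f.
Hypothesis if2 : lambda.-integrable A (EFin \o (fun t => (f t - mu) ^+ 2)).
Hypotheses (n0 : (0 < n)%N) (N0 : 0 < N).
Local Notation avg g := (space_average A g).

Let c := Num.sqrt n%:R * Num.sqrt N.
Let sn0 : 0 < Num.sqrt n%:R :> R. Proof. by rewrite sqrtr_gt0 ltr0n. Qed.
Let sN0 : 0 < Num.sqrt N. Proof. by rewrite sqrtr_gt0. Qed.
Let c0 : 0 < c. Proof. by rewrite mulr_gt0. Qed.
Let c2 : c ^+ 2 = n%:R * N. Proof. by rewrite exprMn !sqr_sqrtr// ltW. Qed.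
Let nn0 : n%:R != 0 :> R. Proof. by rewrite pnatr_eq0 -lt0n. Qed.

Let mft i : measurable_fun setT (fun w => tnth (theta w) i).
Proof. by apply: (measurableT_comp (measurable_tnth i)). Qed.

Let mfc : measurable_fun setT (fun t => f t - mu).
Proof. exact: measurable_funB. Qed.

Let mfc2 : measurable_fun setT (fun t => (f t - mu) ^+ 2).
Proof. exact: measurable_funX. Qed.

Let ifc : lambda.-integrable A (EFin \o (fun t => f t - mu)).
Proof. by apply: integrable_centered => //; exact: measurable_funTS. Qed.

Let mtail e : measurable_fun setT (fun t => tail2 e (f t - mu)).
Proof. exact: (measurableT_comp (measurable_tail2 e)). Qed.

Let itail e : lambda.-integrable A (EFin \o (fun t => tail2 e (f t - mu))).
Proof.
apply: le_integrable if2 => //.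
  by apply/measurable_EFinP/measurable_funTS.
move=> t _; rewrite lee_fin ger0_norm ?tail2_ge0// ger0_norm ?sqr_ge0//.
exact: tail2_le.
Qed.

Let scaled_integral (g : T -> R) (a : R) i : measurable_fun setT g ->
  lambda.-integrable A (EFin \o g) ->
  \int[Q]_w (a * g (tnth (theta w) i)) = a * avg g.
Proof.
move=> mg ig; have iQ := uniform_integrable mA A0 Afin (mft i) (@theta_law i) mg ig.
rewrite (RintegralZl _ _ iQ)//; congr (_ * _).
exact: (uniform_integral mA A0 Afin (mft i) (@theta_law i)).
Qed.

Let tail2_scale e x : tail2 e (x / c) = c ^- 2 * tail2 (e * c) x.
Proof.
rewrite /tail2 normrM [`|c^-1|]ger0_norm ?invr_ge0 ?ltW// ltr_pdivlMr//.
by case: ifP => _; rewrite ?mulr0// exprMn exprVn mulrC.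
Qed.

(** [lindeberg_bound] for the summands [xi i], whose moments are spatial averages over [A]. The
    drift occurs in the first term only, which allows it to be controlled apart from all the other
    averages. *)
Lemma randomized_average_bound (C : R) (g g1 g2 : R -> R) (e : R) :
  taylor2 C g g1 g2 -> 0 < e ->
  `|\int[Q]_w g ((\sum_(i < n) (f (tnth (theta w) i) - mu)) / c)
     - \int[std_normal R]_z g z| <=
  C * (`|Num.sqrt n%:R * (avg f - mu)| / Num.sqrt N)
  + C * `|avg (fun t => (f t - mu) ^+ 2) / N - 1|
  + 4 * C * (e * (avg (fun t => (f t - mu) ^+ 2) / N)
             + avg (fun t => tail2 (e * c) (f t - mu)) / N)
  + 4 * C * (e + \int[std_normal R]_z tail2 (e * Num.sqrt n%:R) z).
Proof.
move=> tg e0; pose xi (i : 'I_n) w := (f (tnth (theta w) i) - mu) / c.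
have mxi i : measurable_fun setT (xi i).
  by apply: measurable_funM => //; exact: (measurableT_comp mfc).
have indxi : mutually_independent Q xi.
  apply: (mutually_independent_comp (h := fun _ t => (f t - mu) / c)) => // i.
  exact: measurable_funM.
have ixi i : Q.-integrable setT (EFin \o (fun w => xi i w ^+ 2)).
  have := uniform_integrable mA A0 Afin (mft i) (@theta_law i) mfc2 if2.
  move=> /(integrableZr measurableT (c ^- 2)); apply: eq_integrable => // w _.
  by rewrite /xi /= -EFinM expr_div_n.
have xi1 i : \int[Q]_w xi i w = c^-1 * (avg f - mu).
  have -> : avg f - mu = avg (fun t => f t - mu).
    rewrite /space_average (average_mean mA A0 Afin _ if2); last exact: measurable_funTS.
    by rewrite addrAC subrr add0r.
  rewrite -(scaled_integral c^-1 i mfc ifc).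
  by apply: eq_Rintegral => w _; rewrite mulrC.
have xi2 i : \int[Q]_w xi i w ^+ 2 = c ^- 2 * avg (fun t => (f t - mu) ^+ 2).
  rewrite -(scaled_integral (c ^- 2) i mfc2 if2).
  by apply: eq_Rintegral => w _; rewrite /xi expr_div_n mulrC.
have xit i : \int[Q]_w tail2 e (xi i w) = c ^- 2 * avg (fun t => tail2 (e * c) (f t - mu)).
  rewrite -(scaled_integral (c ^- 2) i (mtail _) (itail _)).
  by apply: eq_Rintegral => w _; rewrite /xi tail2_scale.
have := lindeberg_bound n0 e0 mxi indxi ixi xi1 xi2 xit tg.
rewrite (_ : (fun w => g (\sum_(i < n) xi i w)) =
  (fun w => g ((\sum_(i < n) (f (tnth (theta w) i) - mu)) / c))); last first.
  by apply/funext => w; rewrite mulr_suml.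
move=> /le_trans; apply; rewrite /lindeberg_error.
(* Since [c ^+ 2 = n N], the sum of [n] moments scaled by [c ^- 2] is divided by the normalizer
   alone. *)
have cn x : n%:R * (c ^- 2 * x) = x / N by rewrite c2; field; rewrite nn0 gt_eqF.
rewrite !cn lerD2r lerD2r lerD2r.
rewrite (_ : n%:R * (c^-1 * (avg f - mu)) = Num.sqrt n%:R * (avg f - mu) / Num.sqrt N).
  by rewrite [`|_ / Num.sqrt N|]normrM normfV (gtr0_norm sN0).
rewrite -{1}(sqr_sqrtr (ler0n R n)) /c; field.
by rewrite !gt_eqF.
Qed.

End randomized_average.

Lemma tail2_anti (R : realType) (a b y : R) : a <= b -> tail2 b y <= tail2 a y.
Proof.
move=> ab; rewrite /tail2; case: ifP => [by_|_]; first by rewrite (le_lt_trans ab by_).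
by case: ifP => _; rewrite ?sqr_ge0.
Qed.

(** [fine] sends an infinite measure to 0 and division by 0 gives 0, so the law evaluated at [setT]
    would read 1 = 0. *)
Lemma uniform_window_finite (R : realType) (K : index_kind) (m : nat) d
    (Omega : measurableType d) (Q : probability Omega R)
    (A : set (index_space R K m)) (theta : Omega -> index_space R K m) :
  (0 < index_measure R K m A)%E ->
  (forall B, measurable B -> Q [set w | B (theta w)] =
     (fine (index_measure R K m (B `&` A)) / fine (index_measure R K m A))%:E) ->
  (index_measure R K m A < +oo)%E.
Proof.
move=> A0 /(_ setT measurableT); rewrite setTI [LHS](_ : _ = 1%E); last first.
  by rewrite (_ : [set w | _] = setT) ?probability_setT//; apply/seteqP; split.
move: A0; case: (index_measure R K m A) => [r _ _|_ /=|//]; first exact: ltry.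
by rewrite mul0r => -[] /eqP; rewrite oner_eq0.
Qed.

Section randomized_average_limit.
Context (R : realType) (K : index_kind) (m : nat).
Local Notation T := (index_space R K m).
Local Notation lambda := (index_measure R K m).
Context d (Omega : measurableType d) (Q : probability Omega R).
Variables (S : nat -> set T) (k : nat -> nat).
Variable theta : forall n, Omega -> (k n).-tuple T.
Hypotheses (mS : forall n, measurable (S n)) (S0 : forall n, (0 < lambda (S n))%E).
Hypothesis koo : k n @[n --> \oo] --> \oo.
Hypothesis mtheta : forall n, measurable_fun setT (theta n).
Hypothesis indtheta : forall n, mutually_independent Q (fun i w => tnth (theta n w) i).
Hypothesis theta_law : forall n i B, measurable B ->
  Q [set w | B (tnth (theta n w) i)] =
  (fine (lambda (B `&` S n)) / fine (lambda (S n)))%:E.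
Local Notation avg n f := (space_average (S n) f).

(** The law of a randomizing point shows finiteness, and such a point exists only if [k n] is
    positive; hence the restriction to large [n]. *)
Lemma window_finite : \forall n \near \oo, (lambda (S n) < +oo)%E.
Proof.
have : \forall n \near \oo, (1 <= k n)%N by move/cvgnyPge : koo; exact.
apply: filterS => n kn; have i : 'I_(k n) := Ordinal kn.
by apply: (@uniform_window_finite _ _ _ _ _ Q _ (fun w => tnth (theta n w) i));
  [exact: S0|exact: theta_law].
Qed.

Variables (f : T -> R) (mu v : R) (N eta : nat -> R).
Hypothesis mf : measurable_fun setT f.
Hypotheses (v0 : 0 < v) (Nv : N n @[n --> \oo] --> v).
Hypothesis eta0 : eta n @[n --> \oo] --> (0 : R).
Hypothesis if2 : \forall n \near \oo,
  lambda.-integrable (S n) (EFin \o (fun t => (f t - mu) ^+ 2)).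
Hypothesis f2v : avg n (fun t => (f t - mu) ^+ 2) @[n --> \oo] --> v.
Hypothesis f_tail : forall del : R, 0 < del -> exists a : nat, \forall n \near \oo,
  avg n (fun t => tail2 a%:R (f t - mu)) < del.

(** The bound on the drift is a premise inside the eventual statement: a realization need not
    satisfy it for all large [n]. *)
Lemma randomized_average_cvg (g : R -> R) (eps : R) : test_function g -> 0 < eps ->
  \forall n \near \oo, `|Num.sqrt (k n)%:R * (avg n f - mu)| <= eta n ->
    `|\int[Q]_w g ((\sum_(i < k n) (f (tnth (theta n w) i) - mu)) /
                  (Num.sqrt (k n)%:R * Num.sqrt (N n)))
       - \int[std_normal R]_z g z| <= eps.
Proof.
move=> [C [g1 [g2 tg]]] eps0.
have C0 : 0 <= C by have [_ + _ _ _] := tg => /(_ 0); exact: le_trans.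
(* The four error terms will be at most [e], [e], [4 C (2 e + e)] and [4 C (e + e)], together
   [(2 + 20 C) e]. *)
pose e := eps / (2 + 20 * C).
have e0 : 0 < e by rewrite divr_gt0// ltr_wpDr// mulr_ge0.
have v2 : 0 < v / 2 by rewrite divr_gt0.
have [a at_] := f_tail (mulr_gt0 e0 v2).
have Vv : (N n)^-1 @[n --> \oo] --> v^-1 by apply: cvgV => //; rewrite gt_eqF.
have f2N : avg n (fun t => (f t - mu) ^+ 2) / N n @[n --> \oo] --> (1 : R).
  by rewrite -(divff (lt0r_neq0 v0)); exact: cvgM.
have f2N1 : C * `|avg n (fun t => (f t - mu) ^+ 2) / N n - 1| @[n --> \oo] --> (0 : R).
  rewrite -(mulr0 C) -(normr0 R) -(subrr 1); apply: cvgMr; apply: cvg_norm.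
  by apply: cvgB => //; exact: cvg_cst.
have sNv : Num.sqrt (N n) @[n --> \oo] --> Num.sqrt v.
  by apply: (cvg_comp _ _ Nv); exact: sqrt_continuous.
have etaN : C * (eta n / Num.sqrt (N n)) @[n --> \oo] --> (0 : R).
  rewrite -(mulr0 C) -(mul0r (Num.sqrt v)^-1); apply: cvgMr; apply: cvgM => //.
  by apply: cvgV => //; rewrite gt_eqF// sqrtr_gt0.
have skoo : e * Num.sqrt (k n)%:R @[n --> \oo] --> +oo.
  apply/cvgryPge => r.
  have /cvgnyPge/(_ (Num.truncn ((r / e) ^+ 2)).+1) := koo.
  apply: filterS => n kn; rewrite -ler_pdivrMl// mulrC.
  rewrite (le_trans (ler_norm _))// -sqrtr_sqr ler_sqrt//.
  apply: (le_trans (ltW (truncnS_gt _))).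
  by rewrite ler_nat.
have skoo2 : Num.sqrt (v / 2) * (e * Num.sqrt (k n)%:R) @[n --> \oo] --> +oo.
  apply/cvgryPge => r; have /cvgryPge/(_ (r / Num.sqrt (v / 2))) := skoo.
  by apply: filterS => n; rewrite ler_pdivrMr ?sqrtr_gt0// mulrC.
have G0 := @tail2_integral_cvg _ _ _ (std_normal R) (fun z => z) (@measurable_id _ _ _)
  (@integrable_normal_sqr R) _ skoo.
near=> n => U_eta.
have kn : (0 < k n)%N.
  by near: n; move/cvgnyPge : koo; exact.
have Sfin : (lambda (S n) < +oo)%E by near: n; exact: window_finite.
have iFn : lambda.-integrable (S n) (EFin \o (fun t => (f t - mu) ^+ 2)) by near: n.
have Nn : v / 2 < N n.
  by near: n; apply: (cvgr_gt v) => //; rewrite ltr_pdivrMr// ltr_pMr// ltr1n.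
have N0 : 0 < N n by exact: lt_trans Nn.
have := randomized_average_bound (mS n) (S0 n) Sfin (@mtheta n) (@indtheta n)
  (@theta_law n) mf iFn kn N0 tg e0.
move=> /le_trans; apply.
have h1 : C * (`|Num.sqrt (k n)%:R * (avg n f - mu)| / Num.sqrt (N n)) <= e.
  have h : C * (eta n / Num.sqrt (N n)) < e by near: n; exact: (cvgr_lt 0).
  apply: le_trans (ltW h); rewrite ler_wpM2l// ler_wpM2r// invr_ge0 sqrtr_ge0//.
have h2 : C * `|avg n (fun t => (f t - mu) ^+ 2) / N n - 1| < e.
  by near: n; exact: (cvgr_lt 0).
have h3 : avg n (fun t => (f t - mu) ^+ 2) / N n < 2.
  by near: n; apply: (cvgr_lt 1) => //; rewrite ltr1n.
have h4 : \int[std_normal R]_z tail2 (e * Num.sqrt (k n)%:R) z < e.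
  by near: n; exact: (cvgr_lt 0).
(* The growing truncation level eventually exceeds the fixed level [a] because [N n > v / 2]. So the
   average is at most the one at level [a], below [e * (v / 2)], and dividing by [N n] leaves at
   most [e]. *)
have h5 : avg n (fun t => tail2 (e * (Num.sqrt (k n)%:R * Num.sqrt (N n))) (f t - mu)) / N n <= e.
  have an : avg n (fun t => tail2 a%:R (f t - mu)) < e * (v / 2) by near: n.
  have ak : a%:R <= Num.sqrt (v / 2) * (e * Num.sqrt (k n)%:R).
    by near: n; move/cvgryPge : skoo2; exact.
  have itail (b : R) : lambda.-integrable (S n) (EFin \o (fun t => tail2 b (f t - mu))).
    apply: le_integrable iFn => //.
      apply/measurable_EFinP/measurable_funTS.
      by apply: (measurableT_comp (measurable_tail2 b)); exact: measurable_funB.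
    move=> t _; rewrite lee_fin ger0_norm ?tail2_ge0// ger0_norm ?sqr_ge0//.
    exact: tail2_le.
  rewrite ler_pdivrMr//; apply: (@le_trans _ _ (e * (v / 2))); last first.
    by rewrite ler_pM2l// ltW.
  apply: le_trans (ltW an).
  rewrite ler_wpM2l ?invr_ge0 ?fine_ge0//; apply: le_Rintegral => // t _.
  apply: tail2_anti; apply: (le_trans ak).
  rewrite mulrC -mulrA ler_pM2l// ler_wpM2l ?sqrtr_ge0// ler_sqrt ?ltW//.
have {}h3 : e * (avg n (fun t => (f t - mu) ^+ 2) / N n) <= e * 2 by rewrite ler_pM2l// ltW.
have -> : eps = e + e + 4 * C * (e * 2 + e) + 4 * C * (e + e).
  by rewrite /e; field; rewrite gt_eqF// ltr_wpDr// mulr_ge0.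
apply: lerD; last by rewrite ler_wpM2l ?mulr_ge0// lerD2l ltW.
apply: lerD; last by rewrite ler_wpM2l ?mulr_ge0// lerD.
by apply: lerD => //; exact: ltW.
Unshelve. all: by end_near. Qed.

End randomized_average_limit.

(** Where [clip (U n)] is at most [eta n], [D n] tends to 0 almost surely and dominated convergence
    applies. Elsewhere [D n <= C <= C / eta n * clip (U n)], whose integral is at most [C] times the
    square root of [gam n]. *)
Lemma Rintegral_cvg0_of_clip d (Omega : measurableType d) (R : realType)
    (P : probability Omega R) (D U : nat -> Omega -> R) (C : R) :
  (forall n, measurable_fun setT (D n)) -> (forall n, measurable_fun setT (U n)) ->
  (forall n w, 0 <= D n w <= C) ->
  \int[P]_w clip (U n w) @[n --> \oo] --> (0 : R) ->
  (forall eta : nat -> R, eta n @[n --> \oo] --> (0 : R) ->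
    {ae P, forall w, forall eps : R, 0 < eps ->
      \forall n \near \oo, `|U n w| <= eta n -> D n w <= eps}) ->
  \int[P]_w D n w @[n --> \oo] --> (0 : R).
Proof.
move=> mD mU D0C c0 Deps.
have mclip n : measurable_fun setT (fun w => clip (U n w)).
  exact: (measurableT_comp (@measurable_clip R)).
have C0 : 0 <= C by have /andP[] := D0C 0%N point; exact: le_trans.
pose gam n := \int[P]_w clip (U n w).
have gam0 n : 0 <= gam n by apply: Rintegral_ge0 => w _; have /andP[] := clip_itv (U n w).
(* Markov's inequality bounds the probability of clip (U n) > eta n by gam n / eta n,
   so eta must vanish more slowly than gam. *)
pose eta n := Num.sqrt (gam n) + n.+1%:R^-1.
(* The summand [n.+1%:R^-1] keeps [eta n] positive where [gam n] is 0. *)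
have eta_gt0 n : 0 < eta n by rewrite ltr_wpDl ?sqrtr_ge0// invr_gt0.
have sgam : Num.sqrt (gam n) @[n --> \oo] --> (0 : R).
  by rewrite -sqrtr0; apply: (cvg_comp _ _ c0); exact: sqrt_continuous.
have eta0 : eta n @[n --> \oo] --> (0 : R).
  by rewrite -[X in _ --> X](addr0 0); apply: cvgD => //; exact: cvg_harmonic.
pose D1 n w := if clip (U n w) <= eta n then D n w else 0.
have mD1 n : measurable_fun setT (D1 n).
  by apply: measurable_fun_ifT => //; exact: measurable_fun_ler.
have D1C n w : `|D1 n w| <= C.
  have /andP[D0 DC] := D0C n w.
  by rewrite /D1; case: ifP => _; rewrite ?normr0// ger0_norm.
have iD1 n := bounded_integrable P (mD1 n) (D1C n).
have D1cvg : \int[P]_w D1 n w @[n --> \oo] --> (0 : R).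
  have mD1E n : measurable_fun setT (fun w => (D1 n w)%:E) by exact/measurable_EFinP.
  have ae1 : {ae P, forall w, setT w -> (D1 n w)%:E @[n --> \oo] --> (cst 0%E w : \bar R)}.
    move: (Deps _ eta0); apply: filterS => w h _; apply: cvg_EFin; first exact: nearW.
    apply/cvgrPdist_le => eps eps0; near=> n; rewrite sub0r normrN /= /D1.
    case: ifP => [cU|_]; last by rewrite normr0 ltW.
    have /andP[D0 _] := D0C n w; rewrite ger0_norm//.
    (* Below level 1, [clip] is the absolute value, so the condition on [clip (U n w)] becomes one
       on [U n w]. *)
    have : eta n < 1 by near: n; exact: (cvgr_lt 0).
    have : `|U n w| <= eta n -> D n w <= eps by near: n; exact: h.
    move=> + e1; apply; move: cU; rewrite /clip /Num.min; case: ifP => // _.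
    by rewrite leNgt e1.
  have iC := finite_measure_integrable_cst P C measurableT.
  have bnd : {ae P, forall w n, setT w -> (`|(D1 n w)%:E| <= (EFin \o cst C) w)%E}.
    by apply: aeW => w n _; rewrite lee_fin.
  have [_ _] := dominated_convergence measurableT mD1E (measurable_cst 0%E) ae1 iC bnd.
  rewrite integral0 => /fine_cvg; exact.
apply: (@squeeze_cvgr _ _ _ _ (cst 0) (fun n => \int[P]_w D1 n w + C * Num.sqrt (gam n))).
- near=> n; apply/andP; split; first by apply: Rintegral_ge0 => w _; have /andP[] := D0C n w.
  have iclip := bounded_integrable P (mclip n) (fun w => clip_norm_le1 (U n w)).
  have iclip2 : P.-integrable setT (EFin \o (fun w => C / eta n * clip (U n w))).
    exact: (integrableZl measurableT (C / eta n) iclip).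
  have DC w : `|D n w| <= C by have /andP[D0 ?] := D0C n w; rewrite ger0_norm.
  apply: (@le_trans _ _ (\int[P]_w (D1 n w + C / eta n * clip (U n w)))).
    apply: prob_le_Rintegral.
    + exact: (bounded_integrable P (mD n) DC).
    + exact: (integrableD measurableT (iD1 n) iclip2).
    + move=> w; rewrite /D1; case: (leP (clip (U n w)) (eta n)) => h.
        by rewrite lerDl mulr_ge0//; [rewrite divr_ge0// ltW|have /andP[] := clip_itv (U n w)].
      rewrite add0r mulrAC; have /andP[_ /le_trans] := D0C n w; apply.
      by rewrite -mulrA ler_peMr// ler_pdivlMr// mul1r ltW.
  rewrite (RintegralD measurableT (iD1 n) iclip2) (RintegralZl _ _ iclip)//.
  rewrite lerD2l -/(gam n) -mulrA ler_wpM2l// mulrC ler_pdivrMr//.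
  rewrite /eta mulrDr -expr2 sqr_sqrtr// lerDl mulr_ge0 ?sqrtr_ge0// invr_ge0//.
- exact: cvg_cst.
- by rewrite -[X in _ --> X](addr0 0) -{2}(mulr0 C); apply: cvgD => //; exact: cvgMr.
Unshelve. all: by end_near. Qed.

(** Inversion is not continuous at 0, where its value is 0; on nonnegative reals it agrees with the
    power -1, which is measurable. *)
Lemma measurable_inv_sqrt (R : realType) (a : R) :
  measurable_fun setT (fun x : R => (Num.sqrt a * Num.sqrt x)^-1).
Proof.
rewrite (_ : (fun _ => _) = fun x : R => (Num.sqrt a * Num.sqrt x) `^ (-1)).
  apply: (measurableT_comp (measurable_powR (-1))); apply: measurable_funM => //.
  by apply: continuous_measurable_fun; exact: sqrt_continuous.
by apply/funext => x; rewrite powR_inv1// mulr_ge0 ?sqrtr_ge0.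
Qed.

Section randomized_field.
Context (R : realType) (K : index_kind) (m : nat).
Local Notation T := (index_space R K m).
Local Notation lambda := (index_measure R K m).
Context d (Omega : measurableType d) (P : probability Omega R).
Variable Y : T -> Omega -> R.
Hypotheses (fY : random_field Y) (homY : homogeneous P Y).
Hypothesis Y2 : ('E_P[(fun w => `|Y index_origin w| ^+ 2)%R] < +oo)%E.
Variables (S : nat -> set T) (k : nat -> nat).
Hypothesis SY : pointwise_averaging S.
Hypothesis koo : k n @[n --> \oo] --> \oo.
Local Notation mu := (fine 'E_P[Y index_origin]).
Local Notation avg n f := (space_average (S n) f).
Local Notation M n w := (avg n (fun t => Y t w)).
Hypothesis kM : cvg_in_distribution P
  (fun n w => Num.sqrt (k n)%:R * (M n w - mu)) P (cst 0).
Context d' (Omega' : measurableType d') (Q : probability Omega' R).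
Variable theta : forall n, Omega' -> (k n).-tuple T.
Hypothesis mtheta : forall n, measurable_fun setT (theta n).
Hypothesis indtheta : forall n, mutually_independent Q (fun i w => tnth (theta n w) i).
Hypothesis theta_law : forall n i B, measurable B ->
  Q [set w | B (tnth (theta n w) i)] =
  (fine (lambda (B `&` S n)) / fine (lambda (S n)))%:E.
Variable N : nat -> Omega -> R.
Hypothesis mN : forall n, measurable_fun setT (N n).

(** The normalizer [N] is left open so as to cover both the empirical variance and the constant
    one. *)
Definition randomized_sum n (p : Omega * Omega') : R :=
  (\sum_(i < k n) (Y (tnth (theta n p.2) i) p.1 - mu)) /
  (Num.sqrt (k n)%:R * Num.sqrt (N n p.1)).

Lemma measurable_randomized_sum n : measurable_fun setT (randomized_sum n).
Proof.
apply: measurable_funM; last first.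
  apply: (measurableT_comp (measurable_inv_sqrt _)).
  exact: (measurableT_comp (mN n) measurable_fst).
apply: measurable_sum => i; apply: measurable_funB => //.
have mti : measurable_fun setT (fun p : Omega * Omega' => (tnth (theta n p.2) i, p.1)).
  apply: measurable_fun_pair => //.
  apply: (measurableT_comp (measurable_tnth i)).
  exact: (measurableT_comp (@mtheta n) measurable_snd).
exact: (measurableT_comp (field_jointly_measurable fY) mti).
Qed.

Hypothesis Nv : {ae P, forall w, N n w @[n --> \oo] -->
  cond_exp P (invariant_events P Y) (fun w => (Y index_origin w - mu) ^+ 2) w}.
Hypothesis v0 : {ae P, forall w,
  0 < cond_exp P (invariant_events P Y) (fun w => (Y index_origin w - mu) ^+ 2) w}.

(** The absolute value stands inside the outer integral: convergence in mean to a constant passes to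
    products over coordinates even though the components of X may be dependent. *)
Lemma randomized_sum_cvg (g : R -> R) : test_function g ->
  \int[P]_w `|\int[Q]_w' g (randomized_sum n (w, w')) - \int[std_normal R]_z g z|
    @[n --> \oo] --> (0 : R).
Proof.
move=> tg; have [C gC] := test_function_bounded tg.
have mg : measurable_fun setT g.
  by apply: continuous_measurable_fun; exact: test_function_continuous.
have mgF n : measurable_fun setT (fun p => g (randomized_sum n p)).
  exact: (measurableT_comp mg (measurable_randomized_sum n)).
have mS n : measurable (S n) by have [/(_ n)[]] := SY.
have S0 n : (0 < lambda (S n))%E by have [/(_ n)[]] := SY.
have Sfin := window_finite S0 koo theta_law.
apply: (@Rintegral_cvg0_of_clip _ _ _ P _
    (fun n w => Num.sqrt (k n)%:R * (M n w - mu)) (C + C)).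
- move=> n; apply: measurableT_comp => //; apply: measurable_funB => //.
  exact: (measurable_Rintegral1 P Q (mgF n) (fun p => gC _)).
- move=> n; apply: measurable_funM => //; apply: measurable_funB => //.
  exact: (measurable_space_average (mS n) (field_jointly_measurable fY)).
- move=> n w; rewrite normr_ge0/=; apply: (le_trans (ler_normB _ _)); apply: lerD.
    apply: prob_Rintegral_bound => //.
    exact: (measurableT_comp (mgF n) (measurable_pair1 w)).
  exact: prob_Rintegral_bound.
- exact: clip_cvg0.
move=> eta eta0.
move: (average_limits fY homY Y2 SY Sfin koo kM) Nv v0; apply: filterS3.
move=> w [i2 a2 _ at_] Nw vw eps eps0.
exact: (@randomized_average_cvg _ _ _ _ _ Q S k theta mS S0 koo mtheta indtheta
  theta_law (Y ^~ w) mu _ (N ^~ w) eta (measurable_path w fY) vw Nw eta0 i2 a2 at_ g).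
Qed.

End randomized_field.

(** The factors are exchanged one at a time; [1 <= C] lets a single power of [C] bound all the mixed
    products. *)
Lemma prod_dist_bound (R : realType) (I : Type) (s : seq I) (a b : I -> R) (C : R) :
  1 <= C -> (forall i, `|a i| <= C) -> (forall i, `|b i| <= C) ->
  `|\prod_(i <- s) a i - \prod_(i <- s) b i| <= C ^+ size s * \sum_(i <- s) `|a i - b i|.
Proof.
move=> C1 aC bC; have C0 : 0 <= C by exact: le_trans C1.
have bP (r : seq I) : `|\prod_(i <- r) b i| <= C ^+ size r.
  elim: r => [|i r IH]; first by rewrite big_nil normr1.
  by rewrite big_cons normrM exprS ler_pM.
elim: s => [|i s IH]; first by rewrite !big_nil subrr normr0 mulr0.
rewrite !big_cons /= (_ : a i * _ - _ =
  a i * (\prod_(j <- s) a j - \prod_(j <- s) b j) + (a i - b i) * \prod_(j <- s) b j).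
  rewrite (le_trans (ler_normD _ _))// !normrM mulrDr addrC; apply: lerD.
    rewrite mulrC ler_wpM2r// (le_trans (bP s))// exprS ler_peMl// exprn_ge0//.
  by rewrite exprS -mulrA ler_pM.
ring.
Qed.

(** * Randomized vectors *)

Lemma independent_prod_integralT d d' (T : measurableType d) (E : measurableType d')
    (R : realType) (P : probability T R) (I : finType) (X : I -> T -> E)
    (h : I -> E -> R) (C : R) :
  (forall i, measurable_fun setT (X i)) -> mutually_independent P X ->
  (forall i, measurable_fun setT (h i)) -> (forall i x, `|h i x| <= C) ->
  \int[P]_w \prod_i h i (X i w) = \prod_i \int[P]_w h i (X i w).
Proof.
move=> mX indX mh hC; have := independent_prod_integral mX indX [set: I]%SET mh hC.
rewrite [RHS](eq_bigl xpredT); last by move=> i; rewrite inE.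
move=> <-; apply: eq_Rintegral => w _; apply: eq_bigl => i; by rewrite inE.
Qed.

Lemma standard_normal_integral d (Omega : measurableType d) (R : realType)
    (P : probability Omega R) (X : Omega -> R) (g : R -> R) (C : R) :
  measurable_fun setT X ->
  (forall B : set R, measurable B -> P [set w | B (X w)] = normal_prob 0 1 B) ->
  measurable_fun setT g -> (forall x, `|g x| <= C) ->
  \int[P]_w g (X w) = \int[std_normal R]_z g z.
Proof.
move=> mX lawX mg gC.
pose XM : {mfun Omega >-> R} :=
  MeasurableFun.Pack (MeasurableFun.Class (isMeasurableFun.Build _ _ _ _ X mX)).
rewrite -(Rintegral_distribution (P := P) (X := XM) mg); last first.
  exact: (bounded_integrable P (measurableT_comp mg mX) (fun w => gC _)).
congr fine; apply: eq_measure_integral => B mB _.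
exact: lawX.
Qed.

Section randomized_vector.
Context (R : realType) (K : index_kind) (m d : nat).
Local Notation T := (index_space R K m).
Context (dX : measure_display) (OmegaX : measurableType dX) (PX : probability OmegaX R).
Variable X : T -> OmegaX -> 'rV[R]_d.
Hypothesis X_field : random_field X.
Hypothesis X_homogeneous : forall l, homogeneous PX (component X l).
Hypothesis X_L2 : forall l,
  ('E_PX[(fun w => `|component X l index_origin w| ^+ 2)%R] < +oo)%E.
Variables (S : 'I_d -> nat -> set T) (k : nat -> nat).
Hypothesis S_averaging : forall l, pointwise_averaging (S l).
Hypothesis k_infty : k n @[n --> \oo] --> \oo.
Context (dtau : measure_display) (Omegatau : measurableType dtau)
  (Ptau : probability Omegatau R).
Variable tau : forall n, 'I_d -> Omegatau -> (k n).-tuple T.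
Hypothesis tau_uniform : forall n, randomizing_points Ptau (fun l => S l n) (tau n).
Context (dZ : measure_display) (OmegaZ : measurableType dZ) (PZ : probability OmegaZ R).
Variable Z : OmegaZ -> 'rV[R]_d.
Hypothesis Z_normal : standard_normal_vector PZ Z.
Local Notation Y := (component X).
Local Notation mu l := (fine 'E_PX[Y l index_origin]).
Hypothesis kM : forall l, cvg_in_distribution PX
  (fun n w => Num.sqrt (k n)%:R * (space_average (S l n) (fun t => Y l t w) - mu l))
  PX (cst 0).
Variable N : nat -> 'I_d -> OmegaX -> R.
Hypothesis mN : forall n l, measurable_fun setT (N n l).
Local Notation v l := (cond_exp PX (invariant_events PX (Y l))
  (fun w => (Y l index_origin w - mu l) ^+ 2)).
Hypothesis Nv : forall l, {ae PX, forall w, N n l w @[n --> \oo] --> v l w}.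
Hypothesis v0 : forall l, {ae PX, forall w, 0 < v l w}.

Lemma component_random_field l : random_field (Y l).
Proof.
have [mX jX] := X_field; split => [t|/jX jX'].
  exact: (measurableT_comp (@measurable_coord R d l) (mX t)).
exact: (measurableT_comp (@measurable_coord R d l) jX').
Qed.

Local Notation F n l := (randomized_sum PX (Y l) (fun n w => tau n l w)
  (fun n w => N n l w) n).

Lemma randomized_vector_cvg :
  cvg_in_distribution (PX \x Ptau)%E (fun n p => \row_l F n l p) PZ Z.
Proof.
have mtau n l : measurable_fun setT (tau n l) by have [+ _ _ _] := tau_uniform n; exact.
have indtau n : mutually_independent Ptau (tau n) by have [] := tau_uniform n.
have indtau2 l n : mutually_independent Ptau (fun i w => tnth (tau n l w) i).
  by have [_ _ + _] := tau_uniform n; exact.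
have tau_law l n i B : measurable B -> Ptau [set w | B (tnth (tau n l w) i)] =
    (fine (index_measure R K m (B `&` S l n)) / fine (index_measure R K m (S l n)))%:E.
  by have [_ _ _ +] := tau_uniform n; apply.
have mF n l : measurable_fun setT (F n l).
  exact: (measurable_randomized_sum _ (component_random_field l) (fun n => mtau n l)
    (fun n => mN n l)).
have [mZ Zlaw indZ] := Z_normal.
have mZl l : measurable_fun setT (fun w => Z w ord0 l).
  exact: (measurableT_comp (@measurable_coord R d l) mZ).
apply: test_function_weak_convergence => //.
  move=> n; apply: measurable_fun_rV => l; under eq_fun do rewrite mxE; exact: mF.
move=> psi tpsi.
have mpsi l : measurable_fun setT (psi l).
  by apply: continuous_measurable_fun; exact: test_function_continuous.
have [c psic] : exists c : 'I_d -> R, forall l x, `|psi l x| <= c l.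
  by have /choice[c cP] := fun l => test_function_bounded (tpsi l); exists c.
(* One bound for all [psi l], at least 1 as [prod_dist_bound] requires. *)
pose C := 1 + \sum_l `|c l|.
have C1 : 1 <= C by rewrite lerDl sumr_ge0.
have psiC l x : `|psi l x| <= C.
  apply: (le_trans (psic l x)); apply: (le_trans (ler_norm _)).
  by rewrite /C (bigD1 l)//= addrCA lerDl addr_ge0// sumr_ge0.
pose G l := \int[std_normal R]_z psi l z.
have GC l : `|G l| <= C by exact: prob_Rintegral_bound.
have mpsiF n l : measurable_fun setT (fun p => psi l (F n l p)).
  exact: (measurableT_comp (mpsi l) (mF n l)).
pose h n l w := \int[Ptau]_w' psi l (F n l (w, w')).
have mh n l : measurable_fun setT (h n l).
  exact: (measurable_Rintegral1 PX Ptau (mpsiF n l) (fun p => psiC _ _)).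
have mpsiF2 n l w : measurable_fun setT (fun w' => psi l (F n l (w, w'))).
  exact: (measurableT_comp (mpsiF n l) (measurable_pair1 w)).
have hC n l w : `|h n l w| <= C by exact: prob_Rintegral_bound.
have prodC (a : 'I_d -> R) : (forall l, `|a l| <= C) -> `|\prod_l a l| <= C ^+ d.
  move=> aC; rewrite normr_prod -[d in leRHS]card_ord -prodr_const.
  by apply: ler_prod => l _; rewrite normr_ge0 aC.
have -> : \int[PZ]_w (\prod_l psi l (Z w ord0 l)) = \prod_l G l.
  rewrite (independent_prod_integralT mZl indZ mpsi psiC).
  apply: eq_bigr => l _; exact: (standard_normal_integral (mZl l) (Zlaw l) (mpsi l) (psiC l)).
have -> : (fun n => \int[(PX \x Ptau)%E]_w \prod_l psi l ((\row_l0 F n l0 w) ord0 l)) =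
    (fun n => \int[PX]_w \prod_l h n l w).
  apply/funext => n.
  rewrite (_ : (fun w => \prod_l psi l ((\row_l0 F n l0 w) ord0 l)) =
     (fun w => \prod_l psi l (F n l w))); last first.
    by apply/funext => w; apply: eq_bigr => l _; rewrite mxE.
  rewrite (@Rintegral_prod _ _ _ _ _ PX Ptau _ (C ^+ d)); first last.
  - by move=> p; apply: prodC => l; exact: psiC.
  - by apply: measurable_prod => l _; exact: mpsiF.
  apply: eq_Rintegral => w _.
  (* With the realization [w] fixed, the factor of index [l] depends on [tau n l] alone, so the
     independence of these vectors factorizes the inner integral. *)
  pose H l (t : (k n).-tuple T) := psi l ((\sum_(i < k n) (Y l (tnth t i) w - mu l)) /
    (Num.sqrt (k n)%:R * Num.sqrt (N n l w))).
  apply: (independent_prod_integralT (mtau n) (indtau n) (h := H) (C := C)) => [l|l t];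
    last exact: psiC.
  apply: (measurableT_comp (mpsi l)); apply: measurable_funM => //.
  apply: measurable_sum => i; apply: measurable_funB => //.
  exact: (measurableT_comp (measurable_path w (component_random_field l))
    (measurable_tnth i)).
have ih n l : PX.-integrable setT (EFin \o (fun w => `|h n l w - G l|)).
  apply: (@bounded_integrable _ _ _ PX _ (C + C)).
    by apply: measurableT_comp => //; exact: measurable_funB.
  by move=> w; rewrite normr_id (le_trans (ler_normB _ _))// lerD.
have bound n : `|\prod_l G l - \int[PX]_w \prod_l h n l w| <=
    C ^+ d * \sum_l \int[PX]_w `|h n l w - G l|.
  have iP : PX.-integrable setT (EFin \o (fun w => \prod_l h n l w)).
    apply: (@bounded_integrable _ _ _ PX _ (C ^+ d)) => [|w].
      by apply: measurable_prod => l _; exact: mh.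
    exact: prodC.
  have iG : PX.-integrable setT (EFin \o cst (\prod_l G l)).
    exact: finite_measure_integrable_cst.
  have iD : PX.-integrable setT (EFin \o (fun w => \prod_l h n l w - \prod_l G l)).
    exact: (integrableB measurableT iP iG).
  have [isum sumE] := Rintegral_sum (index_enum 'I_d) (fun l => ih n l).
  rewrite distrC -[X in _ - X](prob_Rintegral_cst PX) -(RintegralB measurableT iP iG).
  apply: (le_trans (le_normr_Rintegral measurableT iD)).
  rewrite -sumE -(RintegralZl _ measurableT isum).
  apply: prob_le_Rintegral.
  - exact: (integrable_norm iD).
  - exact: (integrableZl measurableT (C ^+ d) isum).
  - move=> w; have := prod_dist_bound (index_enum 'I_d) C1 (fun l => hC n l w) GC.
    by rewrite -sum1_size big_const_ord iter_addn mul1n addn0.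
have bound0 : C ^+ d * \sum_l \int[PX]_w `|h n l w - G l| @[n --> \oo] --> (0 : R).
  rewrite -[X in _ --> X](mulr0 (C ^+ d)); apply: cvgMr.
  have z : \sum_(l < d) (0 : R) = 0 by rewrite big1.
  rewrite -[X in _ --> X]z.
  apply: cvg_big => [x|l _]; first exact: add_continuous.
  exact: (randomized_sum_cvg (component_random_field l) (X_homogeneous l) (X_L2 l)
    (S_averaging l) k_infty (kM l) (fun n => mtau n l) (indtau2 l) (tau_law l)
    (fun n => mN n l) (Nv l) (v0 l) (tpsi l)).
apply/cvgrPdist_le => eps eps0; near=> n; apply: (le_trans (bound n)).
by apply: ltW; near: n; exact: (cvgr_lt 0).
Unshelve. all: by end_near. Qed.

End randomized_vector.

Unset Implicit Arguments.

Theorem theorem4 (R : realType) (K : index_kind) (m d : nat)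
  (hm : (0 < m)%N) (hd : (0 < d)%N)
  (dX : measure_display) (OmegaX : measurableType dX)
  (PX : probability OmegaX R)
  (X : index_space R K m -> OmegaX -> 'rV[R]_d)
  (X_field : random_field X)
  (X_homogeneous : forall l : 'I_d, homogeneous PX (component X l))
  (X_L2 : forall l : 'I_d,
    ('E_PX[(fun w => `|component X l index_origin w| ^+ 2)%R] < +oo)%E)
  (X_var : forall l : 'I_d,
    {ae PX, forall w,
      0 < cond_var PX (invariant_events PX (component X l))
            (component X l index_origin) w})
  (S : 'I_d -> nat -> set (index_space R K m))
  (S_averaging : forall l : 'I_d, pointwise_averaging (S l))
  (k : nat -> nat)
  (k_nondecreasing : nondecreasing_seq k)
  (k_infty : k n @[n --> \oo] --> \oo)
  (dtau : measure_display) (Omegatau : measurableType dtau)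
  (Ptau : probability Omegatau R)
  (tau : forall n : nat, 'I_d -> Omegatau -> (k n).-tuple (index_space R K m))
  (tau_uniform : forall n : nat,
    randomizing_points Ptau (fun l => S l n) (tau n))
  (dZ : measure_display) (OmegaZ : measurableType dZ)
  (PZ : probability OmegaZ R) (Z : OmegaZ -> 'rV[R]_d)
  (Z_normal : standard_normal_vector PZ Z) :
  let mu (l : 'I_d) : R := fine 'E_PX[component X l index_origin] in
  let M (n : nat) (l : 'I_d) (w : OmegaX) : R :=
    space_average (S l n) (fun t => component X l t w) in
  let V (n : nat) (l : 'I_d) (w : OmegaX) : R :=
    space_average (S l n) (fun t => (component X l t w - M n l w) ^+ 2) in
  let sigma (l : 'I_d) : R :=
    Num.sqrt (fine 'V_PX[component X l index_origin]) in
  let centered_sum (n : nat) (l : 'I_d) (w : OmegaX * Omegatau) : R :=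
    \sum_(i < k n) (component X l (tnth (tau n l w.2) i) w.1 - mu l) in
  (forall l : 'I_d,
    cvg_in_distribution PX
      (fun n w => Num.sqrt (k n)%:R * (M n l w - mu l)) PX (cst 0)) ->
  cvg_in_distribution (PX \x Ptau)%E
    (fun n w => \row_l (centered_sum n l w /
                          (Num.sqrt (k n)%:R * Num.sqrt (V n l w.1)))) PZ Z
  /\
  ((forall l : 'I_d, ergodic PX (component X l)) ->
   cvg_in_distribution (PX \x Ptau)%E
     (fun n w => \row_l (centered_sum n l w /
                           (Num.sqrt (k n)%:R * sigma l))) PZ Z).
Proof.
move=> mu M V sigma centered_sum kM.
have Y_field l := component_random_field X_field l.
have v0 l : {ae PX, forall w,
    0 < cond_exp PX (invariant_events PX (component X l))
      (fun w => (component X l index_origin w - mu l) ^+ 2) w}.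
  (* The positivity assumption concerns the variance around the conditional mean; the drift
     assumption identifies it with the limit of the averages centered at [mu l]. *)
  have := X_var l.
  by rewrite (cond_var_centered (Y_field l) (X_homogeneous l) (X_L2 l)
    (S_averaging l) k_infty (kM l)).
have Sfin l : \forall n \near \oo, (index_measure R K m (S l n) < +oo)%E.
  apply: (window_finite (Q := Ptau) (theta := fun n => tau n l)) => // n.
    by have [/(_ n)[]] := S_averaging l.
  by have [_ _ _ +] := tau_uniform n => /(_ l); exact.
have mM n l : measurable_fun setT (M n l).
  have [/(_ n)[mS _ _] _ _] := S_averaging l.
  exact: (measurable_space_average mS (field_jointly_measurable (Y_field l))).
have mV n l : measurable_fun setT (V n l).
  have [/(_ n)[mS _ _] _ _] := S_averaging l.
  apply: (measurable_space_average
    (g := fun p => (component X l p.1 p.2 - M n l p.2) ^+ 2) mS).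
  apply: measurable_funX; apply: measurable_funB.
    exact: (field_jointly_measurable (Y_field l)).
  exact: (measurableT_comp (mM n l) measurable_snd).
split.
  (* Here the normalizer is [V], whose almost sure limit is the third clause of [average_limits]. *)
  apply: (randomized_vector_cvg X_field X_homogeneous X_L2 S_averaging k_infty
    tau_uniform Z_normal kM mV) => // l.
  have := average_limits (Y_field l) (X_homogeneous l) (X_L2 l) (S_averaging l)
    (Sfin l) k_infty (kM l).
  by apply: filterS => w [].
move=> erg.
(* Here the normalizer is the constant variance, which ergodicity identifies almost surely with the
   limit of the averages. *)
apply: (randomized_vector_cvg X_field X_homogeneous X_L2 S_averaging k_infty
  tau_uniform Z_normal kM
  (N := fun _ l _ => fine 'V_PX[component X l index_origin])) => // l.
have := ergodic_cond_var (Y_field l) (X_L2 l) (erg l).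
by apply: filterS => w ->; exact: cvg_cst.
Qed.
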